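(* Let $(L,\omega,\psi_+,\psi_-)$ be a (non nearly-Kähler) Einstein coupled $\mathrm{SU}(3)$ manifold with $Scal(g_{\omega,\psi_+})=30$. Let $c$ denote the coupled constant, and consider $\theta(t)$ as follows: (i) if $\theta(t)=\arcsin\left(\frac{2t^{-2c}}{1+t^{-4c}}\right)$, then the $\mathrm{G}_2$-structure $\varphi$ on the manifold $M=(0,\infty)\times L$ given by $\varphi=t^2\,\omega\wedge dt+t^3(\cos\theta(t)\,\psi_+-\sin\theta(t)\,\psi_-)$ belongs to the class $\mathcal{X}_2\oplus\mathcal{X}_3\oplus\mathcal{X}_4$ and its induced metric is Ricci flat; (ii) if $\theta(t)=\arcsin\left(\frac{2(\tan\frac t2)^{-2c}}{1+(\tan\frac t2)^{-4c}}\right)$, then the $\mathrm{G}_2$-structure $\varphi$ on the manifold $M=(0,\pi)\times L$ given by $\varphi=\sin^2t\,\omega\wedge dt+\sin^3t(\cos\theta(t)\,\psi_+-\sin\theta(t)\,\psi_-)$ belongs to the class $\mathcal{X}_2\oplus\mathcal{X}_3\oplus\mathcal{X}_4$ and its induced metric is Einstein with $Scal(g_\varphi)=42$; (iii) if $\theta(t)=\arcsin\left(\frac{2(\tanh\frac t2)^{-2c}}{1+(\tanh\frac t2)^{-4c}}\right)$, then the $\mathrm{G}_2$-structure $\varphi$ on the manifold $M=(0,\infty)\times L$ given by $\varphi=\sinh^2t\,\omega\wedge dt+\sinh^3t(\cos\theta(t)\,\psi_+-\sin\theta(t)\,\psi_-)$ belongs to the class $\mathcal{X}_2\oplus\mathcal{X}_3\oplus\mathcal{X}_4$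 and its induced metric is Einstein with $Scal(g_\varphi)=-42$.
   Context: An $\mathrm{SU}(3)$-structure $(\omega,\psi_+,\psi_-)$ on a 6-manifold $L$ consists of a 2-form $\omega$ and 3-forms $\psi_\pm$ for which there are local coframes with $\omega=e^{12}+e^{34}+e^{56}$, $\psi_+=e^{135}-e^{146}-e^{236}-e^{245}$, $\psi_-=e^{136}+e^{145}+e^{235}-e^{246}$; such coframes are orthonormal for the induced metric $g_{\omega,\psi_+}$, with induced almost complex structure $J$. It is coupled if $d\omega=c\,\psi_+$ for a nonzero constant $c\in\mathbb{R}$ (the coupled constant); equivalently $d\omega=-\frac32\sigma_0\psi_+$, $d\psi_+=0$, $d\psi_-=\sigma_0\,\omega^2-\sigma_2\wedge\omega$ with $\sigma_0=-\frac{2c}{3}$ and $\sigma_2$ a 2-form with $J\sigma_2=\sigma_2$, $\sigma_2\wedge\omega^2=0$. It is nearly Kähler if $\sigma_2=0$; ''non nearly-Kähler'' means $\sigma_2\ne0$. ''Einstein'' means that the induced metric $g_{\omega,\psi_+}$ is Einstein. A $\mathrm{G}_2$-structure on a 7-manifold $M$ is a 3-form $\varphi$ locally of the form $e^{127}+e^{347}+e^{567}+e^{135}-e^{146}-e^{236}-e^{245}$ in coframes declared orthonormal and oriented (defining $g_\varphi$, $\ast_7$). Its torsion forms are the unique $\tau_0\in C^\infty(M)$, $\tau_1\in\Omega^1(M)$, $\tau_2\in\{\beta\in\Omega^2(M):\beta\wedge\ast_7\varphi=0\}$, $\tau_3\in\{\gamma\in\Omega^3(M):\gamma\wedge\varphi=0,\gamma\wedge\ast_7\varphi=0\}$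 with $d\varphi=\tau_0\ast_7\varphi+3\tau_1\wedge\varphi+\ast_7\tau_3$, $d\ast_7\varphi=4\tau_1\wedge\ast_7\varphi+\tau_2\wedge\varphi$. The class $\mathcal{X}_2\oplus\mathcal{X}_3\oplus\mathcal{X}_4$ is defined by $\tau_0=0$. Here $t$ is the coordinate on the interval factor.
   Formalization: With u = t, tan(t/2), tanh(t/2), arcsin is read as the principal value only where u^{-2c} ≤ 1 and as π − arcsin where u^{-2c} > 1; the principal value throughout makes φ non-smooth at u = 1 and τ₀ nonzero where u^{-2c} > 1. *)

(* Defs.v *)
From mathcomp Require Import all_boot all_order all_algebra perm.
From mathcomp Require Import all_classical all_reals all_analysis.

Set Implicit Arguments.
Unset Strict Implicit.
Unset Printing Implicit Defensive.

Import Order.TTheory GRing.Theory Num.Theory.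
Import numFieldNormedType.Exports.

Local Open Scope classical_set_scope.
Local Open Scope ring_scope.

Fixpoint Ck_on (R : realType) (n k : nat) (U : set 'rV[R]_n)
    (f : 'rV[R]_n -> R) : Prop :=
  if k is k'.+1 then
    (forall x, U x -> differentiable f x) /\
    (forall j : 'I_n, Ck_on k' U (fun x => 'D_(delta_mx 0 j) f x))
  else forall x, U x -> {for x, continuous f}.

Definition smooth_on (R : realType) (n : nat) (U : set 'rV[R]_n)
    (f : 'rV[R]_n -> R) : Prop :=
  forall k, Ck_on k U f.

(* [chart i] matters only on [dom i] and [para i] (its inverse) only on
   [img i]; elsewhere they take arbitrary values. *)
Record charts (R : realType) (T : Type) (n : nat) := Charts {
  idx : Type;
  dom : idx -> set T;
  chart : idx -> T -> 'rV[R]_n;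
  para : idx -> 'rV[R]_n -> T }.

Definition img (R : realType) (T : Type) (n : nat) (A : charts R T n)
    (i : idx A) : set 'rV[R]_n := chart i @` dom i.

Definition transition (R : realType) (T : Type) (n : nat) (A : charts R T n)
    (i j : idx A) (x : 'rV[R]_n) : 'rV[R]_n := chart j (para i x).

Definition overlap (R : realType) (T : Type) (n : nat) (A : charts R T n)
    (i j : idx A) : set 'rV[R]_n := [set x | img i x /\ dom j (para i x)].

Definition is_atlas (R : realType) (T : topologicalType) (n : nat)
    (A : charts R T n) : Prop :=
  [/\ forall p, exists i : idx A, dom i p,
      forall i : idx A, open (dom i) /\ open (img i),
      forall (i : idx A) p, dom i p ->
        {for p, continuous (chart i)} /\ para i (chart i p) = p,
      forall (i : idx A) x, img i x -> {for x, continuous (para i)}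
    & forall (i j : idx A) (a : 'I_n),
        smooth_on (overlap i j) (fun x => transition i j x 0 a)].

Definition smooth_manifold (R : realType) (T : topologicalType) (n : nat)
    (A : charts R T n) : Prop :=
  [/\ hausdorff_space T, @second_countable T & is_atlas A].

(* The product J x L of an open interval and a manifold, with the product
   charts (t, p) |-> (t, x(p)); t is the coordinate of index 0. *)
Definition cylinder (R : realType) (L : Type) (n : nat) (J : set R)
    (A : charts R L n) : charts R (R * L) (1 + n) :=
  Charts (idx := idx A)
    (fun i => J `*` dom i)
    (fun i q => row_mx (const_mx q.1 : 'rV[R]_1) (chart i q.2))
    (fun i y => (y 0 0, para i (rsubmx y))).

Definition covec (R : realType) (n k : nat) : Type := ('I_k -> 'rV[R]_n) -> R.

Definition multilinear (R : realType) (n k : nat) (a : covec R n k) : Prop :=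
  forall (v : 'I_k -> 'rV[R]_n) (i : 'I_k) (s : R) (u w : 'rV[R]_n),
    let upd z := fun j => if j == i then z else v j in
    a (upd (s *: u + w)) = s * a (upd u) + a (upd w).

Definition alternating_covec (R : realType) (n k : nat) (a : covec R n k) : Prop :=
  forall (v : 'I_k -> 'rV[R]_n) (i j : 'I_k), i != j -> v i = v j -> a v = 0.

Definition ewedge (R : realType) (n p q : nat) (a : covec R n p)
    (b : covec R n q) : covec R n (p + q) :=
  fun v => (p`!%:R * q`!%:R)^-1 *
    \sum_(s : {perm 'I_(p + q)}) (-1) ^+ s *
      a (fun i => v (s (lshift q i))) * b (fun j => v (s (rshift p j))).

(* A coframe (e^1, ..., e^n) at a point is encoded by the invertible matrix P
   whose i-th column lists the coefficients of e^i; [emon P [tuple i1; ..; ik]]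
   is the monomial e^{i1} /\ ... /\ e^{ik}, with indices starting at 1. *)
Definition emon (R : realType) (n k : nat) (P : 'M[R]_n.+1) (I : k.-tuple nat) :
    covec R n.+1 k :=
  fun v => \det (\matrix_(a, b) (v b *m P) 0 (inord (tnth I a).-1)).

Definition mon2 (R : realType) (n : nat) (P : 'M[R]_n.+1) (i j : nat) :=
  emon P [tuple i; j].
Definition mon3 (R : realType) (n : nat) (P : 'M[R]_n.+1) (i j k : nat) :=
  emon P [tuple i; j; k].

Definition ovec (R : realType) (n : nat) (i : 'I_n) : 'rV[R]_n := delta_mx 0 i.

Definition fcat (T : Type) (p q : nat) (u : 'I_p -> T) (v : 'I_q -> T) :
    'I_(p + q) -> T :=
  fun i => match fintype.split i with inl a => u a | inr b => v b end.

(* Hodge star of a p-form, in index notation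
     ( *b)_J = 1/p! g^{i1 k1} ... g^{ip kp} b_{i1 ... ip} vol_{k1 ... kp J},
   for the metric with Gram matrix G and the unit volume form vol; it is
   normalised by a /\ *b = <a, b> vol. *)
Definition hodge (R : realType) (p q : nat) (G : 'M[R]_(p + q))
    (vol : covec R (p + q) (p + q)) (b : covec R (p + q) p) :
    covec R (p + q) q :=
  fun v => (p`!%:R)^-1 *
    \sum_(I : {ffun 'I_p -> 'I_(p + q)}) \sum_(K : {ffun 'I_p -> 'I_(p + q)})
      (\prod_(a < p) invmx G (I a) (K a)) *
      b (fun a => ovec R (I a)) * vol (fcat (fun a => ovec R (K a)) v).

(* Tensor fields are families of local expressions, one for each chart. *)

Definition dform (R : realType) (T : Type) (n : nat) (A : charts R T n)
    (k : nat) : Type := idx A -> 'rV[R]_n -> covec R n k.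

Definition is_form (R : realType) (T : Type) (n : nat) (A : charts R T n)
    (k : nat) (a : dform A k) : Prop :=
  [/\ forall i x, img i x -> multilinear (a i x) /\ alternating_covec (a i x),
      forall i v, smooth_on (img i) (fun x => a i x v)
    & forall i j x, overlap i j x -> forall v,
        a i x v = a j (transition i j x)
                    (fun m => 'D_(v m) (transition i j) x)].

Definition is_smooth (R : realType) (T : Type) (n : nat) (A : charts R T n)
    (f : T -> R) : Prop :=
  forall i : idx A, smooth_on (img i) (fun x => f (para i x)).

Definition extd (R : realType) (n k : nat) (a : 'rV[R]_n -> covec R n k) :
    'rV[R]_n -> covec R n k.+1 :=
  fun x v => \sum_(i < k.+1)
    (-1) ^+ i * 'D_(v i) (fun y => a y (fun j => v (lift i j))) x.

Definition metric (R : realType) (T : Type) (n : nat) (A : charts R T n) : Type :=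
  idx A -> 'rV[R]_n -> 'M[R]_n.

Definition is_metric (R : realType) (T : Type) (n : nat) (A : charts R T n)
    (g : metric A) : Prop :=
  [/\ forall i x, img i x -> (g i x)^T = g i x,
      forall i x, img i x -> forall v : 'rV[R]_n, v != 0 ->
        0 < (v *m g i x *m v^T) 0 0,
      forall i (a b : 'I_n), smooth_on (img i) (fun x => g i x a b)
    & forall i j x, overlap i j x -> forall u v : 'rV[R]_n,
        u *m g i x *m v^T =
        'D_u (transition i j) x *m g j (transition i j x)
          *m ('D_v (transition i j) x)^T].

Definition pder (R : realType) (n : nat) (i : 'I_n) (f : 'rV[R]_n -> R) :
    'rV[R]_n -> R := fun x => 'D_(ovec R i) f x.

Definition christoffel (R : realType) (n : nat) (g : 'rV[R]_n -> 'M[R]_n)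
    (k i j : 'I_n) (x : 'rV[R]_n) : R :=
  2^-1 * \sum_(l < n) invmx (g x) k l *
    (pder i (fun y => g y j l) x + pder j (fun y => g y i l) x
     - pder l (fun y => g y i j) x).

(* With this sign convention round spheres have positive Ricci curvature. *)
Definition ricci (R : realType) (n : nat) (g : 'rV[R]_n -> 'M[R]_n)
    (x : 'rV[R]_n) : 'M[R]_n :=
  \matrix_(j, k) \sum_(i < n)
    (pder i (christoffel g i j k) x - pder j (christoffel g i i k) x
     + \sum_(p < n) (christoffel g i i p x * christoffel g p j k x
                     - christoffel g i j p x * christoffel g p i k x)).

Definition scal (R : realType) (n : nat) (g : 'rV[R]_n -> 'M[R]_n)
    (x : 'rV[R]_n) : R :=
  \tr (invmx (g x) *m ricci g x).

Definition einstein (R : realType) (T : Type) (n : nat) (A : charts R T n)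
    (g : metric A) : Prop :=
  exists lambda : R, forall i x, img i x -> ricci (g i) x = lambda *: g i x.

Definition ricci_flat (R : realType) (T : Type) (n : nat) (A : charts R T n)
    (g : metric A) : Prop :=
  forall i x, img i x -> ricci (g i) x = 0.

Definition scal_eq (R : realType) (T : Type) (n : nat) (A : charts R T n)
    (g : metric A) (s : R) : Prop :=
  forall i x, img i x -> scal (g i) x = s.

Definition local_coframes (R : realType) (T : Type) (n : nat) (A : charts R T n)
    (adapted : idx A -> 'rV[R]_n -> 'M[R]_n -> Prop) : Prop :=
  forall (i : idx A) x, img i x ->
    exists (U : set 'rV[R]_n) (P : 'rV[R]_n -> 'M[R]_n),
      [/\ open U, U x, U `<=` img i,
          forall a b, smooth_on U (fun y => P y a b)
        & forall y, U y -> P y \in unitmx /\ adapted i y (P y)].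

Definition SU3_coframe (R : realType) (P : 'M[R]_6) (w : covec R 6 2)
    (psip psim : covec R 6 3) : Prop :=
  [/\ forall v, w v = mon2 P 1 2 v + mon2 P 3 4 v + mon2 P 5 6 v,
      forall v, psip v =
        mon3 P 1 3 5 v - mon3 P 1 4 6 v - mon3 P 2 3 6 v - mon3 P 2 4 5 v
    & forall v, psim v =
        mon3 P 1 3 6 v + mon3 P 1 4 5 v + mon3 P 2 3 5 v - mon3 P 2 4 6 v].

(* [g] is the metric for which the adapted coframes are orthonormal.  It does
   not depend on the coframes, since the stabiliser of the forms lies in SO(6). *)
Definition SU3_structure (R : realType) (L : Type) (A : charts R L 6)
    (w : dform A 2) (psip psim : dform A 3) (g : metric A) : Prop :=
  [/\ is_form w, is_form psip /\ is_form psim, is_metric g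
    & local_coframes (A := A) (fun i x P =>
        SU3_coframe P (w i x) (psip i x) (psim i x) /\ g i x = P *m P^T)].

(* The matrix J, acting on row vectors on the right, with g(Ju, v) = w(u, v);
   in an adapted coframe, J E_1 = E_2, J E_3 = E_4 and J E_5 = E_6. *)
Definition Jmx (R : realType) (n : nat) (G : 'M[R]_n) (w : covec R n 2) :
    'M[R]_n :=
  (\matrix_(a, b) w (fun m : 'I_2 => if m == 0 then ovec R a else ovec R b))
    *m invmx G.

Definition coupled (R : realType) (L : Type) (A : charts R L 6)
    (w : dform A 2) (psip : dform A 3) (c : R) : Prop :=
  c != 0 /\
  forall i x, img i x -> forall v, extd (w i) x v = c * psip i x v.

Definition coupled_torsion (R : realType) (L : Type) (A : charts R L 6)
    (w : dform A 2) (psip psim : dform A 3) (g : metric A)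
    (sigma0 : R) (sigma2 : dform A 2) : Prop :=
  [/\ is_form sigma2,
      forall i x, img i x -> forall v,
        sigma2 i x (fun m => v m *m Jmx (g i x) (w i x)) = sigma2 i x v,
      forall i x, img i x -> forall v,
        ewedge (sigma2 i x) (ewedge (w i x) (w i x)) v = 0
    & forall i x, img i x ->
      [/\ forall v, extd (w i) x v = - (3 / 2) * sigma0 * psip i x v,
          forall v, extd (psip i) x v = 0
        & forall v, extd (psim i) x v =
            sigma0 * ewedge (w i x) (w i x) v - ewedge (sigma2 i x) (w i x) v]].

Definition nonzero_form (R : realType) (T : Type) (n : nat) (A : charts R T n)
    (k : nat) (a : dform A k) : Prop :=
  exists i x v, img i x /\ a i x v != 0.

Definition G2_coframe (R : realType) (P : 'M[R]_7) (phi : covec R 7 3) : Prop :=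
  forall v, phi v =
    mon3 P 1 2 7 v + mon3 P 3 4 7 v + mon3 P 5 6 7 v
    + mon3 P 1 3 5 v - mon3 P 1 4 6 v - mon3 P 2 3 6 v - mon3 P 2 4 5 v.

(* [g] and [vol] are the metric and the volume form for which the adapted
   coframes are orthonormal and oriented.  They do not depend on the coframes,
   since the stabiliser G2 of phi lies in SO(7). *)
Definition G2_structure (R : realType) (M : Type) (B : charts R M 7)
    (phi : dform B 3) (g : metric B) (vol : dform B 7) : Prop :=
  [/\ is_form phi, is_metric g, is_form vol
    & local_coframes (A := B) (fun i x P =>
        [/\ G2_coframe P (phi i x), g i x = P *m P^T
          & forall v, vol i x v = emon P [tuple 1; 2; 3; 4; 5; 6; 7]%N v])].

Definition G2_torsion (R : realType) (M : Type) (B : charts R M 7)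
    (phi : dform B 3) (g : metric B) (vol : dform B 7)
    (tau0 : M -> R) (tau1 : dform B 1) (tau2 : dform B 2) (tau3 : dform B 3) :
    Prop :=
  let star3 i x (b : covec R 7 3) : covec R 7 4 :=
    @hodge R 3 4 (g i x) (vol i x) b in
  let sphi : dform B 4 := fun i x => star3 i x (phi i x) in
  [/\ is_smooth B tau0, [/\ is_form tau1, is_form tau2 & is_form tau3],
      forall i x, img i x -> forall v, ewedge (tau2 i x) (sphi i x) v = 0,
      forall i x, img i x ->
        (forall v, ewedge (tau3 i x) (phi i x) v = 0) /\
        (forall v, ewedge (tau3 i x) (sphi i x) v = 0)
    & forall i x, img i x ->
        (forall v, extd (phi i) x v =
           tau0 (para i x) * sphi i x v + 3 * ewedge (tau1 i x) (phi i x) v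
           + star3 i x (tau3 i x) v) /\
        (forall v, extd (sphi i) x v =
           4 * ewedge (tau1 i x) (sphi i x) v + ewedge (tau2 i x) (phi i x) v)].

(* The class X_2 + X_3 + X_4; recall that the torsion forms are unique. *)
Definition class_X234 (R : realType) (M : Type) (B : charts R M 7)
    (phi : dform B 3) (g : metric B) (vol : dform B 7) : Prop :=
  exists (tau0 : M -> R) (tau1 : dform B 1) (tau2 : dform B 2) (tau3 : dform B 3),
    G2_torsion phi g vol tau0 tau1 tau2 tau3 /\
    forall i x, img (A := B) i x -> tau0 (para i x) = 0.

Definition pull (R : realType) (n k : nat) (a : covec R n k) :
    covec R (1 + n) k := fun v => a (fun m => rsubmx (v m)).

Definition dt (R : realType) (n : nat) : covec R (1 + n) 1 :=
  fun v => v ord0 0 0.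

Definition warped_G2 (R : realType) (L : Type) (J : set R) (A : charts R L 6)
    (w : dform A 2) (psip psim : dform A 3) (f theta : R -> R) :
    dform (cylinder J A) 3 :=
  fun i y v =>
    let t := y 0 0 in
    let x := rsubmx (y : 'rV[R]_(1 + 6)) in
    f t ^+ 2 * ewedge (pull (w i x)) (@dt R 6) v
    + f t ^+ 3 * (cos (theta t) * pull (psip i x) v
                  - sin (theta t) * pull (psim i x) v).
Arguments warped_G2 {R L} J {A}.

Definition sinh (R : realType) (t : R) : R := (expR t - expR (- t)) / 2.
Definition cosh (R : realType) (t : R) : R := (expR t + expR (- t)) / 2.
Definition tanh (R : realType) (t : R) : R := sinh t / cosh t.

(* The function arcsin (2 u^{-2c} / (1 + u^{-4c})) of u > 0.  Its argument
   reaches 1, at u = 1, and the principal value has a corner there, so arcsin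
   denotes the determination that equals the principal value where
   u^{-2c} <= 1 and continues smoothly, as pi - asin, where u^{-2c} > 1. *)
Definition theta_arcsin (R : realType) (c u : R) : R :=
  let s := 2 * u `^ (- 2 * c) / (1 + u `^ (- 4 * c)) in
  if u `^ (- 2 * c) <= 1 then asin s else pi - asin s.

(* Main.v *)
(* Since psi_+ + i psi_- is a complex volume form, cos theta psi_+ - sin theta psi_-
   is psi_+ rotated by theta, so phi induces the warped metric dt^2 + f^2 g
   whatever theta is.  Now g is Einstein with Ric g = 5 g, and in the three cases
   f'' = - kappa f and f'^2 = 1 - kappa f^2 with kappa = 0, 1, -1, hence
   dt^2 + f^2 g is Einstein with constant 6 kappa.  On the other hand,
   d omega = c psi_+ and d psi_- = sigma_0 omega^2 - sigma_2 /\ omega give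
     tau_0 = 4/7 (theta' + 2 c sin theta / f),
   and theta = 2 arctan (u^{-2c}) with u'/u = 1/f solves
   theta' = - 2 c sin theta / f.  The other torsion forms are then
     tau_1 = (f' - c/3 cos theta)/f dt,   tau_2 = - f cos theta sigma_2,
     tau_3 = sin theta (- c f^2 (cos theta psi_+ - sin theta psi_-)
                        + 4c/3 f omega /\ dt - f sigma_2 /\ dt).
   The pointwise identities between forms are checked by expanding both sides in
   monomials of a coframe and sorting these. *)
Require Import Defs.
From mathcomp Require Import all_boot all_order all_algebra perm.
From mathcomp Require Import all_classical all_reals all_analysis.
From mathcomp Require Import ring lra.

Set Implicit Arguments.
Unset Strict Implicit.
Unset Printing Implicit Defensive.

Import Order.TTheory GRing.Theory Num.Theory.
Import numFieldNormedType.Exports.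

Local Open Scope classical_set_scope.
Local Open Scope ring_scope.

(** * Exterior products of monomials in a coframe *)

(** No coframe is ever differentiated. Every form on the cylinder is a combination, with
    coefficients depending on t alone, of pullbacks from L and of their products with dt; its
    exterior derivative then follows from the structure equations on L and from the derivatives of
    f, sin theta and cos theta. For the same reason the volume form and star phi are given by global
    formulas in omega, psi_+, psi_- and dt. Coframes enter pointwise, to compare both sides of an
    identity. A form is a function of vectors and its wedge product a sum over permutations, too
    large to expand; hence monomials are encoded as lists of indices, wedge and Hodge star become
    list operations proved correct once, and a comparison leaves scalar equations modulo cos^2 = 1 -
    sin^2. This requires sigma_2 as a list too, so its type and primitivity are first turned into
    eight coefficients. Only sin theta and cos theta occur in the forms, and their derivatives are
    rational in sin theta, cos theta and f; so the explicit formula for theta is used only to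
    establish its differential equation. *)

Section BlockPerm.
Variables p q : nat.
Implicit Types (s : {perm 'I_p}) (t : {perm 'I_q}).

Definition block_fun s t (i : 'I_(p + q)) : 'I_(p + q) :=
  match fintype.split i with
  | inl a => lshift q (s a)
  | inr b => rshift p (t b)
  end.

Lemma block_fun_inj s t : injective (block_fun s t).
Proof.
move=> i j; rewrite /block_fun.
case: split_ordP => a ->; case: split_ordP => b -> //.
- by move/lshift_inj/perm_inj ->.
- by move/eqP; rewrite eq_lrshift.
- by move/eqP; rewrite eq_rlshift.
- by move/rshift_inj/perm_inj ->.
Qed.

Definition block_perm s t : {perm 'I_(p + q)} := perm (@block_fun_inj s t).

Lemma block_permL s t a : block_perm s t (lshift q a) = lshift q (s a).
Proof. by rewrite permE /block_fun (unsplitK (inl a)). Qed.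

Lemma block_permR s t b : block_perm s t (rshift p b) = rshift p (t b).
Proof. by rewrite permE /block_fun (unsplitK (inr b)). Qed.

(** A sign is the determinant of the permutation matrix, and the matrix of [block_perm s t] is block
    diagonal. *)
Lemma sgn_block_perm (R : comNzRingType) s t :
  (-1) ^+ block_perm s t = (-1) ^+ s * (-1) ^+ t :> R.
Proof.
rewrite -!det_perm -(det_lblock _ 0 _); congr (\det _); apply/matrixP => i j.
rewrite !mxE.
case: (split_ordP i) => a ->; rewrite ?block_permL ?block_permR;
  case: (split_ordP j) => b -> /=; rewrite ?(row_mxEl, row_mxEr) !mxE.
- by rewrite (inj_eq (@lshift_inj _ _)).
- by rewrite eq_lrshift.
- by rewrite eq_rlshift.
- by rewrite (inj_eq (@rshift_inj _ _)).
Qed.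

End BlockPerm.

Lemma fcat_lshift (T : Type) p q (u : 'I_p -> T) (v : 'I_q -> T) a :
  fcat u v (lshift q a) = u a.
Proof. by rewrite /fcat (unsplitK (inl a)). Qed.

Lemma fcat_rshift (T : Type) p q (u : 'I_p -> T) (v : 'I_q -> T) b :
  fcat u v (rshift p b) = v b.
Proof. by rewrite /fcat (unsplitK (inr b)). Qed.

(** Expanding the two inner determinants gives a sum over pairs of permutations. For a fixed pair,
    left translation by [block_perm s1 t1] absorbs it into the outer permutation, so each of the p!
    q! pairs contributes the full determinant, and the normalisation of [ewedge] cancels that
    number. *)
Lemma ewedge_det (R : realType) (n p q : nat) (F : 'I_p -> 'rV[R]_n -> R)
    (G : 'I_q -> 'rV[R]_n -> R) (v : 'I_(p + q) -> 'rV[R]_n) :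
  ewedge (fun u : 'I_p -> _ => \det (\matrix_(a, b) F a (u b)))
         (fun u : 'I_q -> _ => \det (\matrix_(a, b) G a (u b))) v =
  \det (\matrix_(a, b) fcat F G a (v b)).
Proof.
pose X (u : {perm 'I_(p + q)}) : R :=
  (-1) ^+ u * \prod_i fcat F G i (v (u i)).
have step (s : {perm 'I_(p + q)}) :
    (-1) ^+ s * \det (\matrix_(a, b) F a (v (s (lshift q b)))) *
      \det (\matrix_(a, b) G a (v (s (rshift p b)))) =
    \sum_(s1 : 'S_p) \sum_(t1 : 'S_q) X (block_perm s1 t1 * s)%g.
  rewrite -mulrA big_distrlr /= mulr_sumr; apply: eq_bigr => s1 _.
  rewrite mulr_sumr; apply: eq_bigr => t1 _.
  rewrite /X odd_permM signr_addb sgn_block_perm big_split_ord /=.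
  under eq_bigr => i _ do rewrite mxE.
  under [X in _ * (_ * (_ * X))]eq_bigr => i _ do rewrite mxE.
  under [X in _ = _ * (X * _)]eq_bigr => i _ do
    rewrite permM block_permL fcat_lshift.
  under [X in _ = _ * (_ * X)]eq_bigr => i _ do
    rewrite permM block_permR fcat_rshift.
  by rewrite mulrACA mulrC -[LHS]mulrA (mulrC _ (_ ^+ s)) mulrA.
rewrite /ewedge (eq_bigr _ (fun s _ => step s)).
rewrite exchange_big /=.
have step2 (s1 : 'S_p) (t1 : 'S_q) :
    \sum_s X (block_perm s1 t1 * s)%g = \det (\matrix_(a, b) fcat F G a (v b)).
  rewrite -(reindex_inj (h := fun s => (block_perm s1 t1 * s)%g)
    (F := X) (P := xpredT)); last exact: mulgI.
  by apply: eq_bigr => s _; congr (_ * _); apply: eq_bigr => i _; rewrite mxE.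
under eq_bigr => s1 _.
  rewrite exchange_big /= (eq_bigr _ (fun t _ => step2 s1 t)) sumr_const.
  over.
rewrite sumr_const !card_Sn -mulrnA -[\det _ *+ _]mulr_natl natrM mulrA.
rewrite (mulrC q`!%:R) mulVf ?mul1r// mulf_neq0// pnatr_eq0 -lt0n fact_gt0.
Qed.

(** [emon] with a plain list in place of a tuple, so that concatenating and sorting indices does not
    change types. Positions beyond the list read the default 0, that is column 0; statements
    therefore carry the length of the list. *)
Definition mono (R : realType) (n k : nat) (P : 'M[R]_n.+1) (I : seq nat) :
    covec R n.+1 k :=
  fun v => \det (\matrix_(a, b) (v b *m P) 0 (inord (nth 0%N I a).-1)).

Lemma emonE (R : realType) (n k : nat) (P : 'M[R]_n.+1) (I : k.-tuple nat) v :
  emon P I v = mono P I v.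
Proof.
by congr (\det _); apply/matrixP => a b; rewrite !mxE (tnth_nth 0%N).
Qed.

Lemma ewedge_mono (R : realType) (n p q : nat) (P : 'M[R]_n.+1) (I J : seq nat)
    (v : 'I_(p + q) -> 'rV[R]_n.+1) :
  size I = p -> size J = q ->
  ewedge (@mono R n p P I) (@mono R n q P J) v = mono P (I ++ J) v.
Proof.
move=> sI sJ; rewrite /mono.
rewrite (ewedge_det (fun (a : 'I_p) u => (u *m P) 0 (inord (nth 0%N I a).-1))
  (fun (a : 'I_q) u => (u *m P) 0 (inord (nth 0%N J a).-1))).
congr (\det _); apply/matrixP => a b; rewrite !mxE nth_cat sI.
case: (split_ordP a) => c ->; rewrite ?fcat_lshift ?fcat_rshift !mxE /= ?addKn //.
Qed.

(** * Normal forms of linear combinations of monomials *)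

Section MonoNormal.
Variables (R : realType) (n k : nat) (P : 'M[R]_n.+1).
Variable v : 'I_k -> 'rV[R]_n.+1.
Local Notation mon I := (@mono R n k P I v).

(** The two sides are determinants differing by a transposition of rows. The size condition places
    both rows among the k rows of the matrix. *)
Lemma mono_swap I x y J : (size I + (size J).+2 = k)%N ->
  mon (I ++ x :: y :: J) = - mon (I ++ y :: x :: J).
Proof.
move=> sz.
have ltI : (size I < k)%N by rewrite -sz -addSnnS ltn_addr.
have ltI1 : ((size I).+1 < k)%N by rewrite -sz !addnS !ltnS leq_addr.
pose i := Ordinal ltI; pose j := Ordinal ltI1.
have ij : i != j by rewrite -val_eqE /= neq_ltn leqnn.
rewrite /mono -[LHS]opprK; congr (- _).
have E : (-1 : R) = (-1) ^+ tperm i j by rewrite odd_tperm ij.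
rewrite -mulN1r E -det_perm -det_mulmx -row_permE; congr (\det _).
apply/matrixP => a b; rewrite !mxE.
suff -> : nth 0%N (I ++ x :: y :: J) (tperm i j a) =
  nth 0%N (I ++ y :: x :: J) a by [].
rewrite !nth_cat.
case: tpermP => [->|->|].
- by rewrite /= ltnNge leqnSn /= subSnn ltnn subnn.
- by rewrite /= ltnn subnn ltnNge leqnSn /= subSnn.
- move=> /eqP; rewrite -val_eqE /= => ai /eqP; rewrite -val_eqE /= => aj.
  case: ltnP => // Ia.
  have /subnK <- : ((size I).+2 <= a)%N.
    by rewrite ltn_neqAle eq_sym aj ltn_neqAle eq_sym ai.
  by rewrite -!addSnnS addnK.
Qed.

Lemma mono_dup I x J : (size I + (size J).+2 = k)%N ->
  mon (I ++ x :: x :: J) = 0.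
Proof.
move=> /(mono_swap x x)/eqP; rewrite -addr_eq0 -mulr2n -mulr_natl mulf_eq0.
by rewrite pnatr_eq0 /= => /eqP.
Qed.

(* Insertion sort, together with the parity of the sorting permutation; [None]
   signals a repeated index, for which the monomial vanishes. *)
Fixpoint sort_ins (x : nat) (l : seq nat) : option (bool * seq nat) :=
  if l is y :: l' then
    if Nat.eqb x y then None
    else if Nat.ltb x y then Some (false, x :: l)
    else match sort_ins x l' with
         | Some (b, l'') => Some (negb b, y :: l'')
         | None => None
         end
  else Some (false, [:: x]).

Fixpoint sort_sgn (l : seq nat) : option (bool * seq nat) :=
  if l is x :: l' then
    match sort_sgn l' with
    | Some (b, l'') =>
        match sort_ins x l'' with
        | Some (b', r) => Some (xorb b b', r)
        | None => None
        end
    | None => None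
    end
  else Some (false, [::]).

(** The prefix [I] collects the indices already passed, so that each step of the insertion is one
    adjacent swap inside a monomial of full length. *)
Lemma sort_insP x l I : (size I + (size l).+1 = k)%N ->
  match sort_ins x l with
  | Some (b, r) =>
      size r = (size l).+1 /\ mon (I ++ x :: l) = (-1) ^+ b * mon (I ++ r)
  | None => mon (I ++ x :: l) = 0
  end.
Proof.
elim: l I => [|y l IH] I /= sz; first by rewrite mul1r.
case E: (Nat.eqb x y).
  by rewrite (PeanoNat.Nat.eqb_eq x y).1 // mono_dup.
case: (Nat.ltb x y); first by rewrite mul1r.
have szr : (size (rcons I y) + (size l).+1 = k)%N.
  by rewrite size_rcons -sz addSnnS.
have := IH (rcons I y) szr.
case: (sort_ins x l) => [[b r]|]; rewrite mono_swap //.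
  rewrite !cat_rcons => -[szr' ->]; split; first by rewrite /= szr'.
  by case: b; rewrite /= ?expr0 ?expr1 ?mulN1r ?mul1r ?opprK.
by rewrite cat_rcons => ->; rewrite oppr0.
Qed.

Lemma sort_sgnP l I : (size I + size l = k)%N ->
  match sort_sgn l with
  | Some (b, r) =>
      size r = size l /\ mon (I ++ l) = (-1) ^+ b * mon (I ++ r)
  | None => mon (I ++ l) = 0
  end.
Proof.
elim: l I => [|x l IH] I /= sz; first by rewrite mul1r.
have szr : (size (rcons I x) + size l = k)%N by rewrite size_rcons addSnnS.
have := IH (rcons I x) szr; rewrite !cat_rcons.
case: (sort_sgn l) => [[b r]|] //; rewrite cat_rcons => -[szr' ->].
have szr2 : (size I + (size r).+1 = k)%N by rewrite szr'.
have := sort_insP x szr2.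
case: (sort_ins x r) => [[b' r']|]; last by move=> ->; rewrite mulr0.
rewrite szr' => -[-> ->]; split => //.
by rewrite mulrA -signr_addb; case: b; case: b'.
Qed.

(* A linear combination of monomials e^I, as a list of pairs (coefficient, I). *)
Definition sem (S : seq (R * seq nat)) : R :=
  foldr (fun x acc => x.1 * mon x.2 + acc) 0 S.

(** Stands in for [==] on lists because it reduces under the restricted unfolding of [sem_red]; the
    same holds of the tests with [Nat.eqb] elsewhere. *)
Fixpoint seq_eqn (I J : seq nat) : bool :=
  match I, J with
  | [::], [::] => true
  | x :: I', y :: J' => if Nat.eqb x y then seq_eqn I' J' else false
  | _, _ => false
  end.

Lemma seq_eqnP I J : seq_eqn I J -> I = J.
Proof.
elim: I J => [|x I IH] [|y J] //=.
by case E: (Nat.eqb x y) => // /IH ->; rewrite (PeanoNat.Nat.eqb_eq x y).1.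
Qed.

Fixpoint add_term (c : R) (I : seq nat) (S : seq (R * seq nat)) :=
  if S is x :: S' then
    if seq_eqn I x.2 then (x.1 + c, x.2) :: S' else x :: add_term c I S'
  else [:: (c, I)].

Lemma sem_add_term c I S : sem (add_term c I S) = c * mon I + sem S.
Proof.
elim: S => //= x S IH; case: ifP => [/seq_eqnP -> /=|_ /=].
  by rewrite mulrDl (addrC (_ * _)) addrA.
by rewrite IH addrCA.
Qed.

Definition nform (S : seq (R * seq nat)) : seq (R * seq nat) :=
  foldr (fun x acc =>
    match sort_sgn x.2 with
    | Some (b, r) => add_term (if b then - x.1 else x.1) r acc
    | None => acc
    end) [::] S.

Definition sizes_ok (S : seq (R * seq nat)) : bool :=
  foldr (fun x acc => if Nat.eqb (size x.2) k then acc else false) true S.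

Lemma sem_nform S : sizes_ok S -> sem (nform S) = sem S.
Proof.
elim: S => //= x S IH; case E: (Nat.eqb _ _) => // /IH <-.
have sz : (size (@nil nat) + size x.2 = k)%N by exact/PeanoNat.Nat.eqb_eq.
have := sort_sgnP sz; rewrite !cat0s.
case: (sort_sgn x.2) => [[b r] [_ ->]|->]; last by rewrite mulr0 add0r.
by rewrite sem_add_term; case: b; rewrite ?expr0 ?expr1 ?mul1r// mulN1r mulrN mulNr.
Qed.

Definition zero_coefs (S : seq (R * seq nat)) : Prop :=
  foldr (fun x acc => x.1 = 0 /\ acc) True S.

Lemma sem_eq0 S : sizes_ok S -> zero_coefs (nform S) -> sem S = 0.
Proof.
move=> /sem_nform <-; elim: (nform S) => //= x T IH [-> /IH ->].
by rewrite mul0r addr0.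
Qed.

Definition sscale (c : R) (S : seq (R * seq nat)) : seq (R * seq nat) :=
  [seq (c * x.1, x.2) | x <- S].

Lemma sem_cat S T : sem (S ++ T) = sem S + sem T.
Proof. by elim: S => [|x S IH] /=; rewrite ?add0r // IH addrA. Qed.

Lemma sem_scale c S : sem (sscale c S) = c * sem S.
Proof. by elim: S => [|x S IH] /=; rewrite ?mulr0 // IH mulrDr mulrA. Qed.

(** The way from an identity of forms to scalars: the first hypothesis is decided by computation,
    and the second reduces to one equation in R for each sorted monomial of the difference. *)
Lemma sem_eq S T : sizes_ok (S ++ sscale (-1) T) ->
  zero_coefs (nform (S ++ sscale (-1) T)) -> sem S = sem T.
Proof.
move=> h1 h2; have := sem_eq0 h1 h2; rewrite sem_cat sem_scale mulN1r.
by move/eqP; rewrite subr_eq0 => /eqP.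
Qed.

End MonoNormal.

Section Swedge.
Variables (R : realType).

Fixpoint swedge (S T : seq (R * seq nat)) : seq (R * seq nat) :=
  if S is x :: S' then
    [seq (x.1 * y.1, x.2 ++ y.2) | y <- T] ++ swedge S' T
  else [::].

Lemma ewedgeDl (n p q : nat) (a a' : covec R n p) (b : covec R n q) v :
  ewedge (fun u => a u + a' u) b v = ewedge a b v + ewedge a' b v.
Proof.
rewrite /ewedge -mulrDr -big_split; congr (_ * _); apply: eq_bigr => s _ /=.
by rewrite mulrDr mulrDl.
Qed.

Lemma ewedgeDr (n p q : nat) (a : covec R n p) (b b' : covec R n q) v :
  ewedge a (fun u => b u + b' u) v = ewedge a b v + ewedge a b' v.
Proof.
rewrite /ewedge -mulrDr -big_split; congr (_ * _); apply: eq_bigr => s _ /=.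
by rewrite mulrDr.
Qed.

Lemma ewedgeZl (n p q : nat) c (a : covec R n p) (b : covec R n q) v :
  ewedge (fun u => c * a u) b v = c * ewedge a b v.
Proof.
rewrite /ewedge mulrCA [in RHS]mulr_sumr; congr (_ * _); apply: eq_bigr => s _.
by rewrite mulrCA !mulrA.
Qed.

Lemma ewedgeZr (n p q : nat) c (a : covec R n p) (b : covec R n q) v :
  ewedge a (fun u => c * b u) v = c * ewedge a b v.
Proof.
rewrite /ewedge mulrCA [in RHS]mulr_sumr; congr (_ * _); apply: eq_bigr => s _.
by rewrite mulrCA.
Qed.

Lemma ewedge0l (n p q : nat) (b : covec R n q) v :
  @ewedge R n p q (fun u => 0) b v = 0.
Proof. by rewrite /ewedge big1 ?mulr0// => s _; rewrite mulr0 mul0r. Qed.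

Lemma ewedge0r (n p q : nat) (a : covec R n p) v :
  @ewedge R n p q a (fun u => 0) v = 0.
Proof. by rewrite /ewedge big1 ?mulr0// => s _; rewrite mulr0. Qed.

Lemma ewedge_sem (n p q : nat) (P : 'M[R]_n.+1) S T v :
  sizes_ok p S -> sizes_ok q T ->
  @ewedge R n.+1 p q (fun u => sem P u S) (fun u => sem P u T) v =
  sem P v (swedge S T).
Proof.
elim: S => [|x S IH] /=; first by rewrite ewedge0l.
case E: (Nat.eqb _ _) => // /IH{}IH szT.
rewrite sem_cat ewedgeDl IH //; congr (_ + _).
elim: T szT {IH} => [|y T IH] /=; first by rewrite ewedge0r.
case F: (Nat.eqb _ _) => // /IH{}IH.
rewrite ewedgeDr IH; congr (_ + _).
rewrite ewedgeZl ewedgeZr ewedge_mono ?mulrA //; exact/PeanoNat.Nat.eqb_eq.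
Qed.

(** An equality of functions, so that it rewrites inside nested wedge products. *)
Lemma ewedge_semf (n p q : nat) (P : 'M[R]_n.+1) S T :
  sizes_ok p S -> sizes_ok q T ->
  @ewedge R n.+1 p q (fun u => sem P u S) (fun u => sem P u T) =
  (fun v => sem P v (swedge S T)).
Proof. by move=> pS qT; apply/funext => v; apply: ewedge_sem. Qed.

End Swedge.

(** * Exterior derivative of products *)

Section Pointwise.
Variables (R : realType) (V : normedModType R).
Implicit Types (f g : V -> R) (x v : V).

Lemma is_derive_suml (I : Type) (r : seq I) (h : I -> V -> R) (dh : I -> R) x v :
  (forall i, is_derive x v (h i) (dh i)) ->
  is_derive x v (fun y => \sum_(i <- r) h i y) (\sum_(i <- r) dh i).
Proof.
move=> H; elim: r => [|i r IH].
  rewrite big_nil (_ : (fun y => _) = cst 0); first exact: is_derive_cst.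
  by apply/funext => y; rewrite big_nil.
rewrite big_cons (_ : (fun y => _) = h i + (fun y => \sum_(j <- r) h j y)).
  exact: is_deriveD.
by apply/funext => y; rewrite big_cons.
Qed.

Lemma is_deriveMl f df (c : R) x v :
  is_derive x v f df -> is_derive x v (fun y => c * f y) (c * df).
Proof. by move=> H; have := is_deriveZ c H. Qed.

Lemma is_derive_mul f g df dg x v :
  is_derive x v f df -> is_derive x v g dg ->
  is_derive x v (fun y => f y * g y) (df * g x + f x * dg).
Proof.
move=> Hf Hg; have H : is_derive x v (f * g) _ := is_deriveM Hf Hg.
by apply: (is_derive_eq H); rewrite addrC [g x *: df]mulrC.
Qed.

Lemma is_derive_add f g df dg x v :
  is_derive x v f df -> is_derive x v g dg ->
  is_derive x v (fun y => f y + g y) (df + dg).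
Proof. by move=> Hf Hg; have := is_deriveD Hf Hg. Qed.

Lemma is_derive_inv f df x v : f x != 0 ->
  is_derive x v f df -> is_derive x v (fun y => (f y)^-1) (- (df / f x ^+ 2)).
Proof.
move=> fx [D E]; split; first exact: derivableV.
by rewrite (deriveV fx D) E /GRing.scale /= mulNr mulrC.
Qed.

End Pointwise.

(** A permutation amounts to the image of the first slot and a permutation of the others. The
    correspondence is injective between sets of equal size, hence bijective. *)
Lemma sum_perm_lift (R : nmodType) (n : nat) (F : {perm 'I_n.+1} -> R) :
  \sum_s F s = \sum_(i < n.+1) \sum_(s : {perm 'I_n}) F (lift_perm ord0 i s).
Proof.
rewrite pair_bigA /=.
pose h (u : 'I_n.+1 * {perm 'I_n}) := lift_perm ord0 u.1 u.2.
have hinj : injective h.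
  move=> [i s] [j t]; rewrite /h /= => E.
  have ij : i = j by rewrite -(lift_perm_id ord0 i s) -[RHS](lift_perm_id ord0 j t) E.
  move: t E; rewrite -ij => t E; congr pair; apply/permP => k.
  by apply: (@lift_inj _ i); rewrite -!(lift_perm_lift ord0) E.
rewrite (reindex h) //; apply: onW_bij; apply: inj_card_bij => //.
by rewrite card_prod card_ord !card_Sn factS.
Qed.

Section ExteriorDerivative.
Variables (R : realType) (n : nat).
Implicit Types (x v : 'rV[R]_n).

Definition derivable_form (k : nat) (a : 'rV[R]_n -> covec R n k) x :=
  forall u v, derivable (fun y => a y u) x v.

Lemma extdD k (a b : 'rV[R]_n -> covec R n k) x u :
  derivable_form a x -> derivable_form b x ->
  extd (fun y w => a y w + b y w) x u = extd a x u + extd b x u.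
Proof.
move=> da db; rewrite /extd -big_split; apply: eq_bigr => i _ /=.
rewrite -mulrDr; congr (_ * _).
by apply: derive_val; apply: is_derive_add; apply: derivableP.
Qed.

(** The alternating sum is dF /\ a, left written out; [dt_sem] later converts it when F depends on t
    alone. *)
Lemma extdM k (F : 'rV[R]_n -> R) (a : 'rV[R]_n -> covec R n k) x u :
  (forall v, derivable F x v) -> derivable_form a x ->
  extd (fun y w => F y * a y w) x u =
  \sum_(i < k.+1) (-1) ^+ i * ('D_(u i) F x * a x (fun j => u (lift i j)))
  + F x * extd a x u.
Proof.
move=> dF da; rewrite /extd mulr_sumr -big_split; apply: eq_bigr => i _ /=.
rewrite [X in _ = _ + X]mulrCA -mulrDr; congr (_ * _).
by apply: derive_val; apply: is_derive_mul; apply: derivableP.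
Qed.

Lemma is_derive_ewedgel p q (a : 'rV[R]_n -> covec R n p) (b : covec R n q) x v u :
  derivable_form a x ->
  is_derive x v (fun y => ewedge (a y) b u) (ewedge (fun w => 'D_v (a^~ w) x) b u).
Proof.
move=> da; rewrite /ewedge; apply: is_deriveMl; apply: is_derive_suml => s.
under eq_fun do rewrite mulrAC.
by rewrite mulrAC; apply: is_deriveMl; apply: derivableP.
Qed.

(* Both sides are sums over the permutations of p + q + 1 slots; such a
   permutation is the image of the first slot, where the derivative acts,
   together with a permutation of the remaining ones. *)
Lemma extd_ewedge_cst p q (a : 'rV[R]_n -> covec R n p) (b : covec R n q) x
    (u : 'I_(p.+1 + q) -> 'rV[R]_n) :
  derivable_form a x ->
  @extd R n (p + q) (fun y => ewedge (a y) b) x u =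
  @ewedge R n p.+1 q (extd a x) b u.
Proof.
move=> da.
pose X (s : {perm 'I_(p + q).+1}) : R := (-1) ^+ s *
  'D_(u (s ord0)) (a^~ (fun m => u (s (lift ord0 (lshift q m))))) x *
  b (fun m => u (s (lift ord0 (rshift p m)))).
transitivity ((p`!%:R * q`!%:R)^-1 * \sum_s X s).
  rewrite sum_perm_lift mulr_sumr; apply: eq_bigr => i _.
  rewrite (@derive_val _ _ _ _ _ _ _ (is_derive_ewedgel b _ _ da)) /ewedge.
  rewrite mulrCA; congr (_ * _); rewrite mulr_sumr; apply: eq_bigr => s _.
  rewrite /X odd_lift_perm /= signr_addb signr_odd !mulrA lift_perm_id.
  congr (_ * _ * _).
    by congr ('D_(_) _ x); apply/funext => y; congr (a y _); apply/funext => m;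
      rewrite lift_perm_lift.
  by congr b; apply/funext => m; rewrite lift_perm_lift.
(* On the right the derivative may act in any of p + 1 slots. The cycle [t] moves slot j to the
   front, with sign (-1)^j, so all slots give the same sum; their number turns (p+1)! into p!. *)
have key (j : 'I_p.+1) :
    \sum_(s : {perm 'I_(p.+1 + q)}) (-1) ^+ s * ((-1) ^+ j *
      'D_(u (s (lshift q j))) (a^~ (fun m => u (s (lshift q (lift j m))))) x) *
      b (fun m => u (s (rshift p.+1 m))) = \sum_s X s.
  pose t : {perm 'I_p.+1} := lift_perm ord0 j 1.
  rewrite [RHS](reindex_inj (h := fun s => (block_perm t (1 : 'S_q) * s)%g)) /=;
    last exact: mulgI.
  apply: eq_bigr => s _; rewrite /X.
  have E0 : (block_perm t (1 : 'S_q) * s)%g ord0 = s (lshift q j).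
    rewrite permM; congr (s _).
    rewrite (_ : ord0 = lshift q (ord0 : 'I_p.+1)); last exact: val_inj.
    by rewrite block_permL lift_perm_id.
  have E1 m : (block_perm t (1 : 'S_q) * s)%g (lift ord0 (lshift q m)) =
      s (lshift q (lift j m)).
    rewrite permM; congr (s _).
    rewrite (_ : lift ord0 (lshift q m) = lshift q (lift (ord0 : 'I_p.+1) m));
      last exact: val_inj.
    by rewrite block_permL lift_perm_lift perm1.
  have E2 m : (block_perm t (1 : 'S_q) * s)%g (lift ord0 (rshift p m)) =
      s (rshift p.+1 m).
    rewrite permM; congr (s _).
    rewrite (_ : lift ord0 (rshift p m) = rshift p.+1 m); last exact: val_inj.
    by rewrite block_permR perm1.
  rewrite E0 odd_permM signr_addb.
  rewrite (sgn_block_perm R t (1 : 'S_q)) odd_lift_perm !odd_perm1.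
  rewrite expr0 mulr1 /= addbF signr_odd mulrA [in LHS](mulrC (_ ^+ s)).
  congr (_ * _ * _).
    by congr ('D_(_) _ x); apply/funext => y; congr (a y _); apply/funext => m;
      rewrite E1.
  by congr b; apply/funext => m; rewrite E2.
rewrite /ewedge /extd.
under [X in _ = _ * X]eq_bigr do rewrite mulr_sumr mulr_suml.
rewrite [in RHS]exchange_big /= (eq_bigr _ (fun j _ => key j)) sumr_const card_ord.
rewrite -[(\sum_s X s) *+ _]mulr_natl mulrA; congr (_ * _).
by rewrite factS natrM -mulrA [in RHS]invfM mulrAC mulVf ?mul1r //.
Qed.

End ExteriorDerivative.

(** * The Hodge star in an orthonormal frame *)

Definition fcons (T : Type) (k : nat) (x : T) (w : 'I_k -> T) : 'I_k.+1 -> T :=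
  fun i => if unlift ord0 i is Some j then w j else x.

Lemma fcons0 (T : Type) k (x : T) (w : 'I_k -> T) : fcons x w ord0 = x.
Proof. by rewrite /fcons unlift_none. Qed.

Lemma fconsS (T : Type) k (x : T) (w : 'I_k -> T) i : fcons x w (lift ord0 i) = w i.
Proof. by rewrite /fcons liftK. Qed.

Lemma fcons_eta (T : Type) k (u : 'I_k.+1 -> T) :
  u = fcons (u ord0) (fun i => u (lift ord0 i)).
Proof.
by apply/funext => i; case: (unliftP ord0 i) => [j|] ->; rewrite ?fconsS ?fcons0.
Qed.

Lemma sum_ffun_cons (R : nmodType) (k m : nat) (F : {ffun 'I_k.+1 -> 'I_m} -> R) :
  \sum_f F f = \sum_(j < m) \sum_(f : {ffun 'I_k -> 'I_m}) F [ffun i => fcons j f i].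
Proof.
rewrite pair_bigA /=.
pose h (u : 'I_m * {ffun 'I_k -> 'I_m}) := [ffun i => fcons u.1 u.2 i].
have hinj : injective h.
  move=> [i s] [j t] /ffunP; rewrite /h /= => E; congr pair.
    by have := E ord0; rewrite !ffunE !fcons0.
  by apply/ffunP => l; have := E (lift ord0 l); rewrite !ffunE !fconsS.
rewrite (reindex h) //; apply: onW_bij; apply: inj_card_bij => //.
by rewrite card_prod !card_ffun !card_ord expnS.
Qed.

Lemma multilinear_cons (R : realType) (n k : nat) (a : covec R n k.+1) x :
  multilinear a -> multilinear (fun w => a (fcons x w)).
Proof.
move=> ma v i s u w /=.
have E z : (fun j => if j == lift ord0 i then z else fcons x v j) =
    fcons x (fun j => if j == i then z else v j).
  rewrite [LHS]fcons_eta; congr fcons; first by rewrite fcons0.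
  by apply/funext => j; rewrite fconsS (inj_eq lift_inj).
by have := ma (fcons x v) (lift ord0 i) s u w; rewrite /= !E.
Qed.

Lemma multilinear_suml (R : realType) (n k m : nat) (a : covec R n k.+1)
    (c : 'I_m -> R) (E : 'I_m -> 'rV[R]_n) w :
  multilinear a ->
  a (fcons (\sum_j c j *: E j) w) = \sum_j c j * a (fcons (E j) w).
Proof.
move=> ma.
have U x z : (fun j => if j == ord0 then z else fcons x w j) = fcons z w.
  rewrite [LHS]fcons_eta; congr fcons.
  by apply/funext => j; rewrite fconsS.
have lin s u z : a (fcons (s *: u + z) w) = s * a (fcons u w) + a (fcons z w).
  by have := ma (fcons 0 w) ord0 s u z; rewrite /= !U.
have a0 : a (fcons 0 w) = 0.
  have := lin 1 0 0; rewrite scaler0 addr0 mul1r => /eqP.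
  by rewrite -subr_eq subrr eq_sym => /eqP.
elim/big_rec2: _ => // j y z _ <-.
exact: lin.
Qed.

Lemma multilinear_expand (R : realType) (n k m : nat) (a : covec R n k)
    (c : 'I_k -> 'I_m -> R) (E : 'I_m -> 'rV[R]_n) :
  multilinear a ->
  a (fun i => \sum_j c i j *: E j) =
  \sum_(f : {ffun 'I_k -> 'I_m}) (\prod_i c i (f i)) * a (fun i => E (f i)).
Proof.
elim: k a c => [|k IH] a c ma.
  rewrite (eq_bigr (fun=> a (fun i => \sum_j c i j *: E j))).
    by rewrite sumr_const card_ffun !card_ord expn0.
  by move=> f _; rewrite big_ord0 mul1r; congr a; apply/funext => -[].
rewrite sum_ffun_cons [X in a X]fcons_eta multilinear_suml //.
apply: eq_bigr => j _; 
have /= -> := IH (fun w => a (fcons (E j) w)) (fun i => c (lift ord0 i))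
  (multilinear_cons (E j) ma).
rewrite mulr_sumr; apply: eq_bigr => f _.
rewrite mulrA big_ord_recl ffunE fcons0.
under [X in _ = _ * X * _]eq_bigr do rewrite ffunE fconsS.
congr (_ * a _); rewrite [RHS]fcons_eta ffunE fcons0; congr fcons.
by apply/funext => i; rewrite ffunE fconsS.
Qed.

Section MonoMultilinear.
Variables (R : realType) (n k : nat) (P : 'M[R]_n.+1) (I : seq nat).

Lemma mono_tr (v : 'I_k -> 'rV[R]_n.+1) :
  mono P I v = \det (\matrix_(b, a) (v b *m P) 0 (inord (nth 0%N I a).-1)).
Proof.
by rewrite /mono -det_tr; congr (\det _); apply/matrixP => a b; rewrite !mxE.
Qed.

Lemma mono_multilinear : multilinear (@mono R n k P I).
Proof.
move=> v i s u w /=; rewrite !mono_tr.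
rewrite -[X in _ = _ + X]mul1r; apply: (determinant_multilinear (i0 := i)).
- apply/rowP => a; rewrite !mxE eqxx mul1r mulr_sumr -big_split.
  by apply: eq_bigr => j _; rewrite !mxE mulrDl mulrA.
- by apply/matrixP => a b; rewrite !mxE eq_sym (negPf (neq_lift _ _)).
- by apply/matrixP => a b; rewrite !mxE eq_sym (negPf (neq_lift _ _)).
Qed.

Lemma mono_alternating : alternating_covec (@mono R n k P I).
Proof.
move=> v i j ij vij; rewrite mono_tr; apply: (determinant_alternate ij).
by move=> a; rewrite !mxE vij.
Qed.

Lemma mono_perm (v : 'I_k -> 'rV[R]_n.+1) (s : {perm 'I_k}) :
  mono P I (fun i => v (s i)) = (-1) ^+ s * mono P I v.
Proof.
rewrite !mono_tr -det_perm -det_mulmx -row_permE.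
by congr (\det _); apply/matrixP => a b; rewrite !mxE.
Qed.

End MonoMultilinear.

Lemma sem_multilinear (R : realType) (n k : nat) (P : 'M[R]_n.+1) S :
  @multilinear R n.+1 k (fun v => sem P v S).
Proof.
elim: S => [|x S IH] v i s u w /=; first by rewrite mulr0 addr0.
rewrite mono_multilinear IH /=.
move: (mono _ _ _) (mono _ _ _) (sem _ _ _) (sem _ _ _) => a b a' b'; ring.
Qed.

Lemma sem_alternating (R : realType) (n k : nat) (P : 'M[R]_n.+1) S :
  @alternating_covec R n.+1 k (fun v => sem P v S).
Proof.
elim: S => //= x S IH v i j ij vij.
by rewrite (IH v i j) // (mono_alternating _ _ ij) // mulr0 addr0.
Qed.

Section DualFrame.
Variables (R : realType) (n : nat) (P : 'M[R]_n).
Hypothesis Punit : P \in unitmx.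

Lemma invmx_gram i j :
  invmx (P *m P^T) i j = \sum_m invmx P m i * invmx P m j.
Proof.
have E : invmx (P *m P^T) = (invmx P)^T *m invmx P.
  have U : P *m P^T \in unitmx by rewrite unitmx_mul unitmx_tr Punit.
  apply: (can_inj (mulmxK U)); rewrite mulVmx //.
  rewrite mulmxA -(mulmxA _ (invmx P)) mulVmx // mulmx1 -trmx_mul mulmxV //.
  by rewrite trmx1.
by rewrite E mxE; apply: eq_bigr => m _; rewrite mxE.
Qed.

(** The vectors E_m with e^i(E_m) = delta: column i of [P] is e^i, so e^i(u) is entry i of
    [u *m P]. *)
Definition dual_frame (m : 'I_n) : 'rV[R]_n := row m (invmx P).

Lemma dual_frameE m : dual_frame m = \sum_i invmx P m i *: ovec R i.
Proof.
by rewrite [LHS]row_sum_delta; apply: eq_bigr => i _; rewrite mxE.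
Qed.

Lemma dual_frame_mul m i : (dual_frame m *m P) 0 i = (m == i)%:R.
Proof. by rewrite -row_mul mulVmx // !mxE. Qed.

Lemma dual_frame_decomp (u : 'rV[R]_n) : u = \sum_i (u *m P) 0 i *: dual_frame i.
Proof. by rewrite -mulmx_sum_row mulmxK. Qed.

Lemma multilinear_frame_ext k (a b : covec R n k) :
  multilinear a -> multilinear b ->
  (forall f : {ffun 'I_k -> 'I_n},
     a (fun i => dual_frame (f i)) = b (fun i => dual_frame (f i))) ->
  forall v, a v = b v.
Proof.
move=> ma mb ab v.
rewrite (_ : v = fun i => \sum_j (v i *m P) 0 j *: dual_frame j); last first.
  by apply/funext => i; apply: dual_frame_decomp.
rewrite (multilinear_expand _ _ ma) (multilinear_expand _ _ mb).
by apply: eq_bigr => f _; rewrite ab.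
Qed.

End DualFrame.

Section Hodge.
Variables (R : realType) (p q : nat).
Local Notation N := (p.+1 + q)%N.
Variable P : 'M[R]_N.
Hypothesis Punit : P \in unitmx.
Local Notation dual_frame := (dual_frame P).

(** The inverse metric is the sum of E_m (x) E_m over the orthonormal frame, so the double sum over
    coordinate indices contracts to a single sum over frame indices. *)
Lemma hodge_frame (vol : covec R N N) (b : covec R N p.+1) (v : 'I_q -> 'rV[R]_N) :
  multilinear b -> multilinear (fun w => vol (fcat w v)) ->
  hodge (P *m P^T) vol b v = (p.+1`!%:R)^-1 *
    \sum_(f : {ffun 'I_p.+1 -> 'I_N})
      b (fun a => dual_frame (f a)) * vol (fcat (fun a => dual_frame (f a)) v).
Proof.
move=> mb mv; rewrite /hodge; congr (_ * _).
under eq_bigr => I _.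
  under eq_bigr => K _.
    under eq_bigr => a _ do rewrite (invmx_gram Punit).
    rewrite bigA_distr_bigA /= -mulrA mulr_suml.
    over.
  rewrite exchange_big /=.
  over.
rewrite exchange_big /=; apply: eq_bigr => f _.
have -> : (fun a => dual_frame (f a)) =
    (fun a => \sum_i invmx P (f a) i *: ovec R i).
  by apply/funext => a; rewrite dual_frameE.
rewrite (multilinear_expand _ _ mb) (multilinear_expand _ _ mv) big_distrlr /=.
apply: eq_bigr => I _; apply: eq_bigr => K _.
by rewrite big_split /= mulrACA mulrA.
Qed.

End Hodge.

Lemma fcat_block_perm (T : Type) p q (w : 'I_p -> T) (v : 'I_q -> T) (s : {perm 'I_p}) :
  fcat (fun a => w (s a)) v = (fun i => fcat w v (block_perm s (1 : 'S_q)%g i)).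
Proof.
apply/funext => i; case: (split_ordP i) => a ->.
  by rewrite block_permL !fcat_lshift.
by rewrite block_permR !fcat_rshift perm1.
Qed.

Lemma multilinear_fcat (R : realType) n p q (a : covec R n (p + q)) (v : 'I_q -> 'rV[R]_n) :
  multilinear a -> multilinear (fun w => a (fcat w v)).
Proof.
move=> ma w i s x y /=.
have E z : fcat (fun j => if j == i then z else w j) v =
    (fun j => if j == lshift q i then z else fcat w v j).
  apply/funext => j; case: (split_ordP j) => l ->.
    by rewrite !fcat_lshift (inj_eq (@lshift_inj _ _)).
  by rewrite !fcat_rshift eq_rlshift.
by have := ma (fcat w v) (lshift q i) s x y; rewrite /= !E.
Qed.

Section HodgeMono.
Variables (R : realType) (p q : nat).
Local Notation N := (p.+1 + q)%N.
Variable P : 'M[R]_N.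
Hypothesis Punit : P \in unitmx.
Local Notation K := (iota 1 N).
Local Notation col_of x := (inord x.-1 : 'I_(p + q).+1).

(** When e^I is expanded over permutations s, only the multi-index g o s^-1 survives. Since vol is
    alternating, the sign of s cancels and each s contributes vol(E_I, v); the factorial in [hodge]
    cancels their number. *)
Lemma hodge_mono_dual I v :
  hodge (P *m P^T) (@mono R (p + q) N P K) (@mono R (p + q) p.+1 P I) v =
  @mono R (p + q) N P K (fcat (fun a : 'I_p.+1 => dual_frame P (col_of (nth 0%N I a))) v).
Proof.
rewrite hodge_frame //; first last.
- exact/multilinear_fcat/mono_multilinear.
- exact: mono_multilinear.
set g := fun a : 'I_p.+1 => col_of (nth 0%N I a).
set vol := fun w => @mono R (p + q) N P K (fcat w v).
have volP (s : 'S_p.+1) w : vol (fun a => w (s a)) = (-1) ^+ s * vol w.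
  rewrite /vol fcat_block_perm mono_perm (sgn_block_perm R s (1 : 'S_q)).
  by rewrite odd_perm1 mulr1.
have step (s : 'S_p.+1) :
    \sum_(f : {ffun 'I_p.+1 -> 'I_N}) (-1) ^+ s * (\prod_a (f (s a) == g a)%:R) *
      vol (fun a => dual_frame P (f a)) = vol (fun a => dual_frame P (g a)).
  pose f0 : {ffun 'I_p.+1 -> 'I_N} := [ffun a => g (s^-1 a)%g].
  rewrite (bigD1 f0) //= [X in _ + X]big1 ?addr0 => [|f ff0].
    rewrite big1 ?mulr1 => [|a _]; last by rewrite /f0 ffunE permK eqxx.
    rewrite (_ : (fun a => dual_frame P (f0 a)) =
      (fun a => (fun b => dual_frame P (g b)) (s^-1 a)%g)); last first.
      by apply/funext => a; rewrite /f0 ffunE.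
    rewrite (volP s^-1%g (fun b => dual_frame P (g b))) odd_permV.
    by rewrite mulrA -expr2 sqrr_sign mul1r.
  have [a fa] : exists a, f (s a) != g a.
    apply/existsP; apply: contraNT ff0; rewrite negb_exists => /forallP H.
    apply/eqP/ffunP => a; rewrite /f0 ffunE.
    by have := H (s^-1 a)%g; rewrite negbK permKV => /eqP.
  by rewrite (bigD1 a) //= (negPf fa) mul0r mulr0 mul0r.
transitivity ((p.+1`!%:R)^-1 * \sum_(s : 'S_p.+1) vol (fun a => dual_frame P (g a))).
  congr (_ * _); rewrite -(eq_bigr _ (fun s _ => step s)) exchange_big /=.
  apply: eq_bigr => f _; rewrite /mono mulr_suml; apply: eq_bigr => s _.
  congr (_ * _ * _); apply: eq_bigr => a _.
  by rewrite mxE (dual_frame_mul Punit).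
by rewrite sumr_const card_Sn -[vol _ *+ _]mulr_natl mulrA mulVf ?mul1r // pnatr_eq0 -lt0n fact_gt0.
Qed.

(** With E_I in the first slots the matrix is block upper triangular, with an identity block on the
    rows of I. Distinct indices within range are required because [inord] sends all indices out of
    range to the same column. *)
Lemma mono_fcat_dual I J v : size I = p.+1 -> size J = q -> uniq (I ++ J) ->
  all (fun x => 0 < x <= N)%N (I ++ J) ->
  @mono R (p + q) N P (I ++ J)
    (fcat (fun a : 'I_p.+1 => dual_frame P (col_of (nth 0%N I a))) v) =
  @mono R (p + q) q P J v.
Proof.
move=> sI sJ; rewrite cat_uniq all_cat => /and3P[uI dIJ _] /andP[aI aJ].
have nthI (a : 'I_p.+1) : nth 0%N I a \in I by rewrite mem_nth // sI.
have nthJ (a : 'I_q) : nth 0%N J a \in J by rewrite mem_nth // sJ.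
have col_inj x y : (0 < x <= N)%N -> (0 < y <= N)%N ->
    (col_of x == col_of y) = (x == y).
  case: x => //= x xN; case: y => //= y yN.
  by rewrite -val_eqE /= !inordK.
rewrite /mono -[RHS]mul1r -(det1 R p.+1) -(det_ublock _
  (\matrix_(a < p.+1, b < q) (v b *m P) 0 (col_of (nth 0%N I a)))).
congr (\det _); apply/matrixP => a b; rewrite [LHS]mxE nth_cat sI.
case: (split_ordP a) => c ->; case: (split_ordP b) => d ->.
- rewrite fcat_lshift (dual_frame_mul Punit) block_mxEul [RHS]mxE /=.
  by rewrite col_inj ?(allP aI _ (nthI _)) // nth_uniq ?sI // eq_sym.
- by rewrite fcat_rshift block_mxEur [RHS]mxE /=.
- rewrite fcat_lshift (dual_frame_mul Punit) block_mxEdl [RHS]mxE /=.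
  rewrite addKn col_inj ?(allP aI _ (nthI d)) ?(allP aJ _ (nthJ c)) //.
  case: eqP => // E; case/hasP: dIJ; exists (nth 0%N J c) => //=.
  by rewrite -E; apply: nthI.
- by rewrite fcat_rshift block_mxEdr [RHS]mxE /= addKn.
Qed.

Lemma hodge_mono I J b v : size I = p.+1 -> size J = q -> uniq (I ++ J) ->
  all (fun x => 0 < x <= N)%N (I ++ J) -> sort_sgn (I ++ J) = Some (b, K) ->
  hodge (P *m P^T) (@mono R (p + q) N P K) (@mono R (p + q) p.+1 P I) v =
  (-1) ^+ b * @mono R (p + q) q P J v.
Proof.
move=> sI sJ uIJ aIJ srt; rewrite hodge_mono_dual.
have szK : (size (@nil nat) + size (I ++ J) = N)%N by rewrite size_cat sI sJ.
rewrite -(mono_fcat_dual v sI sJ uIJ aIJ).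
set w := fcat _ _.
have := sort_sgnP P w szK; rewrite srt !cat0s => -[_ ->].
by rewrite mulrA -expr2 sqrr_sign mul1r.
Qed.

End HodgeMono.

Lemma hodge_linear (R : realType) (p q : nat) (G : 'M[R]_(p + q))
    (vol : covec R (p + q) (p + q)) (a b : covec R (p + q) p) c v :
  hodge G vol (fun u => c * a u + b u) v = c * hodge G vol a v + hodge G vol b v.
Proof.
rewrite /hodge mulrCA -mulrDr; congr (_ * _).
rewrite mulr_sumr -big_split; apply: eq_bigr => I _ /=.
rewrite mulr_sumr -big_split; apply: eq_bigr => J _ /=.
move: (\prod__ _) (vol _) (a _) (b _) => x y z t; ring.
Qed.

Section HodgeSem.
Variable R : realType.
Implicit Types (P : 'M[R]_7) (S : seq (R * seq nat)).

Definition compl7 (I : seq nat) : seq nat :=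
  seq.filter (fun x => negb (has (Nat.eqb x) I)) [:: 1; 2; 3; 4; 5; 6; 7]%N.

(* [None] when some monomial of the list is not a product of three distinct
   covectors of the coframe. *)
Fixpoint shodge (S : seq (R * seq nat)) : option (seq (R * seq nat)) :=
  if S is x :: S' then
    match sort_sgn (x.2 ++ compl7 x.2), shodge S' with
    | Some (b, r), Some T =>
        if Nat.eqb (size x.2) 3 && seq_eqn r (iota 1 7)
        then Some ((if b then - x.1 else x.1, compl7 x.2) :: T) else None
    | _, _ => None
    end
  else Some [::].

Lemma sort_ins_perm x l : if sort_ins x l is Some (b, r) then perm_eq r (x :: l) else true.
Proof.
elim: l => //= y l; case: (Nat.eqb x y) => //; case: (Nat.ltb x y) => //.
case: (sort_ins x l) => [[b r]|] //= H.
by rewrite -[x :: y :: l]/([:: x] ++ [:: y] ++ l) perm_sym perm_catCA perm_cons perm_sym.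
Qed.

(** Lets [hodge_sem] deduce from the single fact that the indices sort to 1, ..., 7 that they are
    distinct, within range, and that the complement has four elements. *)
Lemma sort_sgn_perm l : if sort_sgn l is Some (b, r) then perm_eq r l else true.
Proof.
elim: l => //= x l; case: (sort_sgn l) => [[b r]|] // H.
have := sort_ins_perm x r; case: (sort_ins x r) => [[b' r']|] // /perm_trans; apply.
by rewrite perm_cons.
Qed.

Lemma hodge_sem P S T v : P \in unitmx -> shodge S = Some T ->
  @hodge R 3 4 (P *m P^T) (mono P [:: 1; 2; 3; 4; 5; 6; 7]%N)
    (fun u => sem P u S) v = sem P v T.
Proof.
move=> Pu; rewrite -[[:: 1%N, _ & _]]/(iota 1 (3 + 4)%N).
elim: S T => [|x S IH] T /=.
  move=> [<-] /=; rewrite /hodge big1 ?mulr0 // => I _.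
  by rewrite big1 // => J _; rewrite mulr0 mul0r.
case E: (sort_sgn _) => [[b r]|] //; case F: (shodge S) => [T'|] //.
case: ifP => // /andP[sz /seq_eqnP rK] [<-] /=; rewrite -(IH _ F).
have prm := sort_sgn_perm (x.2 ++ compl7 x.2); rewrite E rK in prm.
have s3 : size x.2 = 3%N by exact/PeanoNat.Nat.eqb_eq.
have s4 : size (compl7 x.2) = 4%N.
  by have := perm_size prm; rewrite size_cat s3 /= => -[].
rewrite rK in E.
have hm := @hodge_mono R 2 4 P Pu x.2 (compl7 x.2) b v s3 s4.
have {hm} hm := hm _ _ E.
rewrite (_ : (if b then - x.1 else x.1) = x.1 * (-1) ^+ b); last first.
  by case: b {E hm}; rewrite ?expr0 ?expr1 ?mulr1 // mulrN1.
rewrite -mulrA -hm; last 2 first.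
- by rewrite -(perm_uniq prm).
- by rewrite -(perm_all _ prm).
exact: hodge_linear.
Qed.

End HodgeSem.

(** * Smooth functions and product charts *)

(** The differential of f serves for g, since both little-o expansions concern the same values near
    x. *)
Lemma near_eq_differentiable (R : realType) (V W : normedModType R) (f g : V -> W) x :
  (\near x, f x = g x) -> differentiable f x -> differentiable g x.
Proof.
move=> fg df; have gx : g x = f x by rewrite (nbhs_singleton fg).
(* The differential is defined by choice from this predicate, so exhibiting one witness suffices. *)
apply/diffP; apply: (@getPex _ (fun (dg : {linear V -> W}) => continuous dg /\
  forall y, g y = g (lim (nbhs x)) + dg (y - lim (nbhs x))
                  +o_(y \near x) (y - lim (nbhs x)))).
exists ('d f x); split; first exact: diff_continuous.
have [[_ Hf0]] := df; have {Hf0} := Hf0 => /eqaddoP Hf.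
suff : g = (cst (g (lim (nbhs x))) + 'd f x \o center (lim (nbhs x)))
  +o_x (center (lim (nbhs x))) by move=> E y; rewrite {1}E.
apply/eqaddoP => e e0; have := Hf e e0; rewrite lim_id // gx.
apply: filterS2 fg => y fgy.
by rewrite /= -[(g - _) y]/(g y - _) -[(f - _) y]/(f y - _) fgy.
Qed.

Section LinearPullback.
Variables (R : realType) (V V' W : normedModType R) (l : V -> V').
Hypothesis lin : forall s u w, l (s *: u + w) = s *: l u + l w.

(** The difference quotients of both sides coincide, so the identity holds whether or not F is
    differentiable. *)
Lemma derive_lin_comp (F : V' -> W) y v : 'D_v (fun z => F (l z)) y = 'D_(l v) F (l y).
Proof. by rewrite /derive; under eq_fun do rewrite /= lin. Qed.

Lemma derivable_lin_comp (F : V' -> W) y v :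
  derivable F (l y) (l v) -> derivable (fun z => F (l z)) y v.
Proof. by rewrite /derivable; under [in X in _ -> X]eq_fun do rewrite /= lin. Qed.

End LinearPullback.

Section Smooth.
Variables (R : realType) (n : nat).
Implicit Types (U : set 'rV[R]_n) (f g : 'rV[R]_n -> R).

(** Allows derivatives to be replaced by closed formulas that are valid on U only: on an open set,
    values determine derivatives. *)
Lemma Ck_on_ext k U f g : open U -> (forall x, U x -> f x = g x) ->
  Ck_on k U f -> Ck_on k U g.
Proof.
move=> oU; have nearfg f' g' : (forall x, U x -> f' x = g' x) ->
    forall x, U x -> \near x, f' x = g' x.
  move=> fg x Ux; have : \forall y \near x, U y by exact: open_nbhs_nbhs.
  by apply: filterS => y /fg.
elim: k f g => [|k IH] f g fg /=.
  move=> cf x Ux; have := cf x Ux; rewrite /prop_for /continuous_at -fg //.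
  by move=> H; apply: cvg_trans (near_eq_cvg (nearfg f g fg x Ux)) H.
move=> [df Df]; split=> [x Ux|j].
  by apply: near_eq_differentiable (df x Ux); apply: (nearfg f g).
apply: IH (Df j) => x Ux; apply: near_eq_derive; exact: (nearfg f g).
Qed.

Lemma Ck_on_sub k U V f : V `<=` U -> Ck_on k U f -> Ck_on k V f.
Proof.
move=> VU; elim: k f => [|k IH] f /= H; first by move=> x /VU/H.
by split=> [x /VU|j]; [apply: H.1|apply/IH/H.2].
Qed.

Lemma Ck_on_pred k U f : Ck_on k.+1 U f -> Ck_on k U f.
Proof.
elim: k f => [|k IH] f [df Df] /=.
  by move=> x /df; apply: differentiable_continuous.
by split=> // j; apply/IH/Df.
Qed.

Lemma Ck_on_cst k U (a : R) : Ck_on k U (fun=> a).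
Proof.
elim: k a => [|k IH] a /=; first by move=> x _; apply: cst_continuous.
split=> [x _|j]; first exact: differentiable_cst.
have -> : (fun x => 'D_(delta_mx 0 j) (fun=> a) x) = (fun=> 0) :> ('rV[R]_n -> R).
  by apply/funext => x; apply: derive_cst.
exact: IH.
Qed.

Lemma Ck_onD k U f g : open U -> Ck_on k U f -> Ck_on k U g ->
  Ck_on k U (fun x => f x + g x).
Proof.
move=> oU; elim: k f g => [|k IH] f g /= Hf Hg.
  by move=> x Ux; apply: continuousD; [apply: Hf|apply: Hg].
case: Hf Hg => [df Df] [dg Dg]; split=> [x Ux|j].
  by apply: differentiableD; [apply: df|apply: dg].
apply: (Ck_on_ext oU _ (IH _ _ (Df j) (Dg j))) => x Ux.
by rewrite -deriveD //; apply: diff_derivable; [apply: df|apply: dg].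
Qed.

Lemma Ck_onM k U f g : open U -> Ck_on k U f -> Ck_on k U g ->
  Ck_on k U (fun x => f x * g x).
Proof.
move=> oU; elim: k f g => [|k IH] f g Hf Hg.
  by move=> x Ux; apply: continuousM; [apply: Hf|apply: Hg].
have f0 := Ck_on_pred Hf; have g0 := Ck_on_pred Hg.
case: Hf Hg => [df Df] [dg Dg]; split=> [x Ux|j].
  by apply: differentiableM; [apply: df|apply: dg].
apply: (Ck_on_ext oU _ (Ck_onD oU (IH _ _ (Df j) g0) (IH _ _ f0 (Dg j)))) => x Ux.
apply/esym/derive_val; apply: is_derive_mul; apply: derivableP; apply: diff_derivable;
  [exact: df|exact: dg].
Qed.

Lemma Ck_onV k U f : open U -> (forall x, U x -> f x != 0) -> Ck_on k U f ->
  Ck_on k U (fun x => (f x)^-1).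
Proof.
move=> oU nz; elim: k => [|k IH] Hf.
  by move=> x Ux; apply: continuousV; [apply: nz|apply: Hf].
have f0 := Ck_on_pred Hf; have fV := IH f0.
case: Hf => [df Df]; split=> [x Ux|j].
  by apply: differentiableV; [apply: df|apply: nz].
have H := Ck_onM oU (Ck_onM oU (Ck_on_cst k U (-1)) (Df j)) (Ck_onM oU fV fV).
apply: (Ck_on_ext oU _ H) => x Ux.
rewrite (deriveV (nz x Ux)); last by apply: diff_derivable; apply: df.
by rewrite /GRing.scale /= mulN1r !mulNr expr2 invfM mulrC.
Qed.

Lemma smooth_sub U V f : V `<=` U -> smooth_on U f -> smooth_on V f.
Proof. by move=> VU sf k; apply: Ck_on_sub (sf k). Qed.

Lemma smooth_cst U (a : R) : smooth_on U (fun=> a).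
Proof. by move=> k; apply: Ck_on_cst. Qed.

Lemma smoothD U f g : open U -> smooth_on U f -> smooth_on U g ->
  smooth_on U (fun x => f x + g x).
Proof. by move=> oU sf sg k; apply: Ck_onD. Qed.

Lemma smoothM U f g : open U -> smooth_on U f -> smooth_on U g ->
  smooth_on U (fun x => f x * g x).
Proof. by move=> oU sf sg k; apply: Ck_onM. Qed.

Lemma smoothV U f : open U -> (forall x, U x -> f x != 0) -> smooth_on U f ->
  smooth_on U (fun x => (f x)^-1).
Proof. by move=> oU nz sf k; apply: Ck_onV. Qed.

Lemma smoothZ U (a : R) f : open U -> smooth_on U f -> smooth_on U (fun x => a * f x).
Proof. by move=> oU sf; apply: smoothM => //; apply: smooth_cst. Qed.

Lemma smoothX U f m : open U -> smooth_on U f -> smooth_on U (fun x => f x ^+ m).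
Proof.
move=> oU sf; elim: m => [|m IH]; first exact: smooth_cst.
by under eq_fun do rewrite exprS; apply: smoothM.
Qed.

Lemma smooth_sum U (I : Type) (r : seq I) (F : I -> 'rV[R]_n -> R) : open U ->
  (forall i, smooth_on U (F i)) -> smooth_on U (fun x => \sum_(i <- r) F i x).
Proof.
move=> oU sF; elim: r => [|i r IH].
  by under eq_fun do rewrite big_nil; apply: smooth_cst.
by under eq_fun do rewrite big_cons; apply: smoothD.
Qed.

Lemma smooth_differentiable U f x : smooth_on U f -> U x -> differentiable f x.
Proof. by move=> /(_ 1) [H _] /H. Qed.

Lemma smooth_derivable U f x v : smooth_on U f -> U x -> derivable f x v.
Proof. by move=> sf Ux; apply: diff_derivable; apply: smooth_differentiable sf Ux. Qed.

End Smooth.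

Section SmoothCylinder.
Variables (R : realType) (n : nat).
Implicit Types (U : set 'rV[R]_n) (F : 'rV[R]_n -> R).

Lemma rsubmx_lin (s : R) (u w : 'rV[R]_(1 + n)) :
  rsubmx (s *: u + w) = s *: rsubmx u + rsubmx w :> 'rV[R]_n.
Proof. by apply/rowP => j; rewrite !mxE. Qed.

Lemma coord0_lin (s : R) (u w : 'rV[R]_(1 + n)) :
  (s *: u + w) 0 0 = s *: u 0 0 + w 0 0 :> R.
Proof. by rewrite !mxE. Qed.

Definition derive_rsubmx (W : normedModType R) (F : 'rV[R]_n -> W) :=
  derive_lin_comp rsubmx_lin F.

Lemma continuous_coord0 : continuous (fun y : 'rV[R]_(1 + n) => y 0 0).
Proof. by move=> y; apply: differentiable_continuous; apply: differentiable_coord. Qed.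

Lemma continuous_rsub : continuous (fun y : 'rV[R]_(1 + n) => rsubmx y : 'rV[R]_n).
Proof. exact: continuous_rsubmx. Qed.

Lemma smooth_rsubmx U F : smooth_on U F ->
  smooth_on [set y : 'rV[R]_(1 + n) | U (rsubmx y)] (fun y => F (rsubmx y)).
Proof.
move=> sF k; have {sF} := sF k; elim: k F => [|k IH] F /=.
  move=> cF y Uy; apply: (@continuous_comp _ _ _ rsubmx F); last exact: cF.
  exact: continuous_rsub.
move=> [dF DF]; split=> [y Uy|j].
  by apply: differentiable_comp (dF _ Uy); apply: differentiable_rsubmx.
have -> : (fun y => 'D_(delta_mx 0 j) (fun y : 'rV[R]_(1 + n) => F (rsubmx y)) y) =
    (fun y => 'D_(rsubmx (delta_mx 0 j)) F (rsubmx y)).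
  by apply/funext => y; rewrite derive_rsubmx.
(* The direction of index 0 projects to the zero vector, the others to basis vectors. *)
case: (split_ordP j) => i ->.
  rewrite (_ : rsubmx _ = 0); last by apply/rowP => l; rewrite !mxE eq_rlshift andbF.
  have -> : (fun y : 'rV[R]_(1 + n) => 'D_0 F (rsubmx y)) = (fun=> 0).
    by apply/funext => y; rewrite derive0.
  exact: Ck_on_cst.
rewrite (_ : rsubmx _ = delta_mx 0 i); first exact: (IH _ (DF i)).
by apply/rowP => l; rewrite !mxE (inj_eq (@rshift_inj _ _)).
Qed.

Lemma is_derive_coord0 (F : R -> R) dF (y v : 'rV[R]_(1 + n)) :
  is_derive (y 0 0) 1 F dF ->
  is_derive y v (fun z => F (z 0 0)) (v 0 0 * dF) /\
  differentiable (fun z : 'rV[R]_(1 + n) => F (z 0 0)) y.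
Proof.
move=> [dFd <-]; have dFy : differentiable F (y 0 0) by apply/derivable1_diffP.
have D : differentiable (fun z : 'rV[R]_(1 + n) => F (z 0 0)) y.
  by apply: differentiable_comp dFy; apply: differentiable_coord.
split; last exact: D.
split; first exact: diff_derivable.
rewrite (derive_lin_comp coord0_lin) (deriveE _ dFy) (deriveE _ dFy).
by rewrite -[v 0 0]mulr1 linearZ /= mulr1.
Qed.

End SmoothCylinder.

Lemma row_mx_coord0 (T : Type) n (t : T) (w : 'rV[T]_n) :
  (row_mx (const_mx t : 'rV_1) w : 'rV_(1 + n)) 0 0 = t.
Proof.
have <- : lshift n (0 : 'I_1) = 0 by exact: val_inj.
by rewrite row_mxEl mxE.
Qed.

(** * Forms on the product of an interval and a manifold *)

Section Cylinder.
Variables (R : realType) (L : topologicalType) (n : nat) (A : charts R L n).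
Variable J : set R.
Hypotheses (atlasA : is_atlas A) (openJ : open J).
Local Notation B := (cylinder J A).

Lemma img_cylinder (i : idx A) (y : 'rV[R]_(1 + n)) :
  img (A := B) i y <-> J (y 0 0) /\ img i (rsubmx y).
Proof.
split=> [[[t p] /= [Jt ip] <-]|[Jy [p ip pE]]].
  by rewrite row_mxKr row_mx_coord0; split=> //; exists p.
exists (y 0 0, p) => //=; rewrite pE -[RHS]hsubmxK; congr row_mx.
by apply/rowP => j; rewrite !mxE ord1; congr (y 0 _); apply: val_inj.
Qed.

Lemma open_img (i : idx A) : open (img i).
Proof. by have [_ /(_ i)[]] := atlasA. Qed.

Lemma open_rsubmx (U : set 'rV[R]_n) : open U ->
  open [set y : 'rV[R]_(1 + n) | U (rsubmx y)].
Proof. by move=> oU; apply: open_comp => // y _; apply: continuous_rsub. Qed.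

Lemma open_coord0 : open [set y : 'rV[R]_(1 + n) | J (y 0 0)].
Proof. by apply: open_comp => // y _; apply: continuous_coord0. Qed.

Lemma open_cylinder (U : set 'rV[R]_n) : open U ->
  open [set y : 'rV[R]_(1 + n) | J (y 0 0) /\ U (rsubmx y)].
Proof. by move=> oU; apply: openI; [exact: open_coord0|exact: open_rsubmx]. Qed.

Lemma open_img_cylinder (i : idx A) : open (img (A := B) i).
Proof.
rewrite (_ : img _ = [set y : 'rV[R]_(1 + n) | J (y 0 0) /\ img i (rsubmx y)]).
  exact/open_cylinder/open_img.
by apply/seteqP; split=> y; rewrite /= img_cylinder.
Qed.

Lemma overlap_cylinder (i j : idx A) (y : 'rV[R]_(1 + n)) :
  overlap (A := B) i j y <-> J (y 0 0) /\ overlap i j (rsubmx y).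
Proof.
rewrite /overlap /= img_cylinder; split; first by move=> [[Jy iy] [_ jy]].
by move=> [Jy [iy jy]].
Qed.

Lemma transition_cylinder (i j : idx A) (y : 'rV[R]_(1 + n)) :
  transition (A := B) i j y =
  row_mx (const_mx (y 0 0)) (transition i j (rsubmx y)).
Proof. by []. Qed.

Lemma transition_coord0 (i j : idx A) (y : 'rV[R]_(1 + n)) :
  transition (A := B) i j y 0 0 = y 0 0.
Proof. by rewrite transition_cylinder row_mx_coord0. Qed.

Lemma transition_rsubmx (i j : idx A) (y : 'rV[R]_(1 + n)) :
  rsubmx (transition (A := B) i j y) = transition i j (rsubmx y).
Proof. by rewrite transition_cylinder row_mxKr. Qed.

Lemma derivable_transition (i j : idx A) x v :
  overlap i j x -> derivable (transition i j) x v.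
Proof.
move=> ox; apply/derivable_mxP => a b; rewrite ord1.
by have [_ _ _ _ /(_ i j b)] := atlasA; move/smooth_derivable; apply.
Qed.

(** A transition map of the product fixes t and acts on the remaining coordinates alone, so its
    Jacobian is block diagonal. *)
Lemma derive_transition_cylinder (i j : idx A) (y v : 'rV[R]_(1 + n)) :
  overlap (A := B) i j y ->
  'D_v (transition (A := B) i j) y =
  row_mx (const_mx (v 0 0)) ('D_(rsubmx v) (transition i j) (rsubmx y)).
Proof.
move=> /overlap_cylinder[Jy oy].
have dt := @derivable_transition i j _ (rsubmx v) oy.
have d0 : is_derive y v (fun z : 'rV[R]_(1 + n) => z 0 0) (v 0 0).
  by have [] := @is_derive_coord0 R n id 1 y v (is_derive_id _ _); rewrite mulr1.
have dj k : is_derive y v (fun z : 'rV[R]_(1 + n) => transition i j (rsubmx z) 0 k)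
    ('D_(rsubmx v) (transition i j) (rsubmx y) 0 k).
  split; last by rewrite (derive_rsubmx (fun x => transition i j x 0 k)) derive_mx ?mxE.
  apply: (derivable_lin_comp (@rsubmx_lin R n) (F := fun x => transition i j x 0 k)).
  by move/derivable_mxP : dt; apply.
have dT : derivable (transition (A := B) i j) y v.
  apply/derivable_mxP => a k; rewrite ord1; case: (split_ordP k) => l ->.
    under eq_fun do rewrite transition_cylinder row_mxEl mxE.
    by have [] := d0.
  under eq_fun do rewrite transition_cylinder row_mxEr.
  by have [] := dj l.
rewrite derive_mx //; apply/rowP => k; rewrite mxE; case: (split_ordP k) => l ->.
  under eq_fun do rewrite transition_cylinder row_mxEl mxE.
  by rewrite row_mxEl mxE; have [] := d0.
under eq_fun do rewrite transition_cylinder row_mxEr.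
by rewrite row_mxEr; have [] := dj l.
Qed.

Lemma derive_transition_coord0 (i j : idx A) (y v : 'rV[R]_(1 + n)) :
  overlap (A := B) i j y -> 'D_v (transition (A := B) i j) y 0 0 = v 0 0.
Proof.
by move=> o; rewrite derive_transition_cylinder // row_mx_coord0.
Qed.

Lemma derive_transition_rsubmx (i j : idx A) (y v : 'rV[R]_(1 + n)) :
  overlap (A := B) i j y ->
  rsubmx ('D_v (transition (A := B) i j) y) =
  'D_(rsubmx v) (transition i j) (rsubmx y).
Proof. by move=> o; rewrite derive_transition_cylinder // row_mxKr. Qed.

(** The part of [is_form] that passes through sums, wedge products and multiplication by functions
    of t. Multilinearity and alternation are read at each point from an expression in a coframe. *)
Definition smooth_natural k (a : dform B k) : Prop :=
  (forall i v, smooth_on (img (A := B) i) (fun y => a i y v)) /\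
  (forall i j y, overlap (A := B) i j y -> forall v,
     a i y v = a j (transition (A := B) i j y)
                   (fun m => 'D_(v m) (transition (A := B) i j) y)).

(** Since [smooth_on] concerns functions of row vectors, a function of t is regarded as a function
    of the first of 1 + n coordinates. *)
Definition smooth_coord0 (F : R -> R) : Prop :=
  smooth_on [set y : 'rV[R]_(1 + n) | J (y 0 0)] (fun y => F (y 0 0)).

Lemma smooth_coord0D F G : smooth_coord0 F -> smooth_coord0 G ->
  smooth_coord0 (fun t => F t + G t).
Proof. by move=> sF sG; apply: smoothD => //; apply: open_coord0. Qed.

Lemma smooth_coord0M F G : smooth_coord0 F -> smooth_coord0 G ->
  smooth_coord0 (fun t => F t * G t).
Proof. by move=> sF sG; apply: smoothM => //; apply: open_coord0. Qed.

Lemma smooth_coord0_cst a : smooth_coord0 (fun=> a).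
Proof. exact: smooth_cst. Qed.

Lemma smooth_coord0N F : smooth_coord0 F -> smooth_coord0 (fun t => - F t).
Proof.
move=> sF; rewrite (_ : (fun t => _) = (fun t => (-1) * F t)).
  by apply: smooth_coord0M => //; apply: smooth_coord0_cst.
by apply/funext => t; rewrite mulN1r.
Qed.

Lemma smooth_coord0X F m : smooth_coord0 F -> smooth_coord0 (fun t => F t ^+ m).
Proof. by move=> sF; apply: smoothX => //; apply: open_coord0. Qed.

Lemma smooth_coord0V F : (forall t, J t -> F t != 0) -> smooth_coord0 F ->
  smooth_coord0 (fun t => (F t)^-1).
Proof.
by move=> nz sF; apply: smoothV => //; [apply: open_coord0|move=> y; apply: nz].
Qed.

Lemma smooth_coord0_img F i : smooth_coord0 F ->
  smooth_on (img (A := B) i) (fun y => F (y 0 0)).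
Proof. by apply: smooth_sub => y /img_cylinder[]. Qed.

Lemma smooth_natural_scale k F (a : dform B k) : smooth_coord0 F ->
  smooth_natural a -> smooth_natural (fun i y v => F (y 0 0) * a i y v).
Proof.
move=> sF [sa na]; split=> [i v|i j y o v].
  by apply: smoothM => //; [exact: open_img_cylinder|exact: smooth_coord0_img].
by rewrite transition_coord0 -na.
Qed.

Lemma smooth_natural_add k (a b : dform B k) : smooth_natural a ->
  smooth_natural b -> smooth_natural (fun i y v => a i y v + b i y v).
Proof.
move=> [sa na] [sb nb]; split=> [i v|i j y o v].
  by apply: smoothD => //; exact: open_img_cylinder.
by rewrite -na // -nb.
Qed.

Lemma smooth_natural_wedge k l (a : dform B k) (b : dform B l) :
  smooth_natural a -> smooth_natural b ->
  smooth_natural (fun i y => ewedge (a i y) (b i y)).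
Proof.
move=> [sa na] [sb nb]; split=> [i v|i j y o v].
  have oi := @open_img_cylinder i.
  apply: smoothZ => //; apply: smooth_sum => // s.
  by apply: smoothM => //; apply: smoothZ.
rewrite /ewedge; congr (_ * _); apply: eq_bigr => s _.
by rewrite (na i j y o) (nb i j y o).
Qed.

Lemma smooth_natural_dt : smooth_natural (fun i y => @dt R n : covec R (1 + n) 1).
Proof.
split=> [i v|i j y o v]; first exact: smooth_cst.
by rewrite /dt derive_transition_coord0.
Qed.

Definition pullf k (a : dform A k) : dform B k := fun i y => pull (a i (rsubmx y)).

Lemma smooth_natural_pull k (a : dform A k) : is_form a -> smooth_natural (pullf a).
Proof.
move=> [_ sa na]; split=> [i v|i j y o v].
  apply: smooth_sub (smooth_rsubmx (sa i (fun m => rsubmx (v m)))).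
  by move=> y /img_cylinder[].
have [Jy oy] := (overlap_cylinder i j y).1 o.
rewrite /pullf /pull transition_rsubmx (na _ _ _ oy).
by congr (a _ _ _); apply/funext => m; rewrite derive_transition_rsubmx.
Qed.

Lemma extd_pullf k (a : dform A k) (i : idx A) (y : 'rV[R]_(1 + n)) u :
  extd (pullf a i) y u = pull (extd (a i) (rsubmx y)) u.
Proof.
rewrite /extd /pull; apply: eq_bigr => m _; congr (_ * _).
exact: (derive_rsubmx (fun x => a i x (fun j => rsubmx (u (lift m j))))).
Qed.

End Cylinder.

Lemma extd_near (R : realType) (n k : nat) (U : set 'rV[R]_n)
    (a b : 'rV[R]_n -> covec R n k) x u : open U -> U x ->
  (forall y, U y -> forall v, a y v = b y v) -> extd a x u = extd b x u.
Proof.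
move=> oU Ux ab; apply: eq_bigr => i _; congr (_ * _); apply: near_eq_derive.
have : \forall y \near x, U y by exact: open_nbhs_nbhs.
by apply: filterS => y /ab.
Qed.

Arguments pullf {R L n A} J {k} a.

(** * SU(3)- and G2-coframes *)

Section LiftFrame.
Variable R : realType.
Implicit Types (P : 'M[R]_6) (u : 'rV[R]_(1 + 6)) (k : nat).

(* The coframe (e^1, ..., e^6, dt) of the cylinder. *)
Definition lift_frame P : 'M[R]_7 :=
  block_mx (0 : 'M[R]_(1, 6)) (1%:M : 'M[R]_1) P (0 : 'M[R]_(6, 1)).

Lemma mul_lift_frame P u :
  (u *m lift_frame P : 'rV[R]_7) = row_mx (rsubmx u *m P) (lsubmx u : 'rV[R]_1).
Proof.
rewrite -[X in (X *m _ = _)](@hsubmxK _ 1 1 6 u).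
by rewrite (@mul_row_block _ 1 1 6 6 1)
  !mulmx0 mulmx1 add0r addr0.
Qed.

Lemma lift_frame_lt6 P u k : (k < 6)%N ->
  (u *m lift_frame P : 'rV[R]_7) 0 (inord k) = (rsubmx u *m P) 0 (inord k).
Proof.
move=> k6; rewrite mul_lift_frame.
have -> : (inord k : 'I_7) = lshift 1 (inord k : 'I_6).
  by apply: val_inj; rewrite /= !inordK // ltnS ltnW.
exact: (@row_mxEl _ 1 6 1).
Qed.

Lemma lift_frame_6 P u : (u *m lift_frame P : 'rV[R]_7) 0 (inord 6) = u 0 0.
Proof.
rewrite mul_lift_frame.
have -> : (inord 6 : 'I_7) = rshift 6 (0 : 'I_1) by apply: val_inj; rewrite /= inordK.
by rewrite (@row_mxEr _ 1 6 1) mxE; congr (u 0 _); apply: val_inj.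
Qed.

Lemma lift_frame_gram P :
  lift_frame P *m (lift_frame P)^T =
  block_mx (1%:M : 'M[R]_1) (0 : 'M[R]_(1, 6)) (0 : 'M[R]_(6, 1)) (P *m P^T) :> 'M[R]_7.
Proof.
have -> : (lift_frame P)^T =
    block_mx (0 : 'M[R]_(6, 1)) P^T (1%:M : 'M[R]_1) (0 : 'M[R]_(1, 6)) :> 'M[R]_7.
  by rewrite /lift_frame (@tr_block_mx _ 1 6 6 1) !trmx0 trmx1.
by rewrite /lift_frame (@mulmx_block _ 1 6 6 1 1 6) !mulmx0 !mul0mx mulmx1
  !add0r !addr0.
Qed.

(** The diagonal blocks of [lift_frame] are not square; the Gram matrix is block diagonal with
    square blocks, so invertibility is read there. *)
Lemma lift_frame_unit P : P \in unitmx -> lift_frame P \in unitmx.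
Proof.
move=> Pu; have : \det (lift_frame P *m (lift_frame P)^T) != 0.
  rewrite lift_frame_gram (@det_ublock _ 1 6) det1 mul1r det_mulmx det_tr.
  by rewrite mulf_neq0 // -unitfE -unitmxE.
by rewrite det_mulmx mulf_eq0 negb_or unitmxE unitfE => /andP[].
Qed.

Lemma pull_mono P k I (v : 'I_k -> 'rV[R]_(1 + 6)) : size I = k ->
  all (fun x => 0 < x <= 6)%N I ->
  pull (@mono R 5 k P I) v = @mono R 6 k (lift_frame P) I v.
Proof.
move=> sI aI; congr (\det _); apply/matrixP => a b; rewrite [LHS]mxE [RHS]mxE.
rewrite lift_frame_lt6 //.
have := allP aI _ (mem_nth 0%N (_ : a < size I)%N).
by rewrite sI => /(_ (ltn_ord a)); case: (nth 0%N I a).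
Qed.

Lemma mono_scale n k (P : 'M[R]_n.+1) (s : R) I v :
  @mono R n k (s *: P) I v = s ^+ k * mono P I v.
Proof.
rewrite /mono -detZ; congr (\det _); apply/matrixP => a b; rewrite !mxE mulr_sumr.
by apply: eq_bigr => j _; rewrite mxE mulrCA.
Qed.

(** Applied with s = f: the coframe f e^i is orthonormal for f^2 g, and a k-form on L acquires the
    factor f^-k when written in it. *)
Lemma pull_sem P k (s : R) S v : s != 0 -> sizes_ok k S ->
  all (fun x => all (fun x => 0 < x <= 6)%N x.2) S ->
  pull (fun w => @sem R 5 k P w S) v =
  @sem R 6 k (lift_frame (s *: P)) v (sscale (s^-1 ^+ k) S).
Proof.
move=> s0; rewrite sem_scale; elim: S => [|x S IH]; first by rewrite mulr0.
rewrite /=; case E: (Nat.eqb _ _) => // szS /andP[ax aS].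
have sx : size x.2 = k by exact/PeanoNat.Nat.eqb_eq.
rewrite /pull /= -[sem P _ S]/(pull (fun w => sem P w S) v) IH // mulrDr.
congr (_ + _).
rewrite -(pull_mono _ _ sx ax) /pull mono_scale mulrCA; congr (_ * _).
by rewrite mulrA -exprMn mulVf // expr1n mul1r.
Qed.

Lemma dt_mono P (v : 'I_1 -> 'rV[R]_(1 + 6)) :
  @dt R 6 v = @sem R 6 1 (lift_frame P) v [:: (1, [:: 7%N])].
Proof. by rewrite /= addr0 mul1r /mono det_mx11 mxE lift_frame_6. Qed.

(** Laplace expansion along the row of dt, which is the seventh covector of the lifted coframe. *)
Lemma dt_sem P k S (u : 'I_k.+1 -> 'rV[R]_(1 + 6)) : 
  \sum_(i < k.+1) (-1) ^+ i *
    (u i 0 0 * @sem R 6 k (lift_frame P) (fun j => u (lift i j)) S) =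
  @sem R 6 k.+1 (lift_frame P) u [seq (x.1, 7%N :: x.2) | x <- S].
Proof.
elim: S => [|x S IH] /=; first by rewrite big1 // => i _; rewrite !mulr0.
rewrite -IH [in RHS]/mono (expand_det_row _ ord0) mulr_sumr -big_split.
apply: eq_bigr => i _ /=; rewrite !mulrDr; congr (_ + _).
rewrite mxE /= lift_frame_6 /cofactor add0n [LHS]mulrCA [RHS]mulrCA.
congr (_ * _); rewrite mulrCA; congr (_ * (_ * _)).
by rewrite /mono; congr (\det _); apply/matrixP => a b; rewrite !mxE.
Qed.

End LiftFrame.

Section FrameChange.
Variables (R : realType) (n : nat) (P Q : 'M[R]_n.+1).
Variable rows : nat -> seq (R * seq nat).

(** [rows i] is meant to be the expansion of covector i of [Q] in the coframe [P], so this expands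
    the monomial e^I of [Q] in [P]. *)
Fixpoint change_frame (I : seq nat) : seq (R * seq nat) :=
  if I is i :: I' then swedge (rows i) (change_frame I') else [:: (1, [::])].

Lemma sizes_okE k (S : seq (R * seq nat)) : sizes_ok k S = all (fun x => size x.2 == k) S.
Proof.
by elim: S => //= x S ->; case: eqP => [->|/PeanoNat.Nat.eqb_neq -> //]; rewrite PeanoNat.Nat.eqb_refl.
Qed.

Lemma sizes_ok_swedge p q (S T : seq (R * seq nat)) :
  sizes_ok p S -> sizes_ok q T -> sizes_ok (p + q) (swedge S T).
Proof.
rewrite !sizes_okE => pS qT; elim: S pS => //= x S IH /andP[/eqP px /IH].
rewrite all_cat => ->; rewrite andbT all_map.
by apply: sub_all qT => y /eqP qy /=; rewrite size_cat px qy.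
Qed.

Lemma mono_change_frame k (I : seq nat) v : size I = k ->
  (forall i u, i \in I -> (u *m Q) 0 (inord i.-1) = @sem R n 1 P (fun=> u) (rows i)) ->
  (forall i, i \in I -> sizes_ok 1 (rows i)) ->
  mono Q I v = @sem R n k P v (change_frame I).
Proof.
move=> sI; move: v; rewrite -{k}sI => v.
elim: I v => [|i I IH] v rowsP szP.
  by rewrite /= addr0 mul1r /mono !det_mx00.
have szI : sizes_ok (size I) (change_frame I).
  elim: I {IH v rowsP} szP => //= j I IH szP.
  apply: (@sizes_ok_swedge 1) => //; last first.
    apply: IH => l; rewrite inE => /orP[/eqP->|lI]; apply: szP; rewrite !inE ?eqxx //.
    by rewrite lI !orbT.
  by apply: szP; rewrite !inE eqxx orbT.
have E1 : (fun w => sem P w (rows i)) = @mono R n 1 Q [:: i].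
  apply/funext => u; rewrite /mono det_mx11 mxE /= rowsP ?inE ?eqxx //.
  by congr (sem _ _ _); apply/funext => j; rewrite ord1.
have E2 : (fun w => sem P w (change_frame I)) = @mono R n (size I) Q I.
  apply/funext => u; apply/esym.
  by apply: IH => [j w jI|j jI]; [apply: rowsP|apply: szP]; rewrite inE jI orbT.
rewrite [change_frame _]/=.
rewrite -(@ewedge_sem R n 1 (size I) P (rows i) (change_frame I)) //; last first.
  by apply: szP; rewrite inE eqxx.
by rewrite E1 E2; apply/esym/(@ewedge_mono R n 1 (size I) Q [:: i] I v).
Qed.

End FrameChange.

(** Only the list operations are unfolded, so the coefficients in R reach [ring] and [field] as they
    were built. *)
Ltac sem_red :=
  lazy beta iota zeta delta [zero_coefs nform foldr sscale map seq.map cat add_term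
    sort_sgn sort_ins seq_eqn swedge Nat.eqb Nat.ltb Nat.leb xorb negb fst snd
    sizes_ok size shodge compl7 seq.filter has iota andb orb change_frame].

(* [repeat split] would try to prove each equation by conversion. *)
Ltac each_coef tac := repeat (refine (conj _ _); [solve [tac] | ]); exact I.

Section SU3Lists.
Variable R : realType.
Local Notation form := (seq (R * seq nat)).

Definition su3_w : form :=
  [:: (1, [:: 1; 2]%N); (1, [:: 3; 4]%N); (1, [:: 5; 6]%N)].
Definition su3_psip : form :=
  [:: (1, [:: 1; 3; 5]%N); (-1, [:: 1; 4; 6]%N); (-1, [:: 2; 3; 6]%N);
      (-1, [:: 2; 4; 5]%N)].
Definition su3_psim : form :=
  [:: (1, [:: 1; 3; 6]%N); (1, [:: 1; 4; 5]%N); (1, [:: 2; 3; 5]%N);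
      (-1, [:: 2; 4; 6]%N)].
(* The general primitive (1,1)-form. *)
Definition su3_sigma (a b p q r u x y : R) : form :=
  [:: (a, [:: 1; 2]%N); (b, [:: 3; 4]%N); (- (a + b), [:: 5; 6]%N);
      (p, [:: 1; 3]%N); (p, [:: 2; 4]%N); (q, [:: 1; 4]%N); (- q, [:: 2; 3]%N);
      (r, [:: 1; 5]%N); (r, [:: 2; 6]%N); (u, [:: 1; 6]%N); (- u, [:: 2; 5]%N);
      (x, [:: 3; 5]%N); (x, [:: 4; 6]%N); (y, [:: 3; 6]%N); (- y, [:: 4; 5]%N)].

Lemma SU3_coframe_sem (P : 'M[R]_6) w psip psim : SU3_coframe P w psip psim ->
  [/\ w = (fun v => @sem R 5 2 P v su3_w),
      psip = (fun v => @sem R 5 3 P v su3_psip)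
    & psim = (fun v => @sem R 5 3 P v su3_psim)].
Proof.
move=> [Hw Hp Hm]; split; apply/funext => v;
  rewrite ?Hw ?Hp ?Hm /mon2 /mon3 !emonE /=; ring.
Qed.

End SU3Lists.

Lemma det_mx22 (R : comNzRingType) (M : 'M[R]_2) :
  \det M = M 0 0 * M 1 1 - M 0 1 * M 1 0.
Proof.
rewrite (expand_det_row _ 0) !big_ord_recl big_ord0 /cofactor !det_mx11 !mxE /=.
rewrite addr0 expr0 expr1 mul1r mulN1r mulrN.
by congr (_ * M _ _ - M _ _ * M _ _); apply: val_inj.
Qed.

Definition pair2 (T : Type) (x y : T) : 'I_2 -> T := fun m => if m == 0 then x else y.

Lemma pair2_eta (T : Type) (v : 'I_2 -> T) : v = pair2 (v 0) (v 1).
Proof.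
by apply/funext => m; case: m => [[|[|//]] i] /=; congr v; apply: val_inj.
Qed.

Section TwoForms.
Variables (R : realType) (n : nat) (a : covec R n 2).
Hypotheses (ma : multilinear a) (aa : alternating_covec a).

Lemma pair2_linl s u u' v :
  a (pair2 (s *: u + u') v) = s * a (pair2 u v) + a (pair2 u' v).
Proof.
have U z : (fun j : 'I_2 => if j == 0 then z else pair2 0 v j) = pair2 z v.
  by apply/funext => j; rewrite /pair2; case: (j == 0).
by have := ma (pair2 0 v) 0 s u u'; rewrite /= !U.
Qed.

Lemma pair2_linr s u v v' :
  a (pair2 u (s *: v + v')) = s * a (pair2 u v) + a (pair2 u v').
Proof.
have U z : (fun j : 'I_2 => if j == 1 then z else pair2 u 0 j) = pair2 u z.
  by apply/funext => -[[|[|//]] j]; rewrite /pair2 -!val_eqE.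
by have := ma (pair2 u 0) 1 s v v'; rewrite /= !U.
Qed.

Lemma pair2_diag u : a (pair2 u u) = 0.
Proof. exact: (aa (i := 0) (j := 1)). Qed.

Lemma pair2_anti u v : a (pair2 u v) = - a (pair2 v u).
Proof.
have := pair2_diag (1 *: u + v); rewrite pair2_linl !pair2_linr !pair2_diag.
by rewrite !mul1r add0r addr0 => /eqP; rewrite addr_eq0 => /eqP.
Qed.

Lemma pair2_0r u : a (pair2 u 0) = 0.
Proof.
have := pair2_linr 1 u 0 0; rewrite scaler0 addr0 mul1r => /eqP.
by rewrite -subr_eq subrr eq_sym => /eqP.
Qed.

Lemma pair2_Nr u v : a (pair2 u (- v)) = - a (pair2 u v).
Proof.
by have := pair2_linr (-1) u v 0; rewrite addr0 scaleN1r pair2_0r addr0 mulN1r.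
Qed.

Lemma pair2_sum m (c d : 'I_m -> R) (u : 'I_m -> 'rV[R]_n) :
  a (pair2 (\sum_i c i *: u i) (\sum_j d j *: u j)) =
  \sum_i \sum_j c i * d j * a (pair2 (u i) (u j)).
Proof.
have a0l v : a (pair2 0 v) = 0 by rewrite pair2_anti pair2_0r oppr0.
have suml v : a (pair2 (\sum_i c i *: u i) v) = \sum_i c i * a (pair2 (u i) v).
  elim/big_rec2: _ => [|i y z _ <-]; [exact: a0l|exact: pair2_linl].
have sumr v : a (pair2 v (\sum_i d i *: u i)) = \sum_i d i * a (pair2 v (u i)).
  elim/big_rec2: _ => [|i y z _ <-]; [exact: pair2_0r|exact: pair2_linr].
rewrite suml; apply: eq_bigr => i _; rewrite sumr mulr_sumr.
by apply: eq_bigr => j _; rewrite mulrA.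
Qed.

End TwoForms.

(** * Primitive J-invariant two-forms in an adapted coframe *)

Section Sigma.
Variables (R : realType) (P : 'M[R]_6).
Hypothesis Punit : P \in unitmx.
Local Notation E := (dual_frame P).

Lemma mono2_dual (i j : nat) (a b : 'I_6) : (0 < i <= 6)%N -> (0 < j <= 6)%N ->
  @mono R 5 2 P [:: i; j] (pair2 (E a) (E b)) =
  ((a.+1 == i) && (b.+1 == j))%:R - ((a.+1 == j) && (b.+1 == i))%:R.
Proof.
move=> hi hj; rewrite /mono det_mx22 ![fun_of_matrix (\matrix_(_, _) _) _ _]mxE /=.
rewrite !(dual_frame_mul Punit).
have H (l : nat) (d : 'I_6) : (0 < l <= 6)%N -> (d == inord l.-1) = (d.+1 == l).
  by case: l => // l /= hl; rewrite -val_eqE /= inordK.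
by rewrite !H // -!natrM !mulnb [_ && (a.+1 == j)]andbC.
Qed.

(** In coordinates the matrix of w is P M P^T, with M its matrix in the frame E, and the inverse
    metric is P^-T P^-1. The factors of P cancel and M remains, as the frame is orthonormal. *)
Lemma Jmx_dual (w : covec R 6 2) a : multilinear w -> alternating_covec w ->
  E a *m Jmx (P *m P^T) w = \sum_b w (pair2 (E a) (E b)) *: E b.
Proof.
move=> mw aw.
pose M := \matrix_(i, j) w (pair2 (E i) (E j)).
have WE : \matrix_(a, b) w (fun m : 'I_2 => if m == 0 then ovec R a else ovec R b) =
    P *m M *m P^T.
  apply/matrixP => i j; rewrite mxE.
  rewrite -[X in w X]/(pair2 (ovec R i) (ovec R j)).
  rewrite [in LHS](dual_frame_decomp Punit (ovec R i)).
  rewrite [in LHS](dual_frame_decomp Punit (ovec R j)) pair2_sum //.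
  rewrite [RHS]mxE exchange_big; apply: eq_bigr => l _ /=.
  rewrite [in RHS]mxE mulr_suml; apply: eq_bigr => k _.
  by rewrite /ovec -!rowE !mxE mulrAC.
have U : P *m P^T \in unitmx by rewrite unitmx_mul unitmx_tr Punit.
have PT : P^T *m invmx (P *m P^T) = invmx P.
  by apply: (can_inj (mulKmx Punit)); rewrite mulmxA mulmxV // mulmxV.
rewrite /Jmx WE -(mulmxA (P *m M)) PT /dual_frame -row_mul !mulmxA mulVmx // mul1mx.
rewrite row_mul mulmx_sum_row; apply: eq_bigr => b _.
by rewrite !mxE.
Qed.

Lemma su3_w_dual i j : @sem R 5 2 P (pair2 (E i) (E j)) (su3_w R) =
  \sum_(l <- [:: (1, 2); (3, 4); (5, 6)]%N)
    (((i.+1 == l.1) && (j.+1 == l.2))%:R - ((i.+1 == l.2) && (j.+1 == l.1))%:R).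
Proof.
by rewrite !big_cons big_nil /= !mul1r !mono2_dual.
Qed.

Definition ord6 (k : nat) : 'I_6 := inord k.

Lemma sum6 (V : nmodType) (F : 'I_6 -> V) :
  \sum_i F i = F (ord6 0) + (F (ord6 1) + (F (ord6 2) + (F (ord6 3) +
    (F (ord6 4) + F (ord6 5))))).
Proof.
rewrite !big_ord_recl big_ord0 addr0.
by congr (F _ + (F _ + (F _ + (F _ + (F _ + F _))))); apply: val_inj;
  rewrite /= inordK.
Qed.

Lemma ord6_ind (Q : 'I_6 -> Prop) :
  Q (ord6 0) -> Q (ord6 1) -> Q (ord6 2) -> Q (ord6 3) -> Q (ord6 4) -> Q (ord6 5) ->
  forall i, Q i.
Proof.
move=> q0 q1 q2 q3 q4 q5 i; rewrite -[i]inord_val.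
by case: i => -[|[|[|[|[|[|//]]]]]] /=.
Qed.

Lemma su3_J_dual w : multilinear w -> alternating_covec w ->
  w = (fun v => @sem R 5 2 P v (su3_w R)) ->
  let J u := u *m Jmx (P *m P^T) w in
  [/\ J (E (ord6 0)) = E (ord6 1), J (E (ord6 1)) = - E (ord6 0),
      J (E (ord6 2)) = E (ord6 3), J (E (ord6 3)) = - E (ord6 2)
    & J (E (ord6 4)) = E (ord6 5) /\ J (E (ord6 5)) = - E (ord6 4)].
Proof.
move=> mw aw wE /=; rewrite !Jmx_dual // !sum6 wE !su3_w_dual.
rewrite !big_cons !big_nil /= !inordK //=.
by rewrite !(subr0, sub0r, addr0, add0r, oppr0, scale0r, scale1r, scaleN1r).
Qed.

(** J-invariance ties the mixed coefficients in pairs and leaves nine of the fifteen (three in the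
    planes 12, 34, 56 and six mixed); the wedge with omega^2 detects the trace and leaves eight. *)
Lemma sigma_sem (w s : covec R 6 2) :
  multilinear w -> alternating_covec w ->
  w = (fun v => @sem R 5 2 P v (su3_w R)) ->
  multilinear s -> alternating_covec s ->
  (forall v, s (fun m => v m *m Jmx (P *m P^T) w) = s v) ->
  (forall v, ewedge s (ewedge w w) v = 0) ->
  exists a b p q r u x y,
    s = (fun v => @sem R 5 2 P v (su3_sigma a b p q r u x y)).
Proof.
move=> mw aw wE ms als sJ prim.
have [J0 J1 J2 J3 [J4 J5]] := su3_J_dual mw aw wE.
pose S i j := s (pair2 (E (ord6 i)) (E (ord6 j))).
have SJ u v : s (pair2 (u *m Jmx (P *m P^T) w) (v *m Jmx (P *m P^T) w)) = s (pair2 u v).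
  rewrite -[RHS]sJ; congr s; apply/funext => m; rewrite /pair2.
  by case: (m == 0).
have SN u v : s (pair2 u (- v)) = - s (pair2 u v) by exact: pair2_Nr.
have SNl u v : s (pair2 (- u) v) = - s (pair2 u v).
  by rewrite (pair2_anti ms als (- u)) SN -(pair2_anti ms als u v).
have D i : S i i = 0 by exact: pair2_diag.
have anti i j : S i j = - S j i by exact: pair2_anti.
(* Each relation applies J to both arguments. Frame vectors are numbered from 0 here, whereas the
   covectors in monomials are numbered from 1. *)
have H02 : S 1 3 = S 0 2 by rewrite /S -[RHS]SJ J0 J2.
have H03 : S 1 2 = - S 0 3 by rewrite /S -[in RHS]SJ J0 J3 SN opprK.
have H04 : S 1 5 = S 0 4 by rewrite /S -[RHS]SJ J0 J4.
have H05 : S 1 4 = - S 0 5 by rewrite /S -[in RHS]SJ J0 J5 SN opprK.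
have H24 : S 3 5 = S 2 4 by rewrite /S -[RHS]SJ J2 J4.
have H25 : S 3 4 = - S 2 5 by rewrite /S -[in RHS]SJ J2 J5 SN opprK.
pose T := [:: (S 0 1, [:: 1; 2]); (S 2 3, [:: 3; 4]); (S 4 5, [:: 5; 6]);
      (S 0 2, [:: 1; 3]); (S 0 2, [:: 2; 4]); (S 0 3, [:: 1; 4]); (- S 0 3, [:: 2; 3]);
      (S 0 4, [:: 1; 5]); (S 0 4, [:: 2; 6]); (S 0 5, [:: 1; 6]); (- S 0 5, [:: 2; 5]);
      (S 2 4, [:: 3; 5]); (S 2 4, [:: 4; 6]); (S 2 5, [:: 3; 6]); (- S 2 5, [:: 4; 5])]%N.
have sT : s = (fun v => @sem R 5 2 P v T).
  apply/funext; apply: (multilinear_frame_ext Punit ms); first exact: sem_multilinear.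
  move=> f; rewrite (pair2_eta (fun i => E (f i))).
  elim/ord6_ind: (f 0); elim/ord6_ind: (f 1);
    rewrite -/(S _ _) /= !mono2_dual // !inordK //= ?D;
    rewrite ?(anti 1 0) ?(anti 2 0) ?(anti 2 1) ?(anti 3 0) ?(anti 3 1) ?(anti 3 2);
    rewrite ?(anti 4 0) ?(anti 4 1) ?(anti 4 2) ?(anti 4 3);
    rewrite ?(anti 5 0) ?(anti 5 1) ?(anti 5 2) ?(anti 5 3) ?(anti 5 4);
    rewrite ?H02 ?H03 ?H04 ?H05 ?H24 ?H25; ring.
have tr : S 4 5 = - (S 0 1 + S 2 3).
  have := prim (fun m => E m).
  rewrite wE sT (@ewedge_semf R 5 2 2) // (@ewedge_semf R 5 2 4) //.
  (* In omega^2 each of e^{1234}, e^{1256}, e^{3456} has coefficient 2, so only the three diagonal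
     coefficients of s survive, each with factor 2. *)
  rewrite (@sem_eq R 5 6 P (fun m => E m) _
    [:: (2 * (S 0 1 + S 2 3 + S 4 5), [:: 1; 2; 3; 4; 5; 6]%N)]) //; last first.
    by sem_red; each_coef ltac:(ring).
  rewrite /= addr0 (_ : mono _ _ _ = 1); last first.
    rewrite /mono -(det1 R 6); congr (\det _); apply/matrixP => a b.
    rewrite [LHS]mxE (dual_frame_mul Punit) mxE eq_sym; congr (_ == _)%:R.
    by elim/ord6_ind: a; rewrite /ord6 ?inordK.
  rewrite mulr1 => /eqP; rewrite mulf_eq0 pnatr_eq0 /= addr_eq0 => /eqP.
  by move=> ->; rewrite opprK.
by do 8!eexists; rewrite sT /T tr.
Qed.

End Sigma.

(** * The pointwise identities for phi, star phi and the torsion forms *)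

Section G2Algebra.
Variable R : realType.
Local Notation form := (seq (R * seq nat)).
Variables (E : 'M[R]_7) (F h s co c : R) (a b p q r u x y : R).
Hypotheses (F0 : F != 0) (cs1 : co ^+ 2 = 1 - s ^+ 2).

Definition star7 (S : form) : form := if shodge S is Some T then T else [::].

(* [g2_phi] and [g2_tau3] are phi and tau_3 in the orthonormal coframe
   (f e^1, ..., f e^6, dt), which is not rotated by theta, hence adapted to phi
   only where theta = 0; here F = f, h = f', s = sin theta, co = cos theta. *)
Definition g2_phi : form :=
  [:: (1, [:: 1; 2; 7]%N); (1, [:: 3; 4; 7]%N); (1, [:: 5; 6; 7]%N);
      (co, [:: 1; 3; 5]%N); (- co, [:: 1; 4; 6]%N); (- co, [:: 2; 3; 6]%N);
      (- co, [:: 2; 4; 5]%N); (- s, [:: 1; 3; 6]%N); (- s, [:: 1; 4; 5]%N);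
      (- s, [:: 2; 3; 5]%N); (s, [:: 2; 4; 6]%N)].

Local Notation dtl := [:: (1 : R, [:: 7%N])].
Local Notation W := (sscale (F^-1 ^+ 2) (su3_w R)).
Local Notation Pp := (sscale (F^-1 ^+ 3) (su3_psip R)).
Local Notation Pm := (sscale (F^-1 ^+ 3) (su3_psim R)).
Local Notation Sg := (sscale (F^-1 ^+ 2) (su3_sigma a b p q r u x y)).

Definition g2_tau3 : form :=
  sscale (s / F) (sscale (- c * co) (su3_psip R) ++ sscale (c * s) (su3_psim R) ++
    sscale (4 / 3 * c) (swedge (su3_w R) dtl) ++
    sscale (-1) (swedge (su3_sigma a b p q r u x y) dtl)).

Ltac sem_red7 :=
  rewrite /g2_tau3 /star7 /g2_phi /su3_w /su3_psip /su3_psim /su3_sigma; sem_red.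

Lemma shodge_phi : shodge g2_phi = Some (star7 g2_phi).
Proof. by sem_red7. Qed.

Lemma shodge_tau3 : shodge g2_tau3 = Some (star7 g2_tau3).
Proof. by sem_red7. Qed.

Ltac coefs := sem_red7; each_coef ltac:(first [ring: cs1 | by field: cs1; try exact: F0]).

Lemma phi_alg v :
  F ^+ 2 * @sem R 6 3 E v (swedge W dtl) +
  F ^+ 3 * (co * sem E v Pp - s * sem E v Pm) = sem E v g2_phi.
Proof.
rewrite -mulNr -!sem_scale -sem_cat -sem_scale -sem_cat; refine (@sem_eq _ _ _ _ _ _ _ _ _); first by sem_red7.
by coefs.
Qed.

Lemma vol_alg v :
  F ^+ 6 / 6 * @sem R 6 7 E v (swedge (swedge (swedge W W) W) dtl) =
  mono E [:: 1; 2; 3; 4; 5; 6; 7]%N v.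
Proof.
rewrite -[RHS](_ : sem E v [:: (1, [:: 1; 2; 3; 4; 5; 6; 7]%N)] = _); last first.
  by rewrite /= mul1r addr0.
rewrite -sem_scale; refine (@sem_eq _ _ _ _ _ _ _ _ _); first by sem_red7.
by coefs.
Qed.

(** Expresses star phi through omega^2, psi_+ /\ dt and psi_- /\ dt, which can be differentiated
    without a coframe. *)
Lemma star_phi_alg v :
  F ^+ 4 / 2 * @sem R 6 4 E v (swedge W W) +
  (F ^+ 3 * s * sem E v (swedge Pp dtl) + F ^+ 3 * co * sem E v (swedge Pm dtl)) =
  sem E v (star7 g2_phi).
Proof.
rewrite -!sem_scale -!sem_cat; refine (@sem_eq _ _ _ _ _ _ _ _ _); first by sem_red7.
by coefs.
Qed.

Local Notation tau1_coef := ((h - c / 3 * co) / F).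
Local Notation sigma0 := (- (2 * c / 3)).

(** The left side is d phi term by term: (f^2)' and d omega = c psi_+ on the first two lines, then
    the derivatives of f^3 cos theta and of - f^3 sin theta with theta' = - 2 c sin theta / f
    inserted, then d psi_-. That the right side has no multiple of star phi is the vanishing of
    tau_0. *)
Lemma dphi_alg v :
  2 * F * h * @sem R 6 4 E v (swedge dtl (swedge W dtl)) +
  F ^+ 2 * (c * sem E v (swedge Pp dtl)) +
  ((3 * F ^+ 2 * h * co + F ^+ 3 * (2 * c * s ^+ 2 / F)) * sem E v (swedge dtl Pp) +
   - (3 * F ^+ 2 * h * s - F ^+ 3 * (2 * c * s * co / F)) * sem E v (swedge dtl Pm) +
   - (F ^+ 3 * s) * (sigma0 * sem E v (swedge W W) - sem E v (swedge Sg W))) =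
  3 * sem E v (swedge (sscale tau1_coef dtl) g2_phi) + sem E v (star7 g2_tau3).
Proof.
rewrite -(mulN1r (sem E v (swedge Sg W))); do ?rewrite -?sem_scale -?sem_cat.
refine (@sem_eq _ _ _ _ _ _ _ _ _); first by sem_red7.
by coefs.
Qed.

(** The left side is d(star phi): omega^2 and psi_+ /\ dt are closed, so they contribute only
    through the derivatives of their coefficients, while psi_- /\ dt also contributes d psi_- /\
    dt. *)
Lemma dstar_phi_alg v :
  2 * F ^+ 3 * h * @sem R 6 5 E v (swedge dtl (swedge W W)) +
  ((3 * F ^+ 2 * h * s - F ^+ 3 * (2 * c * s * co / F)) *
     sem E v (swedge dtl (swedge Pp dtl)) +
   ((3 * F ^+ 2 * h * co + F ^+ 3 * (2 * c * s ^+ 2 / F)) *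
     sem E v (swedge dtl (swedge Pm dtl)) +
    F ^+ 3 * co * (sigma0 * sem E v (swedge (swedge W W) dtl) -
                   sem E v (swedge (swedge Sg W) dtl)))) =
  4 * sem E v (swedge (sscale tau1_coef dtl) (star7 g2_phi)) +
  sem E v (swedge (sscale (- (F * co)) Sg) g2_phi).
Proof.
rewrite -(mulN1r (sem E v (swedge (swedge Sg W) dtl))).
do ?rewrite -?sem_scale -?sem_cat.
refine (@sem_eq _ _ _ _ _ _ _ _ _); first by sem_red7.
by coefs.
Qed.

Lemma tau2_star_phi v :
  @sem R 6 6 E v (swedge (sscale (- (F * co)) Sg) (star7 g2_phi)) = 0.
Proof.
refine (@sem_eq0 _ _ _ _ _ _ _ _); first by sem_red7.
by coefs.
Qed.

Lemma tau3_phi v : @sem R 6 6 E v (swedge g2_tau3 g2_phi) = 0.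
Proof.
refine (@sem_eq0 _ _ _ _ _ _ _ _); first by sem_red7.
by coefs.
Qed.

Lemma tau3_star_phi v : @sem R 6 7 E v (swedge g2_tau3 (star7 g2_phi)) = 0.
Proof.
refine (@sem_eq0 _ _ _ _ _ _ _ _); first by sem_red7.
by coefs.
Qed.

(** This makes omega^2 closed, as d(omega^2) = 2 c psi_+ /\ omega. *)
Lemma psip_w v : @sem R 6 5 E v (swedge Pp W) = 0.
Proof.
refine (@sem_eq0 _ _ _ _ _ _ _ _); first by sem_red7.
by coefs.
Qed.

Lemma tau3_alg v :
  (- (c * (F ^+ 2 * (s * co)))) * @sem R 6 3 E v Pp +
  (c * (F ^+ 2 * s ^+ 2) * sem E v Pm +
   (4 / 3 * c * (F * s) * sem E v (swedge W dtl) +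
    (- (F * s)) * sem E v (swedge Sg dtl))) = sem E v g2_tau3.
Proof.
rewrite -!sem_scale -!sem_cat.
refine (@sem_eq _ _ _ _ _ _ _ _ _); first by sem_red7.
by coefs.
Qed.

Lemma sizes_star_phi : sizes_ok 4 (star7 g2_phi).
Proof. by sem_red7. Qed.

Lemma sizes_tau3 : sizes_ok 3 g2_tau3.
Proof. by sem_red7. Qed.

End G2Algebra.

Lemma is_derive_ewedge (R : realType) n p q (a : 'rV[R]_n -> covec R n p)
    (b : 'rV[R]_n -> covec R n q) x v u :
  derivable_form a x -> derivable_form b x ->
  is_derive x v (fun y => ewedge (a y) (b y) u)
    (ewedge (fun w => 'D_v (a^~ w) x) (b x) u +
     ewedge (a x) (fun w => 'D_v (b^~ w) x) u).
Proof.
move=> da db; rewrite /ewedge -mulrDr; apply: is_deriveMl.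
rewrite -big_split; apply: is_derive_suml => s /=.
apply: is_derive_mul; last exact: derivableP.
by apply: is_deriveMl; apply: derivableP.
Qed.

(** Exchanging two blocks of two slots is a product of two transpositions, hence even. *)
Lemma ewedge_comm22 (R : realType) n (a b : covec R n 2) u :
  @ewedge R n 2 2 a b u = @ewedge R n 2 2 b a u.
Proof.
rewrite /ewedge; congr (_ * _).
pose t : {perm 'I_(2 + 2)} := (tperm (lshift 2 0%R) (rshift 2 0%R) * tperm (lshift 2 1%R) (rshift 2 1%R))%g.
have i01 (i : 'I_2) : i = 0 \/ i = 1.
  by case: i => [[|[|//]] hi]; [left|right]; apply: val_inj.
have tl i : t (lshift 2 i) = rshift 2 i.
  rewrite permM; case: (i01 i) => ->; first by rewrite tpermL tpermD.
  by rewrite [tperm (lshift 2 0) _ _]tpermD // tpermL.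
have tr i : t (rshift 2 i) = lshift 2 i.
  rewrite permM; case: (i01 i) => ->; first by rewrite tpermR tpermD.
  by rewrite [tperm (lshift 2 0) _ _]tpermD // tpermR.
have odd_t : odd_perm t = false by rewrite odd_permM !odd_tperm.
rewrite (reindex_inj (h := fun s => (t * s)%g)) /=; last exact: mulgI.
apply: eq_bigr => s _; rewrite odd_permM odd_t addFb mulrAC.
by congr (_ * _ * _); [congr b|congr a]; apply/funext => i; rewrite permM ?tl ?tr.
Qed.

(** By commutativity the two terms of the product rule agree, so the derivative is twice the one
    with the second factor frozen at x, where [extd_ewedge_cst] applies. *)
Lemma extd_ewedge_sq (R : realType) n (a : 'rV[R]_n -> covec R n 2) x u :
  derivable_form a x ->
  @extd R n 4 (fun y => @ewedge R n 2 2 (a y) (a y)) x u =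
  2 * @ewedge R n 3 2 (extd a x) (a x) u.
Proof.
move=> da; rewrite -(@extd_ewedge_cst R n 2 2 a (a x)) // /extd mulr_sumr.
apply: eq_bigr => i _; rewrite mulrCA; congr (_ * _).
rewrite (@derive_val _ _ _ _ _ _ _ (is_derive_ewedge _ _ da da)).
rewrite (@derive_val _ _ _ _ _ _ _ (is_derive_ewedgel _ _ _ da)).
by rewrite [X in _ + X]ewedge_comm22 -mulr2n mulr_natl.
Qed.

(** * Smoothness of the functions of t *)

Section Ode.
Variables (R : realType) (n : nat) (J : set R) (f h th : R -> R) (kap c : R).
Hypotheses (openJ : open J) (f_gt0 : forall t, J t -> 0 < f t)
  (df : forall t, J t -> is_derive t 1 f (h t))
  (dh : forall t, J t -> is_derive t 1 h (- kap * f t))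
  (dth : forall t, J t -> is_derive t 1 th (- (2 * c * sin (th t) / f t))).

Lemma dsin_th t : J t ->
  is_derive t 1 (fun t => sin (th t)) (- (2 * c * sin (th t) * cos (th t) / f t)).
Proof.
move=> Jt; have H := is_derive1_comp (is_derive_sin (th t)) (dth Jt).
by apply: (is_derive_eq H); rewrite /GRing.scale /= mulrN; congr (- _); ring.
Qed.

Lemma dcos_th t : J t ->
  is_derive t 1 (fun t => cos (th t)) (2 * c * sin (th t) ^+ 2 / f t).
Proof.
move=> Jt; have H := is_derive1_comp (is_derive_cos (th t)) (dth Jt).
by apply: (is_derive_eq H); rewrite /GRing.scale /= mulrNN; ring.
Qed.

(* The derivatives of f, h, sin th, cos th are polynomials in these functions
   and 1/f, so differentiability bootstraps to smoothness. *)
Lemma smooth_ode :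
  [/\ smooth_coord0 n J f, smooth_coord0 n J h, smooth_coord0 n J (fun t => sin (th t))
    & smooth_coord0 n J (fun t => cos (th t))].
Proof.
set U := [set y : 'rV[R]_(1 + n) | J (y 0 0)].
have oU : open U := open_coord0 openJ.
have D (F dF : R -> R) : (forall t, J t -> is_derive t 1 F (dF t)) ->
    (forall y, U y -> differentiable (fun z : 'rV[R]_(1 + n) => F (z 0 0)) y) /\
    (forall k, Ck_on k U (fun y => dF (y 0 0)) -> Ck_on k.+1 U (fun y => F (y 0 0))).
  move=> H; have dU y : U y -> differentiable (fun z : 'rV[R]_(1 + n) => F (z 0 0)) y.
    by move=> Uy; have [] := is_derive_coord0 0 (H _ Uy).
  split=> // k CdF; split=> // j.
  have C := Ck_onM oU (Ck_on_cst k U ((delta_mx 0 j : 'rV[R]_(1 + n)) 0 0)) CdF.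
  apply: (Ck_on_ext oU _ C) => y Uy.
  by have [[_ ->]] := is_derive_coord0 (delta_mx 0 j) (H _ Uy).
have nz y : U y -> f (y 0 0) != 0 by move=> Uy; rewrite gt_eqF // f_gt0.
suff all k : [/\ Ck_on k U (fun y => f (y 0 0)), Ck_on k U (fun y => h (y 0 0)),
    Ck_on k U (fun y => sin (th (y 0 0))) & Ck_on k U (fun y => cos (th (y 0 0)))].
  by split=> k; have [] := all k.
elim: k => [|k [Cf Ch Cs Cc]].
  split=> y Uy; apply: differentiable_continuous.
  - exact: (D _ _ df).1.
  - exact: (D _ _ dh).1.
  - exact: (D _ _ dsin_th).1.
  - exact: (D _ _ dcos_th).1.
have CV := Ck_onV oU nz Cf.
split.
- exact: (D _ _ df).2.
- by apply: (D _ _ dh).2; apply: Ck_onM => //; apply: Ck_on_cst.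
- apply: (D _ _ dsin_th).2.
  have C := Ck_onM oU (Ck_onM oU (Ck_onM oU (Ck_on_cst k U (- (2 * c))) Cs) Cc) CV.
  by apply: (Ck_on_ext oU _ C) => y _; rewrite !mulNr.
- apply: (D _ _ dcos_th).2.
  have C := Ck_onM oU (Ck_onM oU (Ck_on_cst k U (2 * c)) (Ck_onM oU Cs Cs)) CV.
  by apply: (Ck_on_ext oU _ C) => y _; rewrite expr2.
Qed.

End Ode.

(** * A coframe adapted to the rotated form *)

Section Rotation.
Variables (R : realType) (E : 'M[R]_7) (s co : R).
Hypothesis cs1 : co ^+ 2 = 1 - s ^+ 2.

(* Multiplying e^1 + i e^2 by a unit complex number co + i s, and fixing e^3, ..., e^7. *)
Definition rot7 : 'M[R]_7 := \matrix_(a, b)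
  if b == 0%N :> nat then (if a == 0%N :> nat then co else if a == 1%N :> nat then - s else 0)
  else if b == 1%N :> nat then (if a == 0%N :> nat then s else if a == 1%N :> nat then co else 0)
  else (a == b)%:R.

Definition rot_rows (i : nat) : seq (R * seq nat) :=
  match i with
  | 1 => [:: (co, [:: 1%N]); (- s, [:: 2%N])]
  | 2 => [:: (s, [:: 1%N]); (co, [:: 2%N])]
  | _ => [:: (1, [:: i])]
  end.

Definition ord7 (k : nat) : 'I_7 := inord k.

Lemma ord7_ind (Q : 'I_7 -> Prop) :
  Q (ord7 0) -> Q (ord7 1) -> Q (ord7 2) -> Q (ord7 3) -> Q (ord7 4) ->
  Q (ord7 5) -> Q (ord7 6) -> forall i, Q i.
Proof.
move=> q0 q1 q2 q3 q4 q5 q6 i; rewrite -[i]inord_val.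
by case: i => -[|[|[|[|[|[|[|//]]]]]]] /=.
Qed.

Lemma sum7 (V : nmodType) (F : 'I_7 -> V) :
  \sum_i F i = F (ord7 0) + (F (ord7 1) + (F (ord7 2) + (F (ord7 3) +
    (F (ord7 4) + (F (ord7 5) + F (ord7 6)))))).
Proof.
rewrite !big_ord_recl big_ord0 addr0.
by congr (F _ + (F _ + (F _ + (F _ + (F _ + (F _ + F _)))))); apply: val_inj;
  rewrite /= inordK.
Qed.

Lemma rot7_gram : rot7 *m rot7^T = 1%:M.
Proof.
apply/matrixP => a b; rewrite mxE sum7 !mxE.
by elim/ord7_ind: a; elim/ord7_ind: b; rewrite -!val_eqE /ord7 /= !inordK //=;
  ring: cs1.
Qed.

Lemma rot7_unit : rot7 \in unitmx.
Proof. by have [] := mulmx1_unit rot7_gram. Qed.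

Lemma rot_rowsP i u : (0 < i <= 7)%N ->
  (u *m (E *m rot7)) 0 (inord i.-1) = @sem R 6 1 E (fun=> u) (rot_rows i).
Proof.
have m1 j : @mono R 6 1 E [:: j] (fun=> u) = (u *m E) 0 (inord j.-1).
  by rewrite /mono det_mx11 mxE.
rewrite mulmxA mxE sum7 => hi.
case: i hi => [|[|[|[|[|[|[|[|i]]]]]]]] // _; rewrite /= !m1 /=;
  move: (u *m E) => M; rewrite /rot7 !mxE /ord7 -?val_eqE /= !inordK //=; ring.
Qed.

Lemma mono_rot k (I : seq nat) v : size I = k -> all (fun i => 0 < i <= 7)%N I ->
  mono (E *m rot7) I v = @sem R 6 k E v (change_frame rot_rows I).
Proof.
move=> sI aI; apply: mono_change_frame => // i.
  by move=> u /(allP aI); apply: rot_rowsP.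
by move=> _; case: i => [|[|[|i]]].
Qed.

Ltac sem_rot := rewrite /g2_phi /rot_rows; sem_red.

(** psi_+ + i psi_- = (e^1 + i e^2)(e^3 + i e^4)(e^5 + i e^6), so turning the first factor by co + i
    s makes the real part co psi_+ - s psi_-, while e^{12} and hence omega are unchanged. Turning
    one factor by the whole angle keeps the matrix polynomial in sin theta and cos theta. *)
Lemma rot_coframe :
  G2_coframe (E *m rot7) (fun v => @sem R 6 3 E v (g2_phi s co)).
Proof.
move=> v; rewrite /mon3 !emonE !mono_rot //.
rewrite -!(mulN1r (sem _ _ _)) -!sem_scale -!sem_cat.
refine (@sem_eq _ _ _ _ _ _ _ _ _); first by sem_rot.
by sem_rot; each_coef ltac:(ring: cs1).
Qed.

Lemma rot_vol v : mono E [:: 1; 2; 3; 4; 5; 6; 7]%N v =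
  emon (E *m rot7) [tuple 1; 2; 3; 4; 5; 6; 7]%N v.
Proof.
rewrite emonE mono_rot //.
rewrite -[LHS](_ : sem E v [:: (1, [:: 1; 2; 3; 4; 5; 6; 7]%N)] = _); last first.
  by rewrite /= mul1r addr0.
refine (@sem_eq _ _ _ _ _ _ _ _ _); first by sem_rot.
by sem_rot; each_coef ltac:(ring: cs1).
Qed.

End Rotation.

(** * The G2-structure of the cylinder and its torsion *)

Section Cone.
Variables (R : realType) (L : topologicalType) (A : charts R L 6).
Variables (w : dform A 2) (psip psim : dform A 3) (g : metric A) (c : R)
  (sigma2 : dform A 2).
Hypotheses (atlasA : is_atlas A) (su3 : SU3_structure w psip psim g)
  (cpl : forall i x, img i x -> forall v, extd (w i) x v = c * psip i x v)
  (tors : coupled_torsion w psip psim g (- (2 * c / 3)) sigma2).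
Variables (J : set R) (f h th : R -> R) (kap : R).
Hypotheses (openJ : open J) (f_gt0 : forall t, J t -> 0 < f t)
  (df : forall t, J t -> is_derive t 1 f (h t))
  (dh : forall t, J t -> is_derive t 1 h (- kap * f t))
  (dth : forall t, J t -> is_derive t 1 th (- (2 * c * sin (th t) / f t))).

Local Notation B := (cylinder J A).
Local Notation phi := (warped_G2 J w psip psim f th).
Local Notation dtl := [:: (1 : R, [:: 7%N])].
Local Notation sn := (fun t => sin (th t)).
Local Notation cs := (fun t => cos (th t)).
Local Notation W F := (sscale (F^-1 ^+ 2) (su3_w R)).
Local Notation Pp F := (sscale (F^-1 ^+ 3) (su3_psip R)).
Local Notation Pm F := (sscale (F^-1 ^+ 3) (su3_psim R)).

Definition cone_metric : metric B := fun i y =>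
  block_mx (1%:M : 'M[R]_1) (0 : 'M[R]_(1, 6)) (0 : 'M[R]_(6, 1))
    (f (y 0 0) ^+ 2 *: g i (rsubmx (y : 'rV[R]_(1 + 6)))).

Definition dtf : dform B 1 := fun i y => @dt R 6.

Definition wwdt : dform B 7 := fun i y =>
  @ewedge R (1 + 6) 6 1
    (@ewedge R (1 + 6) 4 2
       (@ewedge R (1 + 6) 2 2 (pullf J w i y) (pullf J w i y)) (pullf J w i y))
    (@dt R 6).

(** Here omega^3 / 3! is the volume form of g, and rescaling six orthonormal covectors by f gives
    f^6. *)
Definition cone_vol : dform B 7 := fun i y v => f (y 0 0) ^+ 6 / 6 * wwdt i y v.

Lemma w_form : is_form w. Proof. by have [] := su3. Qed.
Lemma psip_form : is_form psip. Proof. by have [_ []] := su3. Qed.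
Lemma psim_form : is_form psim. Proof. by have [_ []] := su3. Qed.
Lemma g_metric : is_metric g. Proof. by have [] := su3. Qed.
Lemma sigma2_form : is_form sigma2. Proof. by have [] := tors. Qed.

Lemma f_neq0 t : J t -> f t != 0.
Proof. by move=> Jt; rewrite gt_eqF // f_gt0. Qed.

Lemma cs_sqr t : cs t ^+ 2 = 1 - sn t ^+ 2.
Proof. by rewrite -(cos2Dsin2 (th t)) addrK. Qed.

Lemma frame_at i x : img i x -> exists P : 'M[R]_6,
  [/\ P \in unitmx, SU3_coframe P (w i x) (psip i x) (psim i x)
    & g i x = P *m P^T].
Proof.
move=> ix; have [_ _ _ /(_ i x ix)[U [P [_ Ux _ _ /(_ x Ux)[Pu [H1 H2]]]]]] := su3.
by exists (P x).
Qed.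

Lemma cone_frame i (y : 'rV[R]_(1 + 6)) (P : 'M[R]_6) :
  J (y 0 0) -> img i (rsubmx y) -> P \in unitmx ->
  SU3_coframe P (w i (rsubmx y)) (psip i (rsubmx y)) (psim i (rsubmx y)) ->
  g i (rsubmx y) = P *m P^T ->
  let F := f (y 0 0) in let E := lift_frame (F *: P) in
  [/\ E \in unitmx, cone_metric i y = E *m E^T,
      @dt R 6 = (fun v => @sem R 6 1 E v dtl),
      pullf J w i y = (fun v => @sem R 6 2 E v (W F))
    & pullf J psip i y = (fun v => @sem R 6 3 E v (Pp F)) /\
      pullf J psim i y = (fun v => @sem R 6 3 E v (Pm F))].
Proof.
move=> Jy iy Pu Pw gP F E; have F0 : F != 0 := f_neq0 Jy.
have [wE pE mE] := SU3_coframe_sem Pw.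
have FPu : F *: P \in unitmx by rewrite unitmxZ // unitfE.
split; [exact: lift_frame_unit| | | |split].
- rewrite /E lift_frame_gram /cone_metric gP -/F; congr block_mx.
  by rewrite linearZ /= -scalemxAl -scalemxAr scalerA expr2.
- by apply/funext => v; apply: dt_mono.
- by apply/funext => v; rewrite /pullf wE; apply: pull_sem.
- by apply/funext => v; rewrite /pullf pE; apply: pull_sem.
- by apply/funext => v; rewrite /pullf mE; apply: pull_sem.
Qed.

(** One coframe in which all the forms have list expressions. [P] is kept beside [E], since [dt_sem]
    requires a coframe of the form [lift_frame P]. *)
Variant cone_frame_spec i (y : 'rV[R]_(1 + 6)) : Prop :=
  ConeFrame (P : 'M[R]_6) (E : 'M[R]_7) (a b p q r u x z : R) of
    E = lift_frame P & E \in unitmx & cone_metric i y = E *m E^T &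
    @dt R 6 = (fun v => @sem R 6 1 E v dtl) &
    pullf J w i y = (fun v => @sem R 6 2 E v (W (f (y 0 0)))) &
    pullf J psip i y = (fun v => @sem R 6 3 E v (Pp (f (y 0 0)))) &
    pullf J psim i y = (fun v => @sem R 6 3 E v (Pm (f (y 0 0)))) &
    pullf J sigma2 i y = (fun v => @sem R 6 2 E v
      (sscale ((f (y 0 0))^-1 ^+ 2) (su3_sigma a b p q r u x z))).

Lemma cone_frameP i (y : 'rV[R]_(1 + 6)) : img (A := B) i y -> cone_frame_spec i y.
Proof.
move=> /img_cylinder[Jy iy]; have [P [Pu Pw gP]] := frame_at iy.
have [Eu gE dtE wE [pE mE]] := cone_frame Jy iy Pu Pw gP.
have [wP _ _] := SU3_coframe_sem Pw.
have [/(_ i _ iy)[mw aw] _ _] := w_form.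
have [/(_ i _ iy)[ms als] _ _] := sigma2_form.
have [_ sJ prim _] := tors.
have [a [b [p [q [r [u [x [z sE]]]]]]]] : exists a b p q r u x z,
    sigma2 i (rsubmx y) = (fun v => @sem R 5 2 P v (su3_sigma a b p q r u x z)).
  apply: (sigma_sem Pu mw aw wP ms als); last exact: prim iy.
  by move=> v; rewrite -gP; apply: sJ iy v.
apply: (@ConeFrame _ _ (f (y 0 0) *: P) _ a b p q r u x z (erefl _)) => //.
by apply/funext => v; rewrite /pullf sE; apply: pull_sem => //; apply: f_neq0.
Qed.

Lemma smooth_f : smooth_coord0 6 J f.
Proof. by have [] := smooth_ode 6 openJ f_gt0 df dh dth. Qed.
Lemma smooth_h : smooth_coord0 6 J h.
Proof. by have [] := smooth_ode 6 openJ f_gt0 df dh dth. Qed.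
Lemma smooth_sn : smooth_coord0 6 J sn.
Proof. by have [] := smooth_ode 6 openJ f_gt0 df dh dth. Qed.
Lemma smooth_cs : smooth_coord0 6 J cs.
Proof. by have [] := smooth_ode 6 openJ f_gt0 df dh dth. Qed.

Lemma natural_w : smooth_natural (pullf J w).
Proof. exact/smooth_natural_pull/w_form. Qed.
Lemma natural_psip : smooth_natural (pullf J psip).
Proof. exact/smooth_natural_pull/psip_form. Qed.
Lemma natural_psim : smooth_natural (pullf J psim).
Proof. exact/smooth_natural_pull/psim_form. Qed.
Lemma natural_sigma2 : smooth_natural (pullf J sigma2).
Proof. exact/smooth_natural_pull/sigma2_form. Qed.
Lemma natural_dt : smooth_natural dtf.
Proof. exact: smooth_natural_dt. Qed.

Definition wdt : dform B 3 := fun i y => @ewedge R (1 + 6) 2 1 (pullf J w i y) (@dt R 6).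

Lemma natural_wdt : smooth_natural wdt.
Proof. exact: (smooth_natural_wedge atlasA openJ natural_w natural_dt). Qed.

(** phi as a sum of products of a function of t and a form. The applied abstractions are the shape
    that [extd_scale] and [smooth_natural_scale] match. *)
Definition cone_phi : dform B 3 := fun i y v =>
  (fun t => f t ^+ 2) (y 0 0) * wdt i y v +
  ((fun t => f t ^+ 3 * cs t) (y 0 0) * pullf J psip i y v +
   (fun t => - (f t ^+ 3 * sn t)) (y 0 0) * pullf J psim i y v).

Lemma cone_phiE : phi = cone_phi.
Proof.
apply/funext => i; apply/funext => y; apply/funext => v.
by rewrite /warped_G2 /cone_phi /= mulrBr mulNr !mulrA.
Qed.

Lemma natural_phi : smooth_natural cone_phi.
Proof.
have sf := smooth_f; have ss := smooth_sn; have sc := smooth_cs.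
have n1 := smooth_natural_scale atlasA openJ (smooth_coord0X openJ 2 sf) natural_wdt.
have s3 := smooth_coord0X openJ 3 sf.
have n2 := smooth_natural_scale atlasA openJ (smooth_coord0M openJ s3 sc) natural_psip.
have n3 := smooth_natural_scale atlasA openJ
  (smooth_coord0N openJ (smooth_coord0M openJ s3 ss)) natural_psim.
exact: (smooth_natural_add atlasA openJ n1 (smooth_natural_add atlasA openJ n2 n3)).
Qed.

Lemma phi_sem i (y : 'rV[R]_(1 + 6)) (E : 'M[R]_7) : J (y 0 0) ->
  @dt R 6 = (fun v => @sem R 6 1 E v dtl) ->
  pullf J w i y = (fun v => @sem R 6 2 E v (W (f (y 0 0)))) ->
  pullf J psip i y = (fun v => @sem R 6 3 E v (Pp (f (y 0 0)))) ->
  pullf J psim i y = (fun v => @sem R 6 3 E v (Pm (f (y 0 0)))) ->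
  cone_phi i y = (fun v => @sem R 6 3 E v (g2_phi (sn (y 0 0)) (cs (y 0 0)))).
Proof.
move=> Jy dtE wE pE mE; apply/funext => v.
rewrite -(phi_alg E (f_neq0 Jy) (cs_sqr (y 0 0))).
rewrite /cone_phi /wdt wE pE mE dtE (@ewedge_semf R 6 2 1) //.
by rewrite mulrBr mulNr !mulrA.
Qed.

Lemma vol_sem i (y : 'rV[R]_(1 + 6)) (E : 'M[R]_7) : J (y 0 0) ->
  @dt R 6 = (fun v => @sem R 6 1 E v dtl) ->
  pullf J w i y = (fun v => @sem R 6 2 E v (W (f (y 0 0)))) ->
  cone_vol i y = @mono R 6 7 E [:: 1; 2; 3; 4; 5; 6; 7]%N.
Proof.
move=> Jy dtE wE; apply/funext => v; rewrite -(vol_alg E (f_neq0 Jy) (cs_sqr (y 0 0))).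
rewrite /cone_vol /wwdt wE dtE (@ewedge_semf R 6 2 2) //.
by rewrite (@ewedge_semf R 6 4 2) // (@ewedge_semf R 6 6 1).
Qed.

Lemma cone_phi_form : is_form cone_phi.
Proof.
have [sp np] := natural_phi; split=> // i y iy.
have [P E a b p q r u x z _ _ _ dtE wE pE mE _] := cone_frameP iy.
have [Jy _] := (img_cylinder (A := A) J i y).1 iy.
rewrite (phi_sem Jy dtE wE pE mE).
by split; [exact: sem_multilinear|exact: sem_alternating].
Qed.

Lemma cone_vol_form : is_form cone_vol.
Proof.
have nw2 := smooth_natural_wedge atlasA openJ natural_w natural_w.
have nw3 := smooth_natural_wedge atlasA openJ nw2 natural_w.
have nw3t := smooth_natural_wedge atlasA openJ nw3 natural_dt.
have s6 := smooth_coord0M openJ (smooth_coord0X openJ 6 smooth_f)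
  (smooth_coord0_cst 6 J (6^-1 : R)).
have [sp np] : smooth_natural cone_vol := smooth_natural_scale atlasA openJ s6 nw3t.
split=> // i y iy.
have [P E a b p q r u x z _ _ _ dtE wE pE mE _] := cone_frameP iy.
have [Jy _] := (img_cylinder (A := A) J i y).1 iy.
rewrite (vol_sem Jy dtE wE).
by split; [exact: mono_multilinear|exact: mono_alternating].
Qed.

Lemma cone_is_metric : is_metric cone_metric.
Proof.
have [gsym gpos gsm gnat] := g_metric.
have blk (y u v : 'rV[R]_(1 + 6)) (G : 'M[R]_6) :
    u *m block_mx (1%:M : 'M[R]_1) (0 : 'M[R]_(1, 6)) (0 : 'M[R]_(6, 1)) G *m v^T =
    (u 0 0 * v 0 0)%:M + rsubmx u *m G *m (rsubmx v)^T.
  rewrite -[X in X *m _ *m _](@hsubmxK _ 1 1 6 u) -[X in _ *m X^T](@hsubmxK _ 1 1 6 v).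
  rewrite (@mul_row_block _ 1 1 6 1 6) !mulmx0 mulmx1 add0r addr0.
  rewrite (@tr_row_mx _ 1 1 6) (@mul_row_col _ 1 1 6 1); congr (_ + _).
  apply/matrixP => a b; rewrite !ord1 !mxE big_ord1 !mxE eqxx mulr1n.
  by congr (u 0 _ * v 0 _); apply: val_inj.
split.
- move=> i y /img_cylinder[_ iy]; rewrite /cone_metric (@tr_block_mx _ 1 6 1 6).
  by rewrite !trmx0 trmx1 linearZ /= gsym.
- move=> i y /img_cylinder[Jy iy] v v0; rewrite /cone_metric (blk y) mxE [X in X + _]mxE eqxx mulr1n.
  have f2 : 0 < f (y 0 0) ^+ 2 by rewrite exprn_gt0 // f_gt0.
  rewrite -scalemxAr -scalemxAl mxE -expr2.
  have [r0|r0] := eqVneq (rsubmx v) 0.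
    rewrite r0 !mul0mx mxE mulr0 addr0 exprn_even_gt0 //=.
    apply: contraNN v0 => /eqP v00; apply/eqP/rowP => j; rewrite mxE.
    case: (@split_ordP 1 6 j) => k ->.
      by rewrite ord1 -v00; congr (v 0 _); apply: val_inj.
    by have /rowP/(_ k) := r0; rewrite !mxE.
  by apply: ltr_wpDl; [exact: sqr_ge0|apply: mulr_gt0 => //; apply: gpos].
- move=> i a b; have oi := @open_img_cylinder _ _ _ _ _ atlasA openJ i.
  rewrite /cone_metric; case: (@split_ordP 1 6 a) => a' ->;
    case: (@split_ordP 1 6 b) => b' ->.
  + by under eq_fun do rewrite (@block_mxEul _ 1 6 1 6); apply: smooth_cst.
  + by under eq_fun do rewrite (@block_mxEur _ 1 6 1 6); apply: smooth_cst.
  + by under eq_fun do rewrite (@block_mxEdl _ 1 6 1 6); apply: smooth_cst.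
  + under eq_fun do rewrite (@block_mxEdr _ 1 6 1 6) mxE.
    apply: smoothM => //; first exact: (smooth_coord0_img (A := A) i (smooth_coord0X openJ 2 smooth_f)).
    by apply: smooth_sub (smooth_rsubmx (gsm i a' b')) => y /img_cylinder[].
- move=> i j y oy u v; rewrite /cone_metric !(blk y).
  have [Jy oy'] := (overlap_cylinder (A := A) J i j y).1 oy.
  have := derive_transition_coord0 atlasA u oy; have := derive_transition_coord0 atlasA v oy.
  have := derive_transition_rsubmx atlasA u oy; have := derive_transition_rsubmx atlasA v oy.
  have := transition_coord0 (A := A) J i j y; have := transition_rsubmx (A := A) J i j y.
  move: ('D_u _ y) ('D_v _ y) (transition _ _ y) => Du Dv T rT tT rv ru tv tu.
  rewrite tT rT tu tv ru rv; congr (_ + _).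
  by rewrite -!scalemxAr -!scalemxAl (gnat _ _ _ oy').
Qed.

Lemma smooth_lift_frame (U : set 'rV[R]_(1 + 6)) (P : 'rV[R]_(1 + 6) -> 'M[R]_6) a b :
  (forall a b, smooth_on U (fun y => P y a b)) ->
  smooth_on U (fun y => lift_frame (P y) a b).
Proof.
move=> sP; rewrite /lift_frame; case: (@split_ordP 1 6 a) => a' ->;
  case: (@split_ordP 6 1 b) => b' ->.
- by under eq_fun do rewrite (@block_mxEul _ 1 6 6 1); apply: smooth_cst.
- by under eq_fun do rewrite (@block_mxEur _ 1 6 6 1); apply: smooth_cst.
- by under eq_fun do rewrite (@block_mxEdl _ 1 6 6 1); apply: sP.
- by under eq_fun do rewrite (@block_mxEdr _ 1 6 6 1); apply: smooth_cst.
Qed.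

Lemma smooth_rot7 (U : set 'rV[R]_(1 + 6)) (s co : 'rV[R]_(1 + 6) -> R) a b :
  open U -> smooth_on U s -> smooth_on U co ->
  smooth_on U (fun y => rot7 (s y) (co y) a b).
Proof.
move=> oU ss sc; under eq_fun do rewrite mxE.
have sN : smooth_on U (fun y => - s y).
  by under eq_fun do rewrite -mulN1r; apply: smoothZ.
case: (b == 0%N :> nat); last case: (b == 1%N :> nat); last exact: smooth_cst.
  case: (a == 0%N :> nat) => //; case: (a == 1%N :> nat) => //; exact: smooth_cst.
case: (a == 0%N :> nat) => //; case: (a == 1%N :> nat) => //; exact: smooth_cst.
Qed.

Lemma cone_local_coframes : local_coframes (A := B) (fun i y P =>
  [/\ G2_coframe P (cone_phi i y), cone_metric i y = P *m P^T
    & forall v, cone_vol i y v = emon P [tuple 1; 2; 3; 4; 5; 6; 7]%N v]).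
Proof.
move=> i y0 /img_cylinder[Jy0 iy0].
have [_ _ _ /(_ i _ iy0)[U [P [oU Uy0 Usub sP PU]]]] := su3.
pose V := [set y : 'rV[R]_(1 + 6) | J (y 0 0) /\ U (rsubmx y)].
have oV : open V by exact: (open_cylinder openJ oU).
have VJ F : smooth_coord0 6 J F -> smooth_on V (fun y => F (y 0 0)).
  by apply: smooth_sub => y [].
(* Rescaling by f makes the coframe orthonormal; the rotation then adapts it to phi and, being in
   SO(7), preserves metric and volume. *)
exists V, (fun y : 'rV[R]_(1 + 6) => lift_frame (f (y 0 0) *: P (rsubmx y)) *m
  rot7 (sn (y 0 0)) (cs (y 0 0))); split=> //.
- by move=> y [Jy Uy]; apply/(img_cylinder (A := A)); split=> //; apply: Usub.
- move=> a b; under eq_fun do rewrite mxE; apply: smooth_sum => // k.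
  apply: smoothM => //; last first.
    by apply: smooth_rot7 => //; [exact: (VJ sn smooth_sn)|exact: (VJ cs smooth_cs)].
  apply: smooth_lift_frame => a' b'; under eq_fun do rewrite mxE.
  apply: smoothM => //; first exact: (VJ f smooth_f).
  by apply: smooth_sub (smooth_rsubmx (sP a' b')) => y [].
move=> y [Jy Uy]; have [Pu [Pw gP]] := PU _ Uy.
have [Eu gE dtE wE [pE mE]] := cone_frame Jy (Usub _ Uy) Pu Pw gP.
have rel := cs_sqr (y 0 0).
split; first by rewrite unitmx_mul Eu (rot7_unit rel).
split.
- by rewrite (phi_sem Jy dtE wE pE mE); apply: rot_coframe.
- by rewrite trmx_mul mulmxA -(mulmxA _ (rot7 _ _)) (rot7_gram rel) mulmx1.
- by move=> v; rewrite (vol_sem Jy dtE wE) (rot_vol _ rel).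
Qed.

Lemma cone_G2_structure : G2_structure cone_phi cone_metric cone_vol.
Proof.
split; [exact: cone_phi_form|exact: cone_is_metric|exact: cone_vol_form|].
exact: cone_local_coframes.
Qed.

Lemma derivable_natural k (a : dform B k) i y : smooth_natural a ->
  img (A := B) i y -> derivable_form (a i) y.
Proof. by move=> [sa _] iy u v; apply: smooth_derivable (sa i u) iy. Qed.

(** d(F a) = F' dt /\ a + F da, with the first term already in list form, as the algebraic
    identities expect. *)
Lemma extd_scale k (F : R -> R) dF (a : dform B k) i (y : 'rV[R]_(1 + 6)) (P : 'M[R]_6) S u :
  is_derive (y 0 0) 1 F dF -> smooth_natural a -> img (A := B) i y ->
  a i y = (fun v => @sem R 6 k (lift_frame P) v S) ->
  extd (fun y v => F (y 0 0) * a i y v) y u =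
  dF * @sem R 6 k.+1 (lift_frame P) u (swedge dtl S) + F (y 0 0) * extd (a i) y u.
Proof.
move=> HF na iy aE.
have D v := (is_derive_coord0 v HF).1.
rewrite (extdM _ (F := fun y : 'rV[R]_(1 + 6) => F (y 0 0))) //; last exact: derivable_natural.
congr (_ + _); have -> : swedge dtl S = [seq (x.1, 7%N :: x.2) | x <- S].
  by rewrite /= cats0; apply: eq_map => x; rewrite mul1r.
rewrite -dt_sem mulr_sumr; apply: eq_bigr => l _.
rewrite (@derive_val _ _ _ _ _ _ _ (D (u l))) aE.
by rewrite [RHS]mulrCA; congr (_ * _); rewrite mulrA (mulrC dF).
Qed.

Definition cone_ww : dform B 4 := pullf J (fun i x => @ewedge R 6 2 2 (w i x) (w i x)).
Definition psipdt : dform B 4 := fun i y => @ewedge R (1 + 6) 3 1 (pullf J psip i y) (@dt R 6).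
Definition psimdt : dform B 4 := fun i y => @ewedge R (1 + 6) 3 1 (pullf J psim i y) (@dt R 6).
Definition sigmadt : dform B 3 := fun i y => @ewedge R (1 + 6) 2 1 (pullf J sigma2 i y) (@dt R 6).

Lemma natural_ww : smooth_natural cone_ww.
Proof. exact: (smooth_natural_wedge atlasA openJ natural_w natural_w). Qed.
Lemma natural_psipdt : smooth_natural psipdt.
Proof. exact: (smooth_natural_wedge atlasA openJ natural_psip natural_dt). Qed.
Lemma natural_psimdt : smooth_natural psimdt.
Proof. exact: (smooth_natural_wedge atlasA openJ natural_psim natural_dt). Qed.
Lemma natural_sigmadt : smooth_natural sigmadt.
Proof. exact: (smooth_natural_wedge atlasA openJ natural_sigma2 natural_dt). Qed.

Lemma extd_pull_psip i y : img (A := B) i y ->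
  extd (pullf J psip i) y = (fun u => 0).
Proof.
move=> /img_cylinder[Jy iy]; apply/funext => u; rewrite extd_pullf.
by have [_ _ _ /(_ i _ iy)[_ H _]] := tors; apply: H.
Qed.

Lemma extd_pull_psim i (y : 'rV[R]_(1 + 6)) : img (A := B) i y ->
  extd (pullf J psim i) y = (fun u =>
    - (2 * c / 3) * @ewedge R (1 + 6) 2 2 (pullf J w i y) (pullf J w i y) u +
    -1 * @ewedge R (1 + 6) 2 2 (pullf J sigma2 i y) (pullf J w i y) u).
Proof.
move=> /img_cylinder[Jy iy]; apply/funext => u; rewrite extd_pullf mulN1r.
by have [_ _ _ /(_ i _ iy)[_ _ H]] := tors; apply: H.
Qed.

Lemma extd_pull_w i (y : 'rV[R]_(1 + 6)) : img (A := B) i y ->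
  extd (pullf J w i) y = (fun u => c * pullf J psip i y u).
Proof.
move=> /img_cylinder[Jy iy]; apply/funext => u; rewrite extd_pullf.
exact: cpl.
Qed.

(** In every product chart dt is a constant covector, so [extd_ewedge_cst] applies. *)
Lemma extd_wdt i (y : 'rV[R]_(1 + 6)) u : img (A := B) i y ->
  extd (wdt i) y u = c * psipdt i y u.
Proof.
move=> iy; rewrite (@extd_ewedge_cst R 7 2 1 (pullf J w i) (@dt R 6)); last first.
  exact: derivable_natural natural_w iy.
by rewrite (extd_pull_w iy); apply: ewedgeZl.
Qed.

Lemma extd_psipdt i (y : 'rV[R]_(1 + 6)) u : img (A := B) i y ->
  extd (psipdt i) y u = 0.
Proof.
move=> iy; rewrite (@extd_ewedge_cst R 7 3 1 (pullf J psip i) (@dt R 6)); last first.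
  exact: derivable_natural natural_psip iy.
by rewrite (extd_pull_psip iy); apply: ewedge0l.
Qed.

Lemma extd_psimdt i (y : 'rV[R]_(1 + 6)) u : img (A := B) i y ->
  extd (psimdt i) y u = - (2 * c / 3) *
    @ewedge R 7 4 1 (@ewedge R (1 + 6) 2 2 (pullf J w i y) (pullf J w i y)) (@dt R 6) u +
    -1 * @ewedge R 7 4 1
      (@ewedge R (1 + 6) 2 2 (pullf J sigma2 i y) (pullf J w i y)) (@dt R 6) u.
Proof.
move=> iy; rewrite (@extd_ewedge_cst R 7 3 1 (pullf J psim i) (@dt R 6)); last first.
  exact: derivable_natural natural_psim iy.
rewrite (extd_pull_psim iy) (@ewedgeDl R 7 4 1); congr (_ + _); exact: ewedgeZl.
Qed.

Lemma extd_ww i (y : 'rV[R]_(1 + 6)) u : img (A := B) i y -> extd (cone_ww i) y u = 0.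
Proof.
move=> iy; have [P E a b p q r u' x z _ _ _ _ wE pE _ _] := cone_frameP iy.
have [Jy iy'] := (img_cylinder (A := A) J i y).1 iy.
rewrite extd_pullf /pull extd_ewedge_sq; last first.
  move=> v v'; have [_ sw _] := w_form.
  exact: smooth_derivable (sw i v) iy'.
have -> : extd (w i) (rsubmx y) = (fun v => c * psip i (rsubmx y) v).
  by apply/funext => v; apply: cpl.
rewrite (@ewedgeZl R 6 3 2) -[ewedge _ _ _]/(@ewedge R (1 + 6) 3 2 (pullf J psip i y) (pullf J w i y) u).
rewrite wE pE (@ewedge_sem R 6 3 2) // psip_w.
by rewrite !mulr0.
Qed.

Lemma dpow m t : J t -> is_derive t 1 (fun t => f t ^+ m.+1) (m.+1%:R * f t ^+ m * h t).
Proof.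
move=> Jt; elim: m => [|m IH].
  by under eq_fun do rewrite expr1; rewrite expr0 !mul1r; apply: df.
under eq_fun do rewrite exprS.
apply: (is_derive_eq (is_derive_mul (df Jt) IH)).
by rewrite -(natr1 m.+1) exprS; ring.
Qed.

Lemma d_f3cs t : J t -> is_derive t 1 (fun t => f t ^+ 3 * cs t)
  (3 * f t ^+ 2 * h t * cs t + f t ^+ 3 * (2 * c * sn t ^+ 2 / f t)).
Proof. by move=> Jt; exact: is_derive_mul (dpow 2 Jt) (dcos_th dth Jt). Qed.

Lemma d_f3sn t : J t -> is_derive t 1 (fun t => f t ^+ 3 * sn t)
  (3 * f t ^+ 2 * h t * sn t - f t ^+ 3 * (2 * c * sn t * cs t / f t)).
Proof.
move=> Jt; have H := is_derive_mul (dpow 2 Jt) (dsin_th dth Jt).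
by apply: (is_derive_eq H); rewrite mulrN.
Qed.

Lemma d_Nf3sn t : J t -> is_derive t 1 (fun t => - (f t ^+ 3 * sn t))
  (- (3 * f t ^+ 2 * h t * sn t - f t ^+ 3 * (2 * c * sn t * cs t / f t))).
Proof. by move=> Jt; exact: is_deriveN (d_f3sn Jt). Qed.

Lemma d_f4 t : J t -> is_derive t 1 (fun t => f t ^+ 4 / 2) (2 * f t ^+ 3 * h t).
Proof.
move=> Jt; have H := is_derive_mul (dpow 3 Jt) (is_derive_cst (2^-1 : R) t 1).
by apply: (is_derive_eq H); rewrite /cst mulr0 addr0; field.
Qed.

Lemma d_f2 t : J t -> is_derive t 1 (fun t => f t ^+ 2) (2 * f t * h t).
Proof. by move=> Jt; have := dpow 1 Jt; rewrite expr1. Qed.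

Definition tau1c t : R := (h t - c / 3 * cs t) / f t.
Definition cone_tau1 : dform B 1 := fun i y v => tau1c (y 0 0) * dtf i y v.
Definition cone_tau2 : dform B 2 := fun i y v =>
  (fun t => - (f t * cs t)) (y 0 0) * pullf J sigma2 i y v.
Definition cone_tau3 : dform B 3 := fun i y v =>
  (fun t => - (c * (f t ^+ 2 * (sn t * cs t)))) (y 0 0) * pullf J psip i y v +
  ((fun t => c * (f t ^+ 2 * sn t ^+ 2)) (y 0 0) * pullf J psim i y v +
   ((fun t => 4 / 3 * c * (f t * sn t)) (y 0 0) * wdt i y v +
    (fun t => - (f t * sn t)) (y 0 0) * sigmadt i y v)).

Lemma form_of_natural k (a : dform B k) : smooth_natural a ->
  (forall i y, img (A := B) i y -> exists E S, a i y = (fun v => @sem R 6 k E v S)) ->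
  is_form a.
Proof.
move=> [sa na] H; split=> // i y /H[E [S ->]].
by split; [exact: sem_multilinear|exact: sem_alternating].
Qed.

Lemma tau1_sem i (y : 'rV[R]_(1 + 6)) E : @dt R 6 = (fun v => @sem R 6 1 E v dtl) ->
  cone_tau1 i y = (fun v => @sem R 6 1 E v (sscale (tau1c (y 0 0)) dtl)).
Proof.
by move=> dtE; apply/funext => v; rewrite /cone_tau1 /dtf dtE sem_scale.
Qed.

Lemma tau2_sem i (y : 'rV[R]_(1 + 6)) E S :
  pullf J sigma2 i y = (fun v => @sem R 6 2 E v S) ->
  cone_tau2 i y = (fun v => @sem R 6 2 E v (sscale (- (f (y 0 0) * cs (y 0 0))) S)).
Proof. by move=> sE; apply/funext => v; rewrite /cone_tau2 sE sem_scale. Qed.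

Lemma tau3_sem i (y : 'rV[R]_(1 + 6)) (E : 'M[R]_7) a b p q r u x z : J (y 0 0) ->
  @dt R 6 = (fun v => @sem R 6 1 E v dtl) ->
  pullf J w i y = (fun v => @sem R 6 2 E v (W (f (y 0 0)))) ->
  pullf J psip i y = (fun v => @sem R 6 3 E v (Pp (f (y 0 0)))) ->
  pullf J psim i y = (fun v => @sem R 6 3 E v (Pm (f (y 0 0)))) ->
  pullf J sigma2 i y = (fun v => @sem R 6 2 E v
      (sscale ((f (y 0 0))^-1 ^+ 2) (su3_sigma a b p q r u x z))) ->
  cone_tau3 i y = (fun v => @sem R 6 3 E v
    (g2_tau3 (f (y 0 0)) (sn (y 0 0)) (cs (y 0 0)) c a b p q r u x z)).
Proof.
move=> Jy dtE wE pE mE sE; apply/funext => v.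
rewrite -(tau3_alg E c a b p q r u x z (f_neq0 Jy) (cs_sqr (y 0 0))).
rewrite /cone_tau3 /wdt /sigmadt wE pE mE sE dtE (@ewedge_semf R 6 2 1) //.
by rewrite (@ewedge_semf R 6 2 1).
Qed.

Lemma natural_tau1 : smooth_natural cone_tau1.
Proof.
have sf := smooth_f; have sh := smooth_h; have sc := smooth_cs.
apply: (smooth_natural_scale atlasA openJ _ natural_dt).
have s1 := smooth_coord0M openJ (smooth_coord0_cst 6 J (- (c / 3))) sc.
have s2 := smooth_coord0M openJ (smooth_coord0D openJ sh s1)
  (smooth_coord0V openJ f_neq0 sf).
by rewrite (_ : tau1c = (fun t => (h t + - (c / 3) * cs t) * (f t)^-1)) //;
  apply/funext => t; rewrite mulNr.
Qed.

Lemma natural_tau2 : smooth_natural cone_tau2.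
Proof.
have sf := smooth_f; have sc := smooth_cs.
exact: (smooth_natural_scale atlasA openJ
  (smooth_coord0N openJ (smooth_coord0M openJ sf sc)) natural_sigma2).
Qed.

Lemma natural_tau3 : smooth_natural cone_tau3.
Proof.
have sf := smooth_f; have sc := smooth_cs; have ss := smooth_sn.
have sK a := smooth_coord0_cst 6 J a.
have s2 := smooth_coord0X openJ 2 sf.
have n1 := smooth_natural_scale atlasA openJ (smooth_coord0N openJ
  (smooth_coord0M openJ (sK c) (smooth_coord0M openJ s2 (smooth_coord0M openJ ss sc))))
  natural_psip.
have n2 := smooth_natural_scale atlasA openJ
  (smooth_coord0M openJ (sK c) (smooth_coord0M openJ s2 (smooth_coord0X openJ 2 ss)))
  natural_psim.
have n3 := smooth_natural_scale atlasA openJ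
  (smooth_coord0M openJ (sK (4 / 3 * c)) (smooth_coord0M openJ sf ss)) natural_wdt.
have n4 := smooth_natural_scale atlasA openJ
  (smooth_coord0N openJ (smooth_coord0M openJ sf ss)) natural_sigmadt.
have add := fun k => @smooth_natural_add _ _ _ _ _ atlasA openJ k.
exact: (add _ _ _ n1 (add _ _ _ n2 (add _ _ _ n3 n4))).
Qed.

Definition star_phi : dform B 4 := fun i y v =>
  (fun t => f t ^+ 4 / 2) (y 0 0) * cone_ww i y v +
  ((fun t => f t ^+ 3 * sn t) (y 0 0) * psipdt i y v +
   (fun t => f t ^+ 3 * cs t) (y 0 0) * psimdt i y v).

Lemma hodge_cone_sem i (y : 'rV[R]_(1 + 6)) (E : 'M[R]_7) a S T : J (y 0 0) ->
  E \in unitmx -> cone_metric i y = E *m E^T ->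
  @dt R 6 = (fun v => @sem R 6 1 E v dtl) ->
  pullf J w i y = (fun v => @sem R 6 2 E v (W (f (y 0 0)))) ->
  a = (fun v => @sem R 6 3 E v S) -> shodge S = Some T ->
  @hodge R 3 4 (cone_metric i y) (cone_vol i y) a = (fun v => @sem R 6 4 E v T).
Proof.
move=> Jy Eu gE dtE wE -> ST; apply/funext => v.
by rewrite gE (vol_sem Jy dtE wE) (hodge_sem v Eu ST).
Qed.

Lemma hodge_cone_phi i (y : 'rV[R]_(1 + 6)) v : img (A := B) i y ->
  @hodge R 3 4 (cone_metric i y) (cone_vol i y) (cone_phi i y) v = star_phi i y v.
Proof.
move=> iy; have [Jy _] := (img_cylinder (A := A) J i y).1 iy.
have [P E a b p q r u x z _ Eu gE dtE wE pE mE _] := cone_frameP iy.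
rewrite (hodge_cone_sem Jy Eu gE dtE wE (phi_sem Jy dtE wE pE mE) (shodge_phi _ _)).
rewrite -(star_phi_alg E (f_neq0 Jy) (cs_sqr (y 0 0))).
rewrite /star_phi /cone_ww /psipdt /psimdt.
rewrite -[pullf J (fun _ _ => _) i y v]/(@ewedge R (1 + 6) 2 2 (pullf J w i y) (pullf J w i y) v).
rewrite wE pE mE dtE (@ewedge_semf R 6 2 2) // (@ewedge_semf R 6 3 1) //.
by rewrite (@ewedge_semf R 6 3 1).
Qed.

Lemma extd_cone_phi i (y : 'rV[R]_(1 + 6)) u : img (A := B) i y ->
  extd (cone_phi i) y u = 3 * @ewedge R 7 1 3 (cone_tau1 i y) (cone_phi i y) u +
    @hodge R 3 4 (cone_metric i y) (cone_vol i y) (cone_tau3 i y) u.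
Proof.
move=> iy; have [Jy _] := (img_cylinder (A := A) J i y).1 iy.
have [P E a b p q r u' x z EP Eu gE dtE wE pE mE sE] := cone_frameP iy.
rewrite (hodge_cone_sem Jy Eu gE dtE wE (tau3_sem Jy dtE wE pE mE sE) (shodge_tau3 _ _ _ _ _ _ _ _ _ _ _ _)).
rewrite (phi_sem Jy dtE wE pE mE) (tau1_sem i y dtE) (@ewedge_semf R 6 1 3) //.
(* The right side becomes the expanded d phi; what remains is to differentiate phi term by term. *)
rewrite -(dphi_alg E (h (y 0 0)) c a b p q r u' x z (f_neq0 Jy) (cs_sqr (y 0 0))).
have wdtE : wdt i y = (fun v => @sem R 6 3 E v (swedge (W (f (y 0 0))) dtl)).
  by rewrite /wdt wE dtE (@ewedge_semf R 6 2 1).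
have sf := smooth_f; have ss := smooth_sn; have sc := smooth_cs.
have s3 := smooth_coord0X openJ 3 sf.
have n1 := smooth_natural_scale atlasA openJ (smooth_coord0X openJ 2 sf) natural_wdt.
have n2 := smooth_natural_scale atlasA openJ (smooth_coord0M openJ s3 sc) natural_psip.
have n3 := smooth_natural_scale atlasA openJ
  (smooth_coord0N openJ (smooth_coord0M openJ s3 ss)) natural_psim.
(* [extd_scale] needs the coframe displayed as [lift_frame P]. *)
rewrite EP in wdtE pE mE.
rewrite extdD; [|exact: derivable_natural n1 iy|
  exact: derivable_natural (smooth_natural_add atlasA openJ n2 n3) iy].
rewrite extdD; [|exact: derivable_natural n2 iy|exact: derivable_natural n3 iy].
rewrite (extd_scale u (d_f2 Jy) natural_wdt iy wdtE) (extd_wdt _ iy).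
rewrite (extd_scale u (d_f3cs Jy) natural_psip iy pE) (extd_pull_psip iy) mulr0 addr0.
rewrite (extd_scale u (d_Nf3sn Jy) natural_psim iy mE) (extd_pull_psim iy).
rewrite -EP in wdtE pE mE *.
rewrite /psipdt pE dtE wE sE (@ewedge_semf R 6 3 1) // (@ewedge_semf R 6 2 2) //.
rewrite (@ewedge_semf R 6 2 2) // mulN1r.
by rewrite -!addrA.
Qed.

Lemma extd_star_phi i (y : 'rV[R]_(1 + 6)) u : img (A := B) i y ->
  extd (star_phi i) y u = 4 * @ewedge R 7 1 4 (cone_tau1 i y) (star_phi i y) u +
    @ewedge R 7 2 3 (cone_tau2 i y) (cone_phi i y) u.
Proof.
move=> iy; have [Jy _] := (img_cylinder (A := A) J i y).1 iy.
have [P E a b p q r u' x z EP Eu gE dtE wE pE mE sE] := cone_frameP iy.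
have starE : star_phi i y = (fun v => @sem R 6 4 E v (star7 (g2_phi (sn (y 0 0)) (cs (y 0 0))))).
  apply/funext => v; rewrite -hodge_cone_phi //.
  by rewrite (hodge_cone_sem Jy Eu gE dtE wE (phi_sem Jy dtE wE pE mE) (shodge_phi _ _)).
rewrite starE (phi_sem Jy dtE wE pE mE) (tau1_sem i y dtE) (tau2_sem sE).
rewrite (@ewedge_semf R 6 1 4) ?sizes_star_phi // (@ewedge_semf R 6 2 3) //.
rewrite -(dstar_phi_alg E (h (y 0 0)) c a b p q r u' x z (f_neq0 Jy) (cs_sqr (y 0 0))).
have wwE : cone_ww i y = (fun v => @sem R 6 4 E v (swedge (W (f (y 0 0))) (W (f (y 0 0))))).
  rewrite -[cone_ww i y]/(@ewedge R (1 + 6) 2 2 (pullf J w i y) (pullf J w i y)).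
  by rewrite wE (@ewedge_semf R 6 2 2).
have pdtE : psipdt i y = (fun v => @sem R 6 4 E v (swedge (Pp (f (y 0 0))) dtl)).
  by rewrite /psipdt pE dtE (@ewedge_semf R 6 3 1).
have mdtE : psimdt i y = (fun v => @sem R 6 4 E v (swedge (Pm (f (y 0 0))) dtl)).
  by rewrite /psimdt mE dtE (@ewedge_semf R 6 3 1).
have sf := smooth_f; have ss := smooth_sn; have sc := smooth_cs.
have s3 := smooth_coord0X openJ 3 sf.
have s4 := smooth_coord0M openJ (smooth_coord0X openJ 4 sf) (smooth_coord0_cst 6 J (2^-1 : R)).
have n1 := smooth_natural_scale atlasA openJ s4 natural_ww.
have n2 := smooth_natural_scale atlasA openJ (smooth_coord0M openJ s3 ss) natural_psipdt.
have n3 := smooth_natural_scale atlasA openJ (smooth_coord0M openJ s3 sc) natural_psimdt.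
rewrite EP in wwE pdtE mdtE.
rewrite extdD; [|exact: derivable_natural n1 iy|
  exact: derivable_natural (smooth_natural_add atlasA openJ n2 n3) iy].
rewrite extdD; [|exact: derivable_natural n2 iy|exact: derivable_natural n3 iy].
rewrite (extd_scale u (d_f4 Jy) natural_ww iy wwE) (extd_ww _ iy) mulr0 addr0.
rewrite (extd_scale u (d_f3sn Jy) natural_psipdt iy pdtE) (extd_psipdt _ iy) mulr0 addr0.
rewrite (extd_scale u (d_f3cs Jy) natural_psimdt iy mdtE) (extd_psimdt _ iy).
rewrite -EP dtE wE sE (@ewedge_semf R 6 2 2) // (@ewedge_semf R 6 2 2) //.
by rewrite (@ewedge_semf R 6 4 1) // (@ewedge_semf R 6 4 1) // mulN1r.
Qed.

Lemma cone_class_X234 : class_X234 cone_phi cone_metric cone_vol.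
Proof.
exists (fun=> 0), cone_tau1, cone_tau2, cone_tau3; split=> //; split.
- by move=> i; apply: smooth_cst.
- split.
  + apply: form_of_natural natural_tau1 _ => i y iy.
    have [P E a b p q r u x z EP Eu gE dtE wE pE mE sE] := cone_frameP iy.
    by exists E; eexists; apply: tau1_sem.
  + apply: form_of_natural natural_tau2 _ => i y iy.
    have [P E a b p q r u x z EP Eu gE dtE wE pE mE sE] := cone_frameP iy.
    by exists E; eexists; apply: tau2_sem sE.
  + apply: form_of_natural natural_tau3 _ => i y iy.
    have [P E a b p q r u x z EP Eu gE dtE wE pE mE sE] := cone_frameP iy.
    have [Jy _] := (img_cylinder (A := A) J i y).1 iy.
    by exists E; eexists; apply: tau3_sem sE.
- move=> i y iy v; have [Jy _] := (img_cylinder (A := A) J i y).1 iy.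
  have [P E a b p q r u x z EP Eu gE dtE wE pE mE sE] := cone_frameP iy.
  rewrite (hodge_cone_sem Jy Eu gE dtE wE (phi_sem Jy dtE wE pE mE) (shodge_phi _ _)).
  rewrite (tau2_sem sE) (@ewedge_semf R 6 2 4) ?sizes_star_phi //.
  exact: (tau2_star_phi E _ a b p q r u x z (cs_sqr (y 0 0))).
- move=> i y iy; have [Jy _] := (img_cylinder (A := A) J i y).1 iy.
  have [P E a b p q r u x z EP Eu gE dtE wE pE mE sE] := cone_frameP iy.
  rewrite (hodge_cone_sem Jy Eu gE dtE wE (phi_sem Jy dtE wE pE mE) (shodge_phi _ _)).
  rewrite (tau3_sem Jy dtE wE pE mE sE) (phi_sem Jy dtE wE pE mE).
  rewrite (@ewedge_semf R 6 3 3) ?sizes_tau3 // (@ewedge_semf R 6 3 4) ?sizes_tau3 ?sizes_star_phi //.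
  split=> v; [apply: tau3_phi (cs_sqr (y 0 0)) v|
              apply: tau3_star_phi (f_neq0 Jy) (cs_sqr (y 0 0)) v].
- move=> i y iy; split=> v; first by rewrite extd_cone_phi // mul0r add0r.
  (* The Hodge star of phi equals [star_phi] on the open chart image only, which is enough for its
     derivatives there. *)
  rewrite (extd_near (U := img (A := B) i) (b := star_phi i)) //.
  + rewrite extd_star_phi //; congr (_ * ewedge _ _ _ + _).
    by apply/funext => u; rewrite hodge_cone_phi.
  + exact: (@open_img_cylinder _ _ _ _ _ atlasA openJ i).
  + by move=> y' iy' v'; rewrite hodge_cone_phi.
Qed.

End Cone.

(** * Ricci curvature of warped products *)

Section Warped.
Variables (R : realType) (n : nat) (J : set R) (U : set 'rV[R]_n).
Variables (G : 'rV[R]_n -> 'M[R]_n) (f h k : R -> R).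
Hypotheses (openJ : open J) (openU : open U)
  (f_neq0 : forall t, J t -> f t != 0)
  (df : forall t, J t -> is_derive t 1 f (h t))
  (dh : forall t, J t -> is_derive t 1 h (k t))
  (Gsym : forall x, U x -> (G x)^T = G x)
  (Gunit : forall x, U x -> G x \in unitmx)
  (Gsm : forall a b, smooth_on U (fun x => G x a b)).

Let V := [set y : 'rV[R]_(1 + n) | J (y 0 0) /\ U (rsubmx y)].

Definition warped (y : 'rV[R]_(1 + n)) : 'M[R]_(1 + n) :=
  block_mx (1%:M : 'M[R]_1) (0 : 'M[R]_(1, n)) (0 : 'M[R]_(n, 1))
    (f (y 0 0) ^+ 2 *: G (rsubmx y)).

Local Notation o := (lshift n (0 : 'I_1)).
Local Notation r a := (rshift 1 a).
Local Notation x_ y := (rsubmx (y : 'rV[R]_(1 + n))).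

Lemma openV : open V.
Proof. exact: (open_cylinder openJ openU). Qed.

Lemma nearV y : V y -> \forall z \near y, V z.
Proof. by move=> Vy; apply: open_nbhs_nbhs; split=> //; exact: openV. Qed.

Lemma ord_o : o = 0 :> 'I_(1 + n).
Proof. exact: val_inj. Qed.

Lemma ovec_o : (ovec R o : 'rV[R]_(1 + n)) 0 0 = 1.
Proof. by rewrite mxE -ord_o !eqxx. Qed.

Lemma ovec_r a : (ovec R (r a) : 'rV[R]_(1 + n)) 0 0 = 0.
Proof. by rewrite mxE -ord_o eq_lrshift andbF. Qed.

Lemma rsub_ovec_o : rsubmx (ovec R o) = 0 :> 'rV[R]_n.
Proof. by apply/rowP => l; rewrite !mxE eq_rlshift andbF. Qed.

Lemma rsub_ovec_r a : rsubmx (ovec R (r a)) = ovec R a :> 'rV[R]_n.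
Proof. by apply/rowP => l; rewrite !mxE (inj_eq (@rshift_inj _ _)). Qed.

Lemma pder_near i (F F' : 'rV[R]_(1 + n) -> R) y : V y ->
  (forall z, V z -> F z = F' z) -> pder i F y = pder i F' y.
Proof.
by move=> Vy FF'; apply: near_eq_derive; apply: filterS (nearV Vy) => z /FF'.
Qed.

Lemma pder_cst i (a : R) (y : 'rV[R]_(1 + n)) : pder i (fun=> a) y = 0.
Proof. exact: derive_cst. Qed.

Lemma pder_o_rsub (F : 'rV[R]_n -> R) y : pder o (fun z => F (x_ z)) y = 0.
Proof. by rewrite /pder derive_rsubmx rsub_ovec_o derive0. Qed.

Lemma pder_r_rsub a (F : 'rV[R]_n -> R) y :
  pder (r a) (fun z => F (x_ z)) y = pder a F (x_ y).
Proof. by rewrite /pder derive_rsubmx rsub_ovec_r. Qed.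

Lemma pder_o_mul (F : R -> R) dF (K : 'rV[R]_n -> R) (y : 'rV[R]_(1 + n)) : differentiable K (x_ y) ->
  is_derive (y 0 0) 1 F dF -> pder o (fun z => F (z 0 0) * K (x_ z)) y = dF * K (x_ y).
Proof.
move=> dK HF; have [D _] := is_derive_coord0 (ovec R o) HF.
have DK : is_derive y (ovec R o) (fun z => K (x_ z)) 0.
  split; last exact: pder_o_rsub.
  by apply: derivable_lin_comp; [exact: rsubmx_lin|exact: diff_derivable].
rewrite /pder (@derive_val _ _ _ _ _ _ _ (is_derive_mul D DK)).
by rewrite ovec_o // mul1r mulr0 addr0.
Qed.

Lemma pder_r_mul a (F : R -> R) dF (K : 'rV[R]_n -> R) (y : 'rV[R]_(1 + n)) : differentiable K (x_ y) ->
  is_derive (y 0 0) 1 F dF ->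
  pder (r a) (fun z => F (z 0 0) * K (x_ z)) y = F (y 0 0) * pder a K (x_ y).
Proof.
move=> dK HF; have [D _] := is_derive_coord0 (ovec R (r a)) HF.
have DK : is_derive y (ovec R (r a)) (fun z => K (x_ z)) (pder a K (x_ y)).
  split; last exact: pder_r_rsub.
  by apply: derivable_lin_comp; [exact: rsubmx_lin|exact: diff_derivable].
rewrite /pder (@derive_val _ _ _ _ _ _ _ (is_derive_mul D DK)).
by rewrite ovec_r !mul0r add0r.
Qed.

Lemma diffG a b y : V y -> differentiable (fun x => G x a b) (x_ y).
Proof. by move=> [_ Uy]; apply: smooth_differentiable (Gsm a b) Uy. Qed.

Lemma warped_oo : (fun y => warped y o o) = fun=> 1.
Proof. by apply/funext => y; rewrite /warped block_mxEul mxE eqxx. Qed.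
Lemma warped_or a : (fun y => warped y o (r a)) = fun=> 0.
Proof. by apply/funext => y; rewrite /warped block_mxEur mxE. Qed.
Lemma warped_ro a : (fun y => warped y (r a) o) = fun=> 0.
Proof. by apply/funext => y; rewrite /warped block_mxEdl mxE. Qed.
Lemma warped_rr a b : (fun y => warped y (r a) (r b)) =
  (fun y => (fun t => f t ^+ 2) (y 0 0) * (fun x => G x a b) (x_ y)).
Proof. by apply/funext => y; rewrite /warped block_mxEdr mxE. Qed.

Lemma df2 t : J t -> is_derive t 1 (fun t => f t ^+ 2) (2 * f t * h t).
Proof.
move=> Jt; under eq_fun do rewrite expr2.
by apply: (is_derive_eq (is_derive_mul (df Jt) (df Jt))); ring.
Qed.

Lemma pder_warped_oc i j y : pder i (fun y => warped y o j) y = 0.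
Proof.
by case: (split_ordP j) => a ->; rewrite ?ord1 (warped_oo, warped_or) pder_cst.
Qed.

Lemma pder_warped_co i j y : pder i (fun y => warped y j o) y = 0.
Proof.
by case: (split_ordP j) => a ->; rewrite ?ord1 (warped_oo, warped_ro) pder_cst.
Qed.

Lemma pder_warped_orr a b y : V y ->
  pder o (fun y => warped y (r a) (r b)) y = 2 * f (y 0 0) * h (y 0 0) * G (x_ y) a b.
Proof.
by move=> Vy; rewrite warped_rr (pder_o_mul (diffG a b Vy) (df2 Vy.1)).
Qed.

Lemma pder_warped_rrr c a b y : V y ->
  pder (r c) (fun y => warped y (r a) (r b)) y =
  f (y 0 0) ^+ 2 * pder c (fun x => G x a b) (x_ y).
Proof.
by move=> Vy; rewrite warped_rr (pder_r_mul c (diffG a b Vy) (df2 Vy.1)).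
Qed.

Lemma inv_warped y : V y -> invmx (warped y) =
  block_mx (1%:M : 'M[R]_1) (0 : 'M[R]_(1, n)) (0 : 'M[R]_(n, 1))
    ((f (y 0 0) ^+ 2)^-1 *: invmx (G (x_ y))).
Proof.
move=> [Jy Uy]; set X := block_mx _ _ _ _.
have f2 : f (y 0 0) ^+ 2 != 0 by rewrite expf_neq0 // f_neq0.
have WX : warped y *m X = 1%:M.
  rewrite /warped /X mulmx_block !mulmx0 !mul0mx !addr0 !add0r mulmx1.
  rewrite -scalemxAl -scalemxAr scalerA mulfV // scale1r mulmxV ?Gunit //.
  by rewrite -scalar_mx_block.
have [Wu _] := mulmx1_unit WX.
by apply: (can_inj (mulKmx Wu)); rewrite WX mulmxV.
Qed.

(** The inverse metric is block diagonal with g^{tt} = 1, so only the summand l = t remains, and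
    there the components g_{jt} and g_{it} are constant. *)
Lemma christoffel_o i j y : V y ->
  christoffel warped o i j y = - (2^-1 * pder o (fun y => warped y i j) y).
Proof.
move=> Vy; rewrite /christoffel inv_warped // big_split_ord big_ord1 /=.
rewrite block_mxEul mxE eqxx !pder_warped_co !add0r mul1r.
rewrite big1 ?addr0 ?mulrN // => b _.
by rewrite block_mxEur mxE mul0r.
Qed.

Lemma christoffel_r c i j y : V y ->
  christoffel warped (r c) i j y = 2^-1 * \sum_b (f (y 0 0) ^+ 2)^-1 *
    invmx (G (x_ y)) c b *
    (pder i (fun y => warped y j (r b)) y + pder j (fun y => warped y i (r b)) y -
     pder (r b) (fun y => warped y i j) y).
Proof.
move=> Vy; rewrite /christoffel inv_warped // big_split_ord big_ord1 /=.
rewrite block_mxEdl mxE mul0r add0r; congr (_ * _); apply: eq_bigr => b _.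
by rewrite block_mxEdr mxE.
Qed.

Lemma chr_ooc j y : V y -> christoffel warped o o j y = 0.
Proof. by move=> Vy; rewrite christoffel_o // pder_warped_oc mulr0 oppr0. Qed.
Lemma chr_oco j y : V y -> christoffel warped o j o y = 0.
Proof. by move=> Vy; rewrite christoffel_o // pder_warped_co mulr0 oppr0. Qed.
(** The right side is a function of t times a function on L in applied form, to be matched by
    [pder_o_mul]. *)
Lemma chr_orr a b y : V y -> christoffel warped o (r a) (r b) y =
  (fun t => - (f t * h t)) (y 0 0) * (fun x => G x a b) (x_ y).
Proof. by move=> Vy; rewrite christoffel_o // pder_warped_orr //=; field. Qed.

Lemma chr_roo c y : V y -> christoffel warped (r c) o o y = 0.
Proof.
move=> Vy; rewrite christoffel_r // big1 ?mulr0 // => b _.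
by rewrite !pder_warped_oc !addr0 subr0 mulr0.
Qed.

Lemma chr_ror c a y : V y ->
  christoffel warped (r c) o (r a) y = (fun t => h t / f t * (c == a)%:R) (y 0 0).
Proof.
move=> Vy; have [Jy Uy] := Vy; have f0 := f_neq0 Jy.
rewrite christoffel_r //=.
transitivity (h (y 0 0) / f (y 0 0) * \sum_b invmx (G (x_ y)) c b * G (x_ y) b a).
  rewrite !mulr_sumr; apply: eq_bigr => b _.
  rewrite pder_warped_orr // !pder_warped_oc addr0 subr0.
  by rewrite -[in G (x_ y) a b](Gsym Uy) mxE; field.
congr (_ * _); have /matrixP/(_ c a) := mulVmx (Gunit Uy).
by rewrite !mxE.
Qed.

Lemma chr_rro c a y : V y ->
  christoffel warped (r c) (r a) o y = (fun t => h t / f t * (c == a)%:R) (y 0 0).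
Proof.
move=> Vy; transitivity (christoffel warped (r c) o (r a) y); last exact: chr_ror.
rewrite !christoffel_r //; congr (_ * _).
apply: eq_bigr => b _; congr (_ * _).
by rewrite !pder_warped_oc !pder_warped_co add0r addr0.
Qed.

Lemma chr_rrr c a b y : V y ->
  christoffel warped (r c) (r a) (r b) y = (fun x => christoffel G c a b x) (x_ y).
Proof.
move=> Vy; have [Jy Uy] := Vy; have f0 := f_neq0 Jy.
rewrite christoffel_r //= /christoffel; congr (_ * _); apply: eq_bigr => d _.
by rewrite !pder_warped_rrr //; field.
Qed.

Lemma chr_sym c a b x : U x -> christoffel G c a b x = christoffel G c b a x.
Proof.
move=> Ux; rewrite /christoffel; congr (_ * _); apply: eq_bigr => d _.
congr (_ * _); rewrite [X in X - _]addrC; congr (_ - _); apply: near_eq_derive.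
have : \forall z \near x, U z by exact: open_nbhs_nbhs.
by apply: filterS => z Uz; rewrite -[in LHS](Gsym Uz) mxE.
Qed.

Lemma d_fh t : J t ->
  is_derive t 1 (fun t => - (f t * h t)) (- (h t ^+ 2 + f t * k t)).
Proof.
move=> Jt; have H := is_deriveN (is_derive_mul (df Jt) (dh Jt)).
by apply: (is_derive_eq H); rewrite expr2.
Qed.

Lemma d_hf (s : R) t : J t ->
  is_derive t 1 (fun t => h t / f t * s) ((k t / f t - h t ^+ 2 / f t ^+ 2) * s).
Proof.
move=> Jt; have f0 := f_neq0 Jt.
have H := is_derive_mul (is_derive_mul (dh Jt) (is_derive_inv f0 (df Jt)))
  (is_derive_cst s t 1).
by apply: (is_derive_eq H); rewrite /cst; field.
Qed.

Lemma pder_coord_r a (F : R -> R) dF (y : 'rV[R]_(1 + n)) : is_derive (y 0 0) 1 F dF ->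
  pder (r a) (fun z : 'rV[R]_(1 + n) => F (z 0 0)) y = 0.
Proof.
move=> HF; have [D _] := is_derive_coord0 (ovec R (r a)) HF.
by rewrite /pder (@derive_val _ _ _ _ _ _ _ D) ovec_r mul0r.
Qed.

Lemma pder_coord_o (F : R -> R) dF (y : 'rV[R]_(1 + n)) : is_derive (y 0 0) 1 F dF ->
  pder o (fun z : 'rV[R]_(1 + n) => F (z 0 0)) y = dF.
Proof.
move=> HF; have [D _] := is_derive_coord0 (ovec R o) HF.
by rewrite /pder (@derive_val _ _ _ _ _ _ _ D) ovec_o // mul1r.
Qed.

Lemma pder_chr_ooc i j y : V y -> pder i (christoffel warped o o j) y = 0.
Proof. by move=> Vy; rewrite (pder_near _ Vy (chr_ooc j)) pder_cst. Qed.
Lemma pder_chr_oco i j y : V y -> pder i (christoffel warped o j o) y = 0.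
Proof. by move=> Vy; rewrite (pder_near _ Vy (chr_oco j)) pder_cst. Qed.
Lemma pder_chr_roo i c y : V y -> pder i (christoffel warped (r c) o o) y = 0.
Proof. by move=> Vy; rewrite (pder_near _ Vy (chr_roo c)) pder_cst. Qed.
Lemma pder_o_chr_orr a b y : V y -> pder o (christoffel warped o (r a) (r b)) y =
  - (h (y 0 0) ^+ 2 + f (y 0 0) * k (y 0 0)) * G (x_ y) a b.
Proof.
move=> Vy; rewrite (pder_near _ Vy (chr_orr a b)).
exact: (pder_o_mul (diffG a b Vy) (d_fh Vy.1)).
Qed.
Lemma pder_o_chr_rro c a y : V y -> pder o (christoffel warped (r c) (r a) o) y =
  (k (y 0 0) / f (y 0 0) - h (y 0 0) ^+ 2 / f (y 0 0) ^+ 2) * (c == a)%:R.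
Proof.
move=> Vy; rewrite (pder_near _ Vy (chr_rro c a)).
exact: (pder_coord_o (d_hf _ Vy.1)).
Qed.
Lemma pder_r_chr_rro d c a y : V y -> pder (r d) (christoffel warped (r c) (r a) o) y = 0.
Proof.
move=> Vy; rewrite (pder_near _ Vy (chr_rro c a)).
exact: (pder_coord_r _ (d_hf _ Vy.1)).
Qed.
Lemma pder_r_chr_ror d c a y : V y -> pder (r d) (christoffel warped (r c) o (r a)) y = 0.
Proof.
move=> Vy; rewrite (pder_near _ Vy (chr_ror c a)).
exact: (pder_coord_r _ (d_hf _ Vy.1)).
Qed.
Lemma pder_o_chr_rrr c a b y : V y -> pder o (christoffel warped (r c) (r a) (r b)) y = 0.
Proof. by move=> Vy; rewrite (pder_near _ Vy (chr_rrr c a b)) pder_o_rsub. Qed.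
Lemma pder_r_chr_rrr d c a b y : V y ->
  pder (r d) (christoffel warped (r c) (r a) (r b)) y =
  pder d (christoffel G c a b) (x_ y).
Proof. by move=> Vy; rewrite (pder_near _ Vy (chr_rrr c a b)) pder_r_rsub. Qed.

Lemma sum_delta (F : 'I_n -> R) a : \sum_b F b * (b == a)%:R = F a.
Proof.
rewrite (bigD1 a) //= eqxx mulr1 big1 ?addr0 // => b /negPf ->.
by rewrite mulr0.
Qed.

(** Each of the n directions of L contributes - (f'/f)' - (f'/f)^2 = - f''/f. *)
Lemma ricci_warped_oo y : V y ->
  ricci warped y o o = - n%:R * (k (y 0 0) / f (y 0 0)).
Proof.
move=> Vy; rewrite mxE big_split_ord big_ord1 /=.
rewrite pder_chr_ooc // subrr add0r big_split_ord big_ord1 /=.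
rewrite !chr_ooc // !mul0r subrr add0r.
rewrite big1 ?add0r => [|b _]; last by rewrite chr_ooc // !mul0r subrr.
transitivity (\sum_(a < n) - (k (y 0 0) / f (y 0 0))).
  apply: eq_bigr => a _.
  rewrite pder_chr_roo // pder_o_chr_rro // eqxx sub0r mulr1.
  rewrite big_split_ord big_ord1 /= chr_ooc // !chr_roo // mulr0 mul0r subrr add0r.
  rewrite (eq_bigr (fun b => - (h (y 0 0) / f (y 0 0)) ^+ 2 * (b == a)%:R)); last first.
    move=> b _; rewrite chr_roo // chr_ror // chr_rro // mulr0 sub0r /= eq_sym.
    by case: eqP => _; rewrite ?mulr1 ?mulr0 ?oppr0 // mulNr.
  rewrite (sum_delta (fun=> - (h (y 0 0) / f (y 0 0)) ^+ 2)) exprMn exprVn.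
  by rewrite opprB addrAC subrr add0r.
by rewrite sumr_const card_ord -[LHS]mulr_natl mulrN mulNr.
Qed.

(** The derivative terms vanish, and after contraction both quadratic sums equal f'/f times the same
    Christoffel symbol of G. *)
Lemma ricci_warped_or c y : V y -> ricci warped y o (r c) = 0.
Proof.
move=> Vy; rewrite mxE big_split_ord big_ord1 /=.
rewrite subrr add0r big_split_ord big_ord1 /= !chr_ooc // !mul0r subrr add0r.
rewrite big1 ?add0r => [|b _]; last by rewrite chr_ooc // !mul0r subrr.
apply: big1 => a _.
rewrite pder_r_chr_ror // pder_o_chr_rrr // subrr add0r big_split_ord big_ord1 /=.
rewrite chr_ooc // chr_roo // mulr0 mul0r subrr add0r sumrB.
rewrite (eq_bigr (fun b => christoffel G a a b (x_ y) * (h (y 0 0) / f (y 0 0)) * (b == c)%:R));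
  last by move=> b _; rewrite chr_rrr // chr_ror //= mulrA.
rewrite sum_delta.
rewrite (eq_bigr (fun b => h (y 0 0) / f (y 0 0) * christoffel G b a c (x_ y) * (b == a)%:R)).
  by rewrite sum_delta mulrC subrr.
by move=> b _; rewrite chr_rrr // chr_ror //= eq_sym mulrAC.
Qed.

Lemma ricci_warped_ro c y : V y -> ricci warped y (r c) o = 0.
Proof.
move=> Vy; have [_ Uy] := Vy; rewrite mxE big_split_ord big_ord1 /=.
rewrite pder_chr_oco // pder_chr_ooc // subrr add0r big_split_ord big_ord1 /=.
rewrite !chr_ooc // chr_oco // !mul0r subrr add0r.
rewrite big1 ?add0r => [|b _]; last by rewrite chr_ooc // chr_roo // mul0r mulr0 subrr.
apply: big1 => a _.
rewrite !pder_r_chr_rro // subrr add0r big_split_ord big_ord1 /=.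
rewrite chr_oco // chr_oco // !mulr0 subrr add0r sumrB.
rewrite (eq_bigr (fun b => christoffel G a a b (x_ y) * (h (y 0 0) / f (y 0 0)) * (b == c)%:R));
  last by move=> b _; rewrite chr_rrr // chr_rro //= mulrA.
rewrite sum_delta.
rewrite (eq_bigr (fun b => christoffel G a c b (x_ y) * (h (y 0 0) / f (y 0 0)) * (b == a)%:R)).
  by rewrite sum_delta (chr_sym _ c) // subrr.
by move=> b _; rewrite chr_rrr // chr_rro //= mulrA.
Qed.

(** The summand i = t gives - f f'' G_cd. Each summand a in L gives the summand of Ric G together
    with - f'^2 G_cd + delta_ac f'^2 G_ad from the inner index t; summed over a this is - (n - 1)
    f'^2 G_cd. *)
Lemma ricci_warped_rr c d y : V y -> ricci warped y (r c) (r d) =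
  ricci G (x_ y) c d -
  (f (y 0 0) * k (y 0 0) + (n%:R - 1) * h (y 0 0) ^+ 2) * G (x_ y) c d.
Proof.
move=> Vy; have [Jy Uy] := Vy; have f0 := f_neq0 Jy.
rewrite mxE big_split_ord big_ord1 /=.
rewrite pder_o_chr_orr // pder_chr_ooc // subr0 big_split_ord big_ord1 /=.
rewrite !chr_ooc // chr_oco // !mul0r subrr add0r.
rewrite (eq_bigr (fun b => h (y 0 0) ^+ 2 * G (x_ y) c b * (b == d)%:R)); last first.
  move=> b _; rewrite chr_ooc // chr_orr // chr_ror //= mul0r sub0r.
  by case: eqP => _; rewrite ?mulr1 ?mulr0 ?oppr0 //; field.
rewrite sum_delta.
have step a : pder (r a) (christoffel warped (r a) (r c) (r d)) y -
    pder (r c) (christoffel warped (r a) (r a) (r d)) y +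
    \sum_(p < 1 + n) (christoffel warped (r a) (r a) p y * christoffel warped p (r c) (r d) y -
       christoffel warped (r a) (r c) p y * christoffel warped p (r a) (r d) y) =
    (pder a (christoffel G a c d) (x_ y) - pder c (christoffel G a a d) (x_ y) +
     \sum_(p < n) (christoffel G a a p (x_ y) * christoffel G p c d (x_ y) -
       christoffel G a c p (x_ y) * christoffel G p a d (x_ y))) +
    (- (h (y 0 0) ^+ 2 * G (x_ y) c d) + h (y 0 0) ^+ 2 * G (x_ y) a d * (a == c)%:R).
  rewrite !pder_r_chr_rrr // big_split_ord big_ord1 /=.
  rewrite [X in _ + (_ + X)](eq_bigr (fun p =>
    christoffel G a a p (x_ y) * christoffel G p c d (x_ y) -
    christoffel G a c p (x_ y) * christoffel G p a d (x_ y))); last first.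
    by move=> b _; rewrite !chr_rrr.
  rewrite -[RHS]addrA [X in _ = _ + X]addrC; congr (_ + (_ + _)).
  by rewrite !chr_rro // !chr_orr //= eqxx -[true%:R]/(1 : R); field.
have tail : \sum_(a < n) (- (h (y 0 0) ^+ 2 * G (x_ y) c d) +
    h (y 0 0) ^+ 2 * G (x_ y) a d * (a == c)%:R) =
    n%:R * - (h (y 0 0) ^+ 2 * G (x_ y) c d) + h (y 0 0) ^+ 2 * G (x_ y) c d.
  by rewrite big_split /= sum_delta sumr_const card_ord -[_ *+ n]mulr_natl.
rewrite (eq_bigr _ (fun a _ => step a)) big_split tail.
rewrite [ricci G _ c d]mxE /=; set S := \sum_(i < n) _.
by move: S (n%:R : R) => S N; ring.
Qed.

End Warped.

(** * The common form of the three cases, with parameter kappa *)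

Section ConeTheorem.
Variables (R : realType) (L : topologicalType) (A : charts R L 6).
Variables (w : dform A 2) (psip psim : dform A 3) (g : metric A) (c : R)
  (sigma2 : dform A 2).
Hypotheses (atlasA : is_atlas A) (su3 : SU3_structure w psip psim g)
  (cpl : forall i x, img i x -> forall v, extd (w i) x v = c * psip i x v)
  (tors : coupled_torsion w psip psim g (- (2 * c / 3)) sigma2)
  (ein : forall i x, img i x -> ricci (g i) x = 5 *: g i x).
Variables (J : set R) (f h th : R -> R) (kap : R).
Hypotheses (openJ : open J) (f_gt0 : forall t, J t -> 0 < f t)
  (df : forall t, J t -> is_derive t 1 f (h t))
  (dh : forall t, J t -> is_derive t 1 h (- kap * f t))
  (hf : forall t, J t -> h t ^+ 2 = 1 - kap * f t ^+ 2)
  (dth : forall t, J t -> is_derive t 1 th (- (2 * c * sin (th t) / f t))).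

Local Notation gphi := (@cone_metric R L A g J f).

(** Along t the coefficient is - 6 f''/f = 6 kappa. Along L it is 5 - f f'' - 5 f'^2 = 6 kappa f^2:
    the Einstein constant 5 of g matches the 5 = n - 1 in front of f'^2, so the constants cancel. *)
Lemma cone_ricci i y : img (A := cylinder J A) i y ->
  ricci (gphi i) y = (6 * kap) *: gphi i y.
Proof.
move=> /img_cylinder[Jy iy].
have [gsym _ gsm _] := g_metric su3.
have gu x : img (A := A) i x -> g i x \in unitmx.
  by move=> ix; have [P [Pu _ ->]] := frame_at su3 ix; rewrite unitmx_mul unitmx_tr Pu.
have f0 t : J t -> f t != 0 by move=> Jt; rewrite gt_eqF // f_gt0.
have oi : open (img (A := A) i) by exact: (@open_img _ _ _ _ atlasA i).
have Vy : J (y 0 0) /\ img (A := A) i (rsubmx (y : 'rV[R]_(1 + 6))) by [].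
have E : gphi i = warped (g i) f by [].
rewrite {1}E; apply/matrixP => a b; rewrite [RHS]mxE.
case: (@split_ordP 1 6 a) => a' ->; case: (@split_ordP 1 6 b) => b' ->; rewrite ?ord1.
- rewrite (ricci_warped_oo openJ oi f0 df dh (gsym i) (gu) (gsm i) Vy).
  rewrite /cone_metric (@block_mxEul _ 1 6 1 6) mxE eqxx mulr1.
  by field; apply: f0.
- rewrite (ricci_warped_or openJ oi f0 df dh (gsym i) (gu) (gsm i) _ Vy).
  by rewrite /cone_metric (@block_mxEur _ 1 6 1 6) mxE mulr0.
- rewrite (ricci_warped_ro openJ oi f0 df dh (gsym i) (gu) (gsm i) _ Vy).
  by rewrite /cone_metric (@block_mxEdl _ 1 6 1 6) mxE mulr0.
rewrite (ricci_warped_rr openJ oi f0 df dh (gsym i) (gu) (gsm i) _ _ Vy).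
rewrite (ein iy) mxE /cone_metric (@block_mxEdr _ 1 6 1 6) mxE (hf Jy).
by move: (g i _ a' b') => G; ring.
Qed.

Lemma cone_scal i y : img (A := cylinder J A) i y -> scal (gphi i) y = 42 * kap.
Proof.
move=> iy; rewrite /scal (cone_ricci iy) -scalemxAr mulVmx; last first.
  have [P E a b p q r u x z _ Eu -> _ _ _ _ _] := cone_frameP su3 tors f_gt0 iy.
  by rewrite unitmx_mul unitmx_tr Eu.
by rewrite mxtraceZ mxtrace1 mulrAC -natrM.
Qed.

Lemma cone_theorem : exists (gphi : metric (cylinder J A)) (vol : dform (cylinder J A) 7),
  [/\ G2_structure (warped_G2 J w psip psim f th) gphi vol,
      class_X234 (warped_G2 J w psip psim f th) gphi vol,
      forall i y, img (A := cylinder J A) i y -> ricci (gphi i) y = (6 * kap) *: gphi i y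
    & scal_eq gphi (42 * kap)].
Proof.
exists gphi, (@cone_vol R L A w J f); rewrite cone_phiE; split.
- exact: (cone_G2_structure atlasA su3 tors openJ f_gt0 df dh dth).
- exact: (cone_class_X234 atlasA su3 cpl tors openJ f_gt0 df dh dth).
- exact: cone_ricci.
- exact: cone_scal.
Qed.

End ConeTheorem.

(** * The functions theta *)

Section Theta.
Variables (R : realType) (c : R).

Lemma sin_2atan (x : R) : sin (2 * atan x) = 2 * x / (1 + x ^+ 2).
Proof.
have [/andP[a1 a2] tx] := atan_def x.
have C0 : cos (atan x) != 0 by rewrite gt_eqF // cos_gt0_pihalf // a1.
have Sx : sin (atan x) = x * cos (atan x) by rewrite -{2}tx /tan divfK.
rewrite (_ : 2 * atan x = atan x *+ 2) ?mulr_natl // sin_mulr2n Sx.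
have <- : cos (atan x) ^- 2 = 1 + x ^+ 2 by rewrite cos2_tan2 // tx.
by rewrite invrK -mulr_natl expr2; ring.
Qed.

(** For x > 0 the angle 2 atan x lies in (0, pi). It is within the range of asin exactly when x <=
    1; otherwise its supplement, with the same sine, is. *)
Lemma asin_sin_2atan (x : R) : 0 < x ->
  (if x <= 1 then asin (2 * x / (1 + x ^+ 2)) else pi - asin (2 * x / (1 + x ^+ 2)))
  = 2 * atan x.
Proof.
move=> x0; rewrite -sin_2atan; have p0 := pi_gt0 R.
have a0 : 0 < atan x by rewrite -(atan0 R); apply: lt_atan.
have a2 := atan_ltpi2 x.
case: ifPn => [x1|]; last rewrite -ltNge => x1.
  have a1 : atan x <= pi / 4 by rewrite -(atan1 R); apply: le_atan.
  by rewrite sinK // in_itv /=; lra.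
have a1 : pi / 4 < atan x by rewrite -(atan1 R); apply: lt_atan.
have -> : sin (2 * atan x) = sin (pi - 2 * atan x).
  by rewrite sinB sinpi cospi mul0r sub0r mulN1r opprK.
by rewrite sinK ?in_itv /=; lra.
Qed.

Lemma theta_arcsinE (u : R) : 0 < u ->
  theta_arcsin c u = 2 * atan (u `^ (- 2 * c)).
Proof.
move=> u0; rewrite -asin_sin_2atan ?powR_gt0 // /theta_arcsin.
have -> // : u `^ (- 4 * c) = (u `^ (- 2 * c)) ^+ 2.
by rewrite -powR_mulrn ?powR_ge0 // -powRrM; congr (_ `^ _); ring.
Qed.

(** With x = u^{-2c} and u' = u/f, x' = - 2 c x / f; hence theta = 2 atan x has theta' = - (2 c / f)
    2 x / (1 + x^2), and the last fraction is sin theta. *)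
Lemma theta_arcsin_ode (J : set R) (u : R -> R) (f : R -> R) : open J ->
  (forall t, J t -> 0 < u t) -> (forall t, J t -> f t != 0) ->
  (forall t, J t -> is_derive t 1 u (u t / f t)) ->
  forall t, J t -> is_derive t 1 (fun t => theta_arcsin c (u t))
    (- (2 * c * sin (theta_arcsin c (u t)) / f t)).
Proof.
move=> oJ u0 f0 du t Jt; have ut := u0 t Jt; have ft := f0 t Jt.
have near_eq : \near t, 2 * atan (u t `^ (- 2 * c)) = theta_arcsin c (u t).
  have : \forall z \near t, J z by exact: open_nbhs_nbhs.
  by apply: filterS => z /u0 uz; rewrite theta_arcsinE.
apply: near_eq_is_derive near_eq _.
have D1 := is_derive1_comp (is_derive1_powR (- 2 * c) ut) (du t Jt).
have D2 := is_deriveMl 2 (is_derive1_comp (is_derive1_atan _) D1).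
apply: (is_derive_eq D2); rewrite /= theta_arcsinE // sin_2atan.
have -> : u t `^ (- 2 * c - 1) = u t `^ (- 2 * c) / u t.
  rewrite powRB ?powRr1 ?(ltW ut) //.
  by apply/implyP => _; rewrite gt_eqF.
have : 0 < 1 + (u t `^ (- 2 * c)) ^+ 2 by rewrite ltr_pwDl // sqr_ge0.
move: (u t `^ _) => x /lt0r_neq0 x0.
by field; rewrite x0 ft gt_eqF.
Qed.

End Theta.

Section Hyperbolic.
Variable R : realType.
Implicit Types t : R.

Lemma is_derive_expRN t : is_derive t 1 (fun t => expR (- t)) (- expR (- t)).
Proof.
have H := is_derive1_comp (is_derive_expR (- t)) (is_deriveN (is_derive_id t 1)).
by apply: (is_derive_eq H); rewrite mulrN1.
Qed.

Lemma is_derive_sinh t : is_derive t 1 (@sinh R) (cosh t).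
Proof.
have H := is_deriveMl 2^-1 (is_deriveB (is_derive_expR t) (is_derive_expRN t)).
rewrite (_ : @sinh R = fun t => 2^-1 * (expR t - expR (- t))).
  by apply: (is_derive_eq H); rewrite opprK mulrC.
by apply/funext => s; rewrite /sinh mulrC.
Qed.

Lemma is_derive_cosh t : is_derive t 1 (@cosh R) (sinh t).
Proof.
have H := is_deriveMl 2^-1 (is_deriveD (is_derive_expR t) (is_derive_expRN t)).
rewrite (_ : @cosh R = fun t => 2^-1 * (expR t + expR (- t))).
  by apply: (is_derive_eq H); rewrite mulrC.
by apply/funext => s; rewrite /cosh mulrC.
Qed.

Lemma cosh_gt0 t : 0 < cosh t.
Proof. by rewrite /cosh divr_gt0 // addr_gt0 // expR_gt0. Qed.

Lemma sinh_gt0 t : 0 < t -> 0 < sinh t.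
Proof. by move=> t0; rewrite /sinh divr_gt0 // subr_gt0 ltr_expR; lra. Qed.

Lemma cosh2_sinh2 t : cosh t ^+ 2 - sinh t ^+ 2 = 1.
Proof.
have E : expR t * expR (- t) = 1 by rewrite -expRD subrr expR0.
by rewrite -E /cosh /sinh; field.
Qed.

Lemma sinh_half t : sinh t = 2 * sinh (t / 2) * cosh (t / 2).
Proof.
have E (s : R) : expR s = expR (s / 2) * expR (s / 2) by rewrite -expRD; congr expR; field.
rewrite /sinh /cosh (E t) (E (- t)) mulNr.
by field.
Qed.

Lemma is_derive_half t : is_derive t 1 (fun t => t / 2) (2^-1 : R).
Proof.
have H := is_deriveMl 2^-1 (is_derive_id t (1 : R)).
under eq_fun do rewrite mulrC.
by apply: (is_derive_eq H); rewrite mulr1.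
Qed.

Lemma is_derive_tanh_half t : 0 < t ->
  is_derive t 1 (fun t => tanh (t / 2)) (tanh (t / 2) / sinh t).
Proof.
move=> t0; have C0 : cosh (t / 2) != 0 by rewrite gt_eqF // cosh_gt0.
have S0 : sinh (t / 2) != 0 by rewrite gt_eqF // sinh_gt0 // divr_gt0.
have Hc : is_derive t 1 (fun s => cosh (s / 2)) (sinh (t / 2) * 2^-1).
  exact: @is_derive1_comp R _ (fun s => s / 2) t _ _
    (is_derive_cosh (t / 2)) (is_derive_half t).
have Hs : is_derive t 1 (fun s => sinh (s / 2)) (cosh (t / 2) * 2^-1).
  exact: @is_derive1_comp R _ (fun s => s / 2) t _ _
    (is_derive_sinh (t / 2)) (is_derive_half t).
have H := is_derive_mul Hs (@is_derive_inv R R (fun s => cosh (s / 2)) _ _ _ C0 Hc).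
apply: (is_derive_eq H); rewrite (sinh_half t) /tanh.
have rel : cosh (t / 2) ^+ 2 = 1 + sinh (t / 2) ^+ 2.
  by apply/eqP; rewrite -subr_eq cosh2_sinh2.
by field: rel; rewrite ?C0 ?S0.
Qed.

Lemma is_derive_tan_half t : 0 < t < pi ->
  is_derive t 1 (fun t => tan (t / 2)) (tan (t / 2) / sin t).
Proof.
move=> /andP[t0 tp]; have C0 : cos (t / 2) != 0.
  by rewrite gt_eqF // cos_gt0_pihalf //; lra.
have S0 : sin (t / 2) != 0 by rewrite gt_eqF // sin_gt0_pihalf //; lra.
have H := @is_derive1_comp R _ (fun s => s / 2) t _ _
  (is_derive_tan C0) (is_derive_half t).
apply: (is_derive_eq H).
have -> : sin t = 2 * (cos (t / 2) * sin (t / 2)).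
  by rewrite mulr_natl -sin_mulr2n -mulr_natl; congr sin; field.
rewrite /tan; field.
by rewrite C0 S0.
Qed.

End Hyperbolic.

Theorem theorem4p18 (R : realType) (L : topologicalType) (A : charts R L 6)
    (w : dform A 2) (psip psim : dform A 3) (g : metric A) (c : R)
    (sigma2 : dform A 2) :
  smooth_manifold A ->
  SU3_structure w psip psim g ->
  coupled w psip c ->
  coupled_torsion w psip psim g (- (2 * c / 3)) sigma2 ->
  nonzero_form sigma2 ->
  einstein g ->
  scal_eq g 30 ->
  [/\ let J := [set t : R | 0 < t] in
      let phi := warped_G2 J w psip psim (fun t => t)
                   (fun t => theta_arcsin c t) in
      exists (gphi : metric (cylinder J A)) (vol : dform (cylinder J A) 7),
        [/\ G2_structure phi gphi vol, class_X234 phi gphi vol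
          & ricci_flat gphi],
      let J := [set t : R | 0 < t < pi] in
      let phi := warped_G2 J w psip psim (fun t => sin t)
                   (fun t => theta_arcsin c (tan (t / 2))) in
      exists (gphi : metric (cylinder J A)) (vol : dform (cylinder J A) 7),
        [/\ G2_structure phi gphi vol, class_X234 phi gphi vol,
            einstein gphi & scal_eq gphi 42]
    & let J := [set t : R | 0 < t] in
      let phi := warped_G2 J w psip psim (fun t => sinh t)
                   (fun t => theta_arcsin c (tanh (t / 2))) in
      exists (gphi : metric (cylinder J A)) (vol : dform (cylinder J A) 7),
        [/\ G2_structure phi gphi vol, class_X234 phi gphi vol,
            einstein gphi & scal_eq gphi (- 42)]].
Proof.
move=> [_ _ atlasA] su3 [_ cpl] tors [i0 [x0 [_ [ix0 _]]]] [lambda ein] scal30.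
(* The trace of Ric = lambda g is 6 lambda = 30. It is evaluated at the point [x0] where sigma_2
   does not vanish, which ensures that L is nonempty. *)
have lambda5 : lambda = 5.
  have := scal30 _ _ ix0; rewrite /scal ein // -scalemxAr mulVmx; last first.
    have [P [Pu _ ->]] := frame_at su3 ix0.
    by rewrite unitmx_mul unitmx_tr Pu.
  by rewrite mxtraceZ mxtrace1 => E; lra.
rewrite {}lambda5 in ein.
have openR : open [set t : R | 0 < t] by exact: open_gt.
have openP : open [set t : R | 0 < t < pi].
  rewrite (_ : [set t | _] = [set t : R | 0 < t] `&` [set t | t < pi]).
    by apply: openI; [exact: open_gt|exact: open_lt].
  by apply/seteqP; split=> t /= => [/andP[]|[-> ->]].
have cone := cone_theorem atlasA su3 cpl tors ein.
split=> J phi.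
- have d1 t : J t -> is_derive t 1 (fun t : R => t) 1 by move=> _; exact: is_derive_id.
  (* The unsimplified factor lets [cone] infer kappa = 0; likewise kappa = 1 and kappa = -1 in the
     next two cases. *)
  have d2 t : J t -> is_derive t 1 (fun=> 1 : R) (- 0 * t).
    by move=> _; rewrite oppr0 mul0r; exact: is_derive_cst.
  have n1 t : J t -> 1 ^+ 2 = 1 - 0 * t ^+ 2 by move=> _; rewrite expr1n mul0r subr0.
  have th : forall t, J t -> is_derive t 1 (fun t => theta_arcsin c t)
      (- (2 * c * sin (theta_arcsin c t) / t)).
    apply: (theta_arcsin_ode c (u := fun t => t) openR) => // t t0.
      by rewrite gt_eqF.
    by rewrite divff ?gt_eqF //; exact: is_derive_id.
  have [gphi [vol [G X Ric _]]] := cone _ _ _ _ _ openR (fun t t0 => t0) d1 d2 n1 th.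
  by exists gphi, vol; split=> // i y iy; rewrite Ric // mulr0 scale0r.
- have sin0 t : J t -> 0 < sin t by exact: sin_gt0_pi.
  have d1 t : J t -> is_derive t 1 (@sin R) (cos t) by move=> _; exact: is_derive_sin.
  have d2 t : J t -> is_derive t 1 (@cos R) (- 1 * sin t).
    by move=> _; rewrite mulN1r; exact: is_derive_cos.
  have n1 t : J t -> cos t ^+ 2 = 1 - 1 * sin t ^+ 2.
    by move=> _; rewrite mul1r cos2sin2.
  have th : forall t, J t -> is_derive t 1 (fun t => theta_arcsin c (tan (t / 2)))
      (- (2 * c * sin (theta_arcsin c (tan (t / 2))) / sin t)).
    apply: (theta_arcsin_ode c (u := fun t => tan (t / 2)) openP) => t Jt.
    + have /andP[t0 tp] := Jt; rewrite /tan divr_gt0 //.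
        by apply: sin_gt0_pihalf; lra.
      by apply: cos_gt0_pihalf; lra.
    + by rewrite gt_eqF // sin0.
    (* The half angle makes u'/u = 1/f: the logarithmic derivative of tan(t/2) is 1/sin t, and that
       of tanh(t/2) in the last case is 1/sinh t. *)
    + exact: is_derive_tan_half.
  have [gphi [vol [G X Ric Sc]]] := cone _ _ _ _ _ openP sin0 d1 d2 n1 th.
  rewrite mulr1 in Sc; exists gphi, vol; split=> //.
  by exists (6 * 1) => i y iy; apply: Ric.
- have d1 t : J t -> is_derive t 1 (@sinh R) (cosh t).
    by move=> _; exact: is_derive_sinh.
  have d2 t : J t -> is_derive t 1 (@cosh R) (- -1 * sinh t).
    by move=> _; rewrite opprK mul1r; exact: is_derive_cosh.
  have n1 t : J t -> cosh t ^+ 2 = 1 - -1 * sinh t ^+ 2.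
    by move=> _; apply/eqP; rewrite mulN1r opprK -subr_eq cosh2_sinh2.
  have th : forall t, J t -> is_derive t 1 (fun t => theta_arcsin c (tanh (t / 2)))
      (- (2 * c * sin (theta_arcsin c (tanh (t / 2))) / sinh t)).
    apply: (theta_arcsin_ode c (u := fun t => tanh (t / 2)) openR) => t Jt.
    + by rewrite /tanh divr_gt0 ?cosh_gt0 // sinh_gt0 // divr_gt0.
    + by rewrite gt_eqF // sinh_gt0.
    + exact: is_derive_tanh_half.
  have [gphi [vol [G X Ric Sc]]] := cone _ _ _ _ _ openR (@sinh_gt0 R) d1 d2 n1 th.
  rewrite mulrN1 in Sc; exists gphi, vol; split=> //.
  by exists (6 * -1) => i y iy; apply: Ric.
Qed.
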